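(* Let $\Sigma$ be a closed spacelike codimension-two submanifold in an $(n+1)$-dimensional spacetime of constant curvature. Suppose $\Sigma$ is torsion-free with respect to the null frame $L$ and $\underline L$. Let $r,s$ be non-negative integers with $1\le r+s\le n-1$. If $r\ge1$, then $$2\int_\Sigma P_{r-1,s}(\chi,\underline\chi)\Big\langle L,\frac{\partial}{\partial t}\Big\rangle d\mu+\frac{r+s}{n-(r+s)}\int_\Sigma P_{r,s}(\chi,\underline\chi)\,Q(L,\underline L)\,d\mu=0,$$ and if $s\ge1$, then $$2\int_\Sigma P_{r,s-1}(\chi,\underline\chi)\Big\langle \underline L,\frac{\partial}{\partial t}\Big\rangle d\mu-\frac{r+s}{n-(r+s)}\int_\Sigma P_{r,s}(\chi,\underline\chi)\,Q(L,\underline L)\,d\mu=0.$$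
   Context: Spacetimes of constant curvature are the Minkowski, de Sitter and anti-de Sitter spacetimes, with metric in static coordinates $\bar g=\langle\cdot,\cdot\rangle=-(1+\kappa r^2)dt^2+\frac{1}{1+\kappa r^2}dr^2+r^2g_{S^{n-1}}$ ($\kappa=0$, $\kappa<0$, $\kappa>0$ respectively); $Q=r\,dr\wedge dt$, with $(dr\wedge dt)(X,Y)=dr(X)dt(Y)-dt(X)dr(Y)$, and $\frac{\partial}{\partial t}$ refer to these coordinates. $D$ is the Levi-Civita connection of $\bar g$. $L,\underline L$ are null normal vector fields along $\Sigma$ with $\langle L,\underline L\rangle=-2$. The null second fundamental forms are $\chi_{ab}=\langle D_{\partial_a}L,\partial_b\rangle$, $\underline\chi_{ab}=\langle D_{\partial_a}\underline L,\partial_b\rangle$. $\Sigma$ is torsion-free with respect to $L,\underline L$ if $\zeta_L(V)=\frac12\langle D_VL,\underline L\rangle=0$ for all $V\in T\Sigma$. With $\sigma$ the induced metric on $\Sigma$, the mixed higher order mean curvatures $P_{r,s}(\chi,\underline\chi)$, $0\le r+s\le n-1$, are defined by the expansion (determinant taken relative to $\sigma$, i.e. in a $\sigma$-orthonormal frame) $$\det(\sigma+y\chi+\underline y\,\underline\chi)=\sum_{0\le r+s\le n-1}\frac{(r+s)!}{r!\,s!}\,y^r\underline y^sP_{r,s}(\chi,\underline\chi),$$ with $y,\underline y$ real variables. *)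

(* Defs.v *)
From HB Require Import structures.
From mathcomp Require Import all_boot all_order all_algebra.
From mathcomp Require Import ring zify.
From mathcomp Require Import all_classical all_reals all_analysis.
Import Order.TTheory GRing.Theory Num.Theory.
Import numFieldNormedType.Exports.

Set Implicit Arguments.
Unset Strict Implicit.
Unset Printing Implicit Defensive.

Local Open Scope classical_set_scope.
Local Open Scope ring_scope.

Section Calculus.
Context {R : realType} {m : nat}.

Definition basis_vec (a : 'I_m) : 'rV[R]_m := delta_mx 0 a.

Fixpoint iter_partial (f : 'rV[R]_m -> R) (s : seq 'I_m) : 'rV[R]_m -> R :=
  if s is a :: s' then fun x => 'D_(basis_vec a) (iter_partial f s') x else f.

(* C^oo on an open set: all iterated partial derivatives exist and are
   continuous. *)
Definition smooth_on (U : set 'rV[R]_m) (f : 'rV[R]_m -> R) : Prop :=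
  forall (s : seq 'I_m) (x : 'rV[R]_m), U x ->
    {for x, continuous (iter_partial f s)} /\
    (forall a : 'I_m, derivable (iter_partial f s) x (basis_vec a)).

Definition dir_deriv N (V : 'rV[R]_m -> 'rV[R]_N) (v x : 'rV[R]_m) : 'rV[R]_N :=
  \row_k 'D_v (fun y => V y 0 k) x.

End Calculus.

(* The integral over R^m with respect to Lebesgue measure, as an iterated
   one-dimensional integral; it is only applied to nonnegative Borel functions,
   for which this is Tonelli's theorem. *)
Fixpoint lebesgue_int {R : realType} (m : nat) :
    ('rV[R]_m -> \bar R) -> \bar R :=
  match m with
  | 0%N => fun f => f 0
  | m'.+1 => fun f =>
      (\int[@lebesgue_measure R]_(t in [set: R])
         lebesgue_int (fun v : 'rV[R]_m' => f (row_mx (t%:M : 'rV[R]_1) v)))%E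
  end.

(* A smooth m-dimensional manifold without boundary on the space T: for every
   point p, [chart p] is a chart around p, with domain [dom p] and inverse
   [param p]. A manifold given by an arbitrary atlas is of this form, a chart
   of the atlas being chosen around each point. *)
Record manifold (R : realType) (m : nat) (T : ptopologicalType) := Manifold {
  dom : T -> set T;
  chart : T -> T -> 'rV[R]_m;
  param : T -> 'rV[R]_m -> T;
  dom_center : forall p, dom p p;
  dom_open : forall p, open (dom p);
  chart_image_open : forall p, open (chart p @` dom p);
  chartK : forall p q, dom p q -> param p (chart p q) = q;
  chart_continuous : forall p q, dom p q -> {for q, continuous (chart p)};
  param_continuous : forall p x, (chart p @` dom p) x ->
    {for x, continuous (param p)};
  transition_smooth : forall p q (a : 'I_m),
    smooth_on (chart p @` (dom p `&` dom q))
              (fun x => chart q (param p x) 0 a)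
}.

Definition chart_image {R : realType} {m} {T : ptopologicalType}
  (S : manifold R m T) (p : T) : set 'rV[R]_m := chart S p @` dom S p.

Section LeviCivita.
Context {R : realType} {N : nat}.

(* A metric on (an open subset of) R^N: [g z X Y] is the product at the point z
   of the tangent vectors with components X and Y. *)
Variable g : 'rV[R]_N -> 'rV[R]_N -> 'rV[R]_N -> R.

Definition metric_mx (z : 'rV[R]_N) : 'M[R]_N :=
  \matrix_(i, j) g z (basis_vec i) (basis_vec j).

Definition christoffel (z : 'rV[R]_N) (k i j : 'I_N) : R :=
  2^-1 * \sum_l invmx (metric_mx z) k l *
    ('D_(basis_vec i) (fun y => metric_mx y j l) z
     + 'D_(basis_vec j) (fun y => metric_mx y i l) z
     - 'D_(basis_vec l) (fun y => metric_mx y i j) z).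

(* D_v V at x, for the Levi-Civita connection D of g and a vector field V
   along the map f. *)
Definition cov_deriv m (f V : 'rV[R]_m -> 'rV[R]_N) (v x : 'rV[R]_m)
    : 'rV[R]_N :=
  dir_deriv V v x +
  \row_k \sum_i \sum_j
    christoffel (f x) k i j * dir_deriv f v x 0 i * V x 0 j.

End LeviCivita.

(* A point of the spacetime is a row z of length n+1: z 0 ord0 is the static
   time t, and the remaining n entries are x = r omega with omega in S^(n-1).
   In these coordinates r dr = x . dx and r^2 g_{S^(n-1)} = |dx|^2 - dr^2, so
   that metric and two-form are defined at r = 0 too; see [static_metric_polar]
   and [Qform_polar]. *)
Section Static.
Context {R : realType} {n : nat}.
Implicit Types z X Y : 'rV[R]_n.+1.

Definition time_part X : R := X 0 ord0.

Definition space_part X : 'rV[R]_n := \row_i X 0 (lift ord0 i).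

Definition dotp k (u v : 'rV[R]_k) : R := \sum_i u 0 i * v 0 i.

Definition radius2 z : R := dotp (space_part z) (space_part z).

(* For kappa < 0 this contains the static patch and also the region beyond the
   cosmological horizon, where the same expression is the de Sitter metric. *)
Definition static_domain (kappa : R) : set 'rV[R]_n.+1 :=
  [set z | 1 + kappa * radius2 z != 0].

Definition static_metric (kappa : R) z X Y : R :=
  - (1 + kappa * radius2 z) * (time_part X * time_part Y)
  + dotp (space_part X) (space_part Y)
  - kappa / (1 + kappa * radius2 z)
    * (dotp (space_part z) (space_part X) * dotp (space_part z) (space_part Y)).

Definition partial_t : 'rV[R]_n.+1 := basis_vec ord0.

Definition Qform z X Y : R :=
  dotp (space_part z) (space_part X) * time_part Y
  - time_part X * dotp (space_part z) (space_part Y).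

Definition static_point (t : R) (x : 'rV[R]_n) : 'rV[R]_n.+1 :=
  row_mx (t%:M : 'rV[R]_1) x.

End Static.

Section Submanifold.
Context {R : realType} {m N : nat} {T : ptopologicalType}.
Variables (S : manifold R m T) (g : 'rV[R]_N -> 'rV[R]_N -> 'rV[R]_N -> R).

Definition smooth_map (V : T -> 'rV[R]_N) : Prop :=
  forall p (k : 'I_N), smooth_on (chart_image S p) (fun x => V (param S p x) 0 k).

Variable F : T -> 'rV[R]_N.

Definition pushforward (p : T) (x v : 'rV[R]_m) : 'rV[R]_N :=
  dir_deriv (F \o param S p) v x.

(* Positivity also makes F an immersion. *)
Definition spacelike : Prop :=
  forall p x, chart_image S p x -> forall v : 'rV[R]_m, v != 0 ->
    0 < g (F (param S p x)) (pushforward p x v) (pushforward p x v).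

Definition induced_metric (p : T) (x : 'rV[R]_m) : 'M[R]_m :=
  \matrix_(a, b) g (F (param S p x)) (pushforward p x (basis_vec a))
                                     (pushforward p x (basis_vec b)).

Definition normal_field (V : T -> 'rV[R]_N) : Prop :=
  forall p x, chart_image S p x -> forall v : 'rV[R]_m,
    g (F (param S p x)) (V (param S p x)) (pushforward p x v) = 0.

Definition null_frame (L Lb : T -> 'rV[R]_N) : Prop :=
  [/\ normal_field L, normal_field Lb &
      forall p, [/\ g (F p) (L p) (L p) = 0, g (F p) (Lb p) (Lb p) = 0
                  & g (F p) (L p) (Lb p) = - 2]].

Definition cov_deriv_along (V : T -> 'rV[R]_N) (p : T) (v x : 'rV[R]_m) :=
  cov_deriv g (F \o param S p) (V \o param S p) v x.

Definition null_second_form (V : T -> 'rV[R]_N) (p : T) (x : 'rV[R]_m)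
    : 'M[R]_m :=
  \matrix_(a, b) g (F (param S p x)) (cov_deriv_along V p (basis_vec a) x)
                                     (pushforward p x (basis_vec b)).

Definition torsion (L Lb : T -> 'rV[R]_N) (p : T) (x v : 'rV[R]_m) : R :=
  2^-1 * g (F (param S p x)) (cov_deriv_along L p v x) (Lb (param S p x)).

Definition torsion_free (L Lb : T -> 'rV[R]_N) : Prop :=
  forall p x, chart_image S p x -> forall v : 'rV[R]_m, torsion L Lb p x v = 0.

(* mu is the measure d mu of the induced metric: sqrt (det sigma) dx in every
   chart. *)
Definition area_measure
    (mu : {measure set (g_sigma_algebraType (@open T)) -> \bar R}) : Prop :=
  forall (p : T) (A : set (g_sigma_algebraType (@open T))),
    measurable A -> A `<=` dom S p ->
    mu A = lebesgue_int (fun x =>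
      (\1_(chart S p @` A) x * Num.sqrt (\det (induced_metric p x)))%:E).

End Submanifold.

Section MixedCurvature.
Context {R : realType} {m : nat}.
Variables sigma chi chib : 'M[R]_m.

(* det (sigma + y chi + yb chib), with y = 'X and yb = 'X%:P. *)
Definition mixed_det : {poly {poly R}} :=
  \det (\matrix_(a, b) ((sigma a b)%:P%:P + 'X * (chi a b)%:P%:P
                        + 'X%:P * (chib a b)%:P%:P) : 'M[{poly {poly R}}]_m).

(* Passing to a sigma-orthonormal frame divides the determinant by det sigma. *)
Definition mixed_mean_curvature (r s : nat) : R :=
  (r`! * s`!)%:R / ((r + s)`!)%:R * (mixed_det`_r)`_s / \det sigma.

End MixedCurvature.

(* P_{r,s}(chi, chib) at the point p; its value there does not depend on the
   chart, and the chart around p is used. *)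
Definition mixedP {R : realType} {m N : nat} {T : ptopologicalType}
    (S : manifold R m T) (g : 'rV[R]_N -> 'rV[R]_N -> 'rV[R]_N -> R)
    (F L Lb : T -> 'rV[R]_N) (r s : nat) (p : T) : R :=
  let x := chart S p p in
  mixed_mean_curvature (induced_metric S g F p x)
    (null_second_form S g F L p x) (null_second_form S g F Lb p x) r s.

Section Checks.
Context {R : realType}.

Lemma space_part_static n (t : R) (x : 'rV[R]_n) :
  space_part (static_point t x) = x.
Proof.
apply/rowP => i; rewrite mxE /static_point mxE.
case: splitP => j /=; first by rewrite (ord1 j).
by rewrite /bump /= !add1n => -[/val_inj ->].
Qed.

Lemma time_part_static n (t : R) (x : 'rV[R]_n) :
  time_part (static_point t x) = t.
Proof.
rewrite /time_part /static_point mxE; case: splitP => j //= _.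
by rewrite mxE (ord1 j) eqxx.
Qed.

Lemma dotpC n (u v : 'rV[R]_n) : dotp u v = dotp v u.
Proof. by apply: eq_bigr => i _; rewrite mulrC. Qed.

Lemma dotpDl n (u v w : 'rV[R]_n) : dotp (u + v) w = dotp u w + dotp v w.
Proof. by rewrite /dotp -big_split; apply: eq_bigr => i _; rewrite mxE mulrDl. Qed.

Lemma dotpZl n a (u v : 'rV[R]_n) : dotp (a *: u) v = a * dotp u v.
Proof. by rewrite /dotp big_distrr; apply: eq_bigr => i _; rewrite mxE -mulrA. Qed.

Lemma dotpDr n (u v w : 'rV[R]_n) : dotp u (v + w) = dotp u v + dotp u w.
Proof. by rewrite dotpC dotpDl !(dotpC u). Qed.

Lemma dotpZr n a (u v : 'rV[R]_n) : dotp u (a *: v) = a * dotp u v.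
Proof. by rewrite dotpC dotpZl dotpC. Qed.

(* The tangent vector with components (dt, dr, d omega) = (tau, rho, theta) in
   polar coordinates is static_point tau (rho *: omega + r *: theta). *)
Lemma static_metric_polar n (kappa t r tau rho tau' rho' : R)
    (omega theta theta' : 'rV[R]_n) :
  dotp omega omega = 1 -> dotp omega theta = 0 -> dotp omega theta' = 0 ->
  1 + kappa * r ^+ 2 != 0 ->
  static_metric kappa (static_point t (r *: omega))
    (static_point tau (rho *: omega + r *: theta))
    (static_point tau' (rho' *: omega + r *: theta'))
  = - (1 + kappa * r ^+ 2) * (tau * tau')
    + (1 + kappa * r ^+ 2)^-1 * (rho * rho') + r ^+ 2 * dotp theta theta'.
Proof.
move=> h1 h2 h3 h4.
rewrite /static_metric /radius2 !space_part_static !time_part_static.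
rewrite !(dotpDl, dotpDr, dotpZl, dotpZr) (dotpC theta omega) h1 h2 h3.
have -> : r * (r * 1) = r ^+ 2 by rewrite mulr1 -expr2.
by field.
Qed.

Lemma Qform_polar n (t r tau rho tau' rho' : R) (omega theta theta' : 'rV[R]_n) :
  dotp omega omega = 1 -> dotp omega theta = 0 -> dotp omega theta' = 0 ->
  Qform (static_point t (r *: omega))
    (static_point tau (rho *: omega + r *: theta))
    (static_point tau' (rho' *: omega + r *: theta'))
  = r * (rho * tau' - tau * rho').
Proof.
move=> h1 h2 h3.
rewrite /Qform !space_part_static !time_part_static.
rewrite !(dotpDl, dotpDr, dotpZl, dotpZr) h1 h2 h3; ring.
Qed.

Definition bidegree_le (d : nat) (P : {poly {poly R}}) : Prop :=
  forall i j, (d < i + j)%N -> P`_i`_j = 0.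

Lemma bidegree_leD d P1 P2 :
  bidegree_le d P1 -> bidegree_le d P2 -> bidegree_le d (P1 + P2).
Proof. by move=> h1 h2 i j h; rewrite !coefD h1 // h2 // addr0. Qed.

Lemma bidegree_leM d1 d2 P1 P2 :
  bidegree_le d1 P1 -> bidegree_le d2 P2 -> bidegree_le (d1 + d2) (P1 * P2).
Proof.
move=> h1 h2 i j h; rewrite coefM coef_sum big1 // => k _.
rewrite coefM big1 // => l _.
have [hk|hk] := ltnP d1 (k + l); first by rewrite h1 // mul0r.
rewrite h2 ?mulr0 //; have := ltn_ord k; have := ltn_ord l; lia.
Qed.

Lemma bidegree_leC d (c : R) : bidegree_le d c%:P%:P.
Proof.
move=> [|i] j h; rewrite coefC ?coef0 // coefC /=.
by case: j h.
Qed.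

Lemma bidegree_mixed_det m (sigma chi chib : 'M[R]_m) :
  bidegree_le m (mixed_det sigma chi chib).
Proof.
rewrite /mixed_det /determinant.
apply: (big_ind (bidegree_le m)) => [i j _||s _]; first by rewrite !coef0.
  exact: bidegree_leD.
have -> : ((-1) ^+ (perm.odd_perm s) : {poly {poly R}})
          = ((-1) ^+ (perm.odd_perm s))%:P%:P.
  by rewrite !(rmorphXn, rmorphN1).
rewrite -[m in bidegree_le m]add0n; apply: bidegree_leM.
  exact: bidegree_leC.
rewrite -[m in bidegree_le m](card_ord m) -sum1_card.
apply: (big_ind2 bidegree_le) => [|d1 P1 d2 P2|a _].
- by rewrite -polyC1 -polyC1; exact: bidegree_leC.
- exact: bidegree_leM.
rewrite mxE; apply: bidegree_leD; first apply: bidegree_leD.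
- exact: bidegree_leC.
- apply: (@bidegree_leM 1 0); last exact: bidegree_leC.
  move=> i j h.
  by rewrite coefX; case: i h => [|[|i]] //=; rewrite ?coef0 // coef1; case: j.
- apply: (@bidegree_leM 1 0); last exact: bidegree_leC.
  move=> i j h.
  by rewrite coefC; case: i h => [|i] //=; rewrite ?coef0 // coefX; case: j => [|[|]].
Qed.

Lemma horner_bidegree d (P : {poly {poly R}}) (y yb : R) : bidegree_le d P ->
  P.[y%:P].[yb] =
  \sum_(r < d.+1) \sum_(s < d.+1 | (r + s <= d)%N) P`_r`_s * yb ^+ s * y ^+ r.
Proof.
move=> hP.
have hsz : (size P <= d.+1)%N.
  apply/leq_sizeP => i hi; apply/polyP => j; rewrite coef0 hP //; lia.
rewrite (horner_coef_wide _ hsz) horner_sum; apply: eq_bigr => r _.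
rewrite hornerM -rmorphXn hornerC.
have hszr : (size (P`_r)%R <= d.+1)%N.
  by apply/leq_sizeP => i hi; rewrite hP //; lia.
rewrite (horner_coef_wide _ hszr) big_distrl [RHS]big_mkcond /=.
apply: eq_bigr => s _; by case: leqP => // h; rewrite hP // !mul0r.
Qed.

Lemma mixed_mean_curvature_expansion m (sigma chi chib : 'M[R]_m) (y yb : R) :
  \det (sigma + y *: chi + yb *: chib) / \det sigma =
  \sum_(r < m.+1) \sum_(s < m.+1 | (r + s <= m)%N)
     ((r + s)`!)%:R / (r`! * s`!)%:R * y ^+ r * yb ^+ s
     * mixed_mean_curvature sigma chi chib r s.
Proof.
have -> : \det (sigma + y *: chi + yb *: chib)
        = (mixed_det sigma chi chib).[y%:P].[yb].
  rewrite -/(horner_eval y%:P _) -/(horner_eval yb _) /mixed_det -!det_map_mx; congr (\det _).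
  by apply/matrixP => a b; rewrite !mxE /= /horner_eval !hornerE.
rewrite (horner_bidegree y yb (bidegree_mixed_det sigma chi chib)) big_distrl.
apply: eq_bigr => r _; rewrite big_distrl; apply: eq_bigr => s _ /=.
rewrite /mixed_mean_curvature; set D := (\det sigma)^-1.
by field; rewrite !pnatr_eq0 -!lt0n !fact_gt0.
Qed.

End Checks.

(* Main.v *)
From HB Require Import structures.
Require Import Defs.
From mathcomp Require Import all_boot all_order all_algebra.
From mathcomp Require Import perm polyXY ring lra zify.
From mathcomp Require Import all_classical all_reals all_analysis.
From mathcomp Require Import measurable_realfun.
From mathcomp Require finmap.
Import Order.TTheory GRing.Theory Num.Theory.
Import numFieldNormedType.Exports.

Set Implicit Arguments.
Unset Strict Implicit.
Unset Printing Implicit Defensive.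

Local Open Scope classical_set_scope.
Local Open Scope ring_scope.

(** Let [m = n - 1] be the dimension of [Sigma]. For real [y] and [yb] put
    [B = sigma + y chi + yb chib], and let [beta] be the restriction of
    [Q(L, .)] to [Sigma]. The proof integrates the divergence of the tangent
    field [Y = beta adj(B) / det sigma], which is

      (<L, d/dt> tr(sigma adj B) + 1/2 Q(L, Lb) tr(chi adj B)) / det sigma.

    Three facts enter this computation, which is [divergence_identity]. By the
    conformal Killing-Yano equation for [Q] ([is_derive_Qform]), the derivative
    of [beta] along [e_a] consists of a term with [d/dt], which is the first
    summand, of the terms with the second fundamental forms, and of a tangential
    term with the restriction of [Q] to [Sigma]. Since the curvature is constant,
    [D_a D_b L] and [D_a D_b Lb] are symmetric in [a] and [b] ([cov_cov_sym]);
    without torsion this is the Codazzi equation for [chi] and [chib], and it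
    makes [adj B] divergence free ([sum_det_setrow_deriv]). Finally, the shape
    operators of [L] and [Lb] commute (the Ricci equation), so that the
    tangential term is the trace of a skew matrix against a symmetric one and
    drops out ([mxtrace_skew_newton]).

    Both traces are combinations of [det B] and its partial derivatives in [y]
    and [yb]. As a polynomial in [y] and [yb], the divergence therefore has the
    coefficients

      (i+j)! / (i! j!) ((m - (i+j)) P_ij <L, d/dt> + (i+j+1) / 2 P_(i+1)j Q(L, Lb))

    ([density_poly_coef]). The integral of the divergence vanishes for all [y]
    and [yb], hence every coefficient does; the pair [(i, j) = (r - 1, s)] is the
    first formula. Exchanging [L] and [Lb] changes the sign of the torsion and of
    [Q(L, Lb)], and gives the second formula.

    The divergence theorem on a closed manifold ([closed_divergence]) is proved
    with a partition of unity by C^1 functions, the expression of the integral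
    over a chart ([ge0_integral_density]) and the vanishing of the integral over
    R^m of a partial derivative of a function of compact support
    ([integral_derive_eq0]). A tangent field is given by its components in the
    charts, so that one has to know how the geometry changes from one chart to
    another: [sigma], [chi] and [chib] by congruence with the Jacobian matrix,
    whose determinant cancels in [Y] and in the mixed curvatures
    ([current_congruence], [mixed_mean_curvature_congruence]). *)

(** * Determinants and adjugates *)

Section Adjugate.
Context {K : fieldType} {m : nat}.
Implicit Types A B C P : 'M[K]_m.

Let lift A : 'M[{poly K}]_m := char_poly_mx (- A).

Let det_lift A : \det (lift A) != 0.
Proof. by rewrite -/(char_poly _) monic_neq0 // char_poly_monic. Qed.

Let lift0 A : map_mx (horner_eval 0) (lift A) = A.
Proof.
apply/matrixP => i j; rewrite !mxE /horner_eval !hornerE.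
by case: eqP => _ /=; rewrite ?mulr1n ?mulr0n !hornerE ?opprK //= ?add0r ?opprK.
Qed.

Let cancel_adj (M X Y : 'M[{poly K}]_m) :
  \det M != 0 -> X *m M = Y *m M -> X = Y.
Proof.
move=> dM /(congr1 (mulmx^~ (\adj M))); rewrite -!mulmxA mul_mx_adj !mul_mx_scalar.
move=> /matrixP e; apply/matrixP => i j; apply: (mulfI dM).
by have := e i j; rewrite !mxE.
Qed.

(** The identity is clear for invertible matrices; over [{poly K}] the shifts
    ['X + A] and ['X + B] are invertible enough, and ['X] is then set to 0. *)
Lemma adj_mulmx A B : \adj (A *m B) = \adj B *m \adj A.
Proof.
rewrite -{2}(lift0 A) -{2}(lift0 B) -{1}(lift0 A) -{1}(lift0 B) -map_mxM.
rewrite -!map_mx_adj -map_mxM; congr (map_mx _ _).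
apply: (@cancel_adj (lift A *m lift B)).
  by rewrite det_mulmx mulf_neq0 // det_lift.
rewrite mul_adj_mx det_mulmx mulmxA -(mulmxA (\adj _)) mul_adj_mx.
by rewrite mul_mx_scalar -scalemxAl mul_adj_mx scale_scalar_mx.
Qed.

(** The relation survives the shift by ['X], after which [\adj A] is the
    inverse up to a factor. *)
Lemma adj_comm A C : A *m C = C *m A -> \adj A *m C = C *m \adj A.
Proof.
move=> AC; set C' : 'M[{poly K}]_m := map_mx polyC C.
have C'0 : map_mx (horner_eval 0) C' = C.
  by apply/matrixP => i j; rewrite !mxE /horner_eval hornerC.
rewrite -(lift0 A) -C'0 -!map_mx_adj -!map_mxM; congr (map_mx _ _).
have AC' : lift A *m C' = C' *m lift A.
  rewrite /lift /char_poly_mx map_mxN opprK mulmxDl mulmxDr -!map_mxM AC.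
  by rewrite scalar_mxC.
apply: (@cancel_adj (lift A)); first exact: det_lift.
by rewrite -!mulmxA -AC' mulmxA mul_adj_mx scalar_mxC.
Qed.

End Adjugate.

Section RowReplacement.
Context {K : numFieldType} {m : nat}.
Implicit Types (M N : 'M[K]_m) (u v w : 'rV[K]_m).

Definition setrow (i : 'I_m) u M : 'M[K]_m :=
  \matrix_(k, j) if k == i then u 0 j else M k j.

(** Laplace expansion along the row [i]. *)
Lemma det_setrow i u M : \det (setrow i u M) = (u *m \adj M) 0 i.
Proof.
rewrite (expand_det_row _ i) mxE; apply: eq_bigr => j _.
rewrite [\adj _ _ _]mxE [setrow _ _ _ _ _]mxE eqxx; congr (_ * _); rewrite /cofactor.
congr (_ * \det _); apply/matrixP => k l; rewrite !mxE.
by rewrite eq_sym (negbTE (neq_lift _ _)).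
Qed.

Lemma mxtrace_mul_adj N M :
  \tr (N *m \adj M) = \sum_i \det (setrow i (row i N) M).
Proof.
apply: eq_bigr => i _; rewrite det_setrow -row_mul.
by rewrite [RHS]mxE.
Qed.

Lemma setrow_setrow i u v M : setrow i u (setrow i v M) = setrow i u M.
Proof. by apply/matrixP => k l; rewrite !mxE; case: eqP. Qed.

Lemma det_setrow_swap i j u v M : i != j ->
  \det (setrow i u (setrow j v M)) = - \det (setrow i v (setrow j u M)).
Proof.
move=> ij.
have -> : setrow i u (setrow j v M) = xrow i j (setrow i v (setrow j u M)).
  apply/matrixP => k l; rewrite !mxE.
  have [->|ki] := eqVneq k i; first by rewrite tpermL eq_sym (negbTE ij) eqxx.
  have [->|kj] := eqVneq k j; first by rewrite tpermR eqxx.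
  by rewrite (tpermD _ _) 1?[_ == k]eq_sym // (negbTE ki) (negbTE kj).
rewrite xrowE det_mulmx det_perm odd_tperm ij expr1 mulN1r //.
Qed.

(** Here [setrow a u (S a) + setrow a w B *m G a] is the derivative in the
    direction [a] of [setrow a w B]: a symmetric [S a b] cancels against
    [S b a], because exchanging two rows of a determinant changes its sign.
    This is how the Codazzi equation makes the Newton tensors divergence
    free. *)
Lemma sum_det_setrow_deriv (w : 'rV[K]_m) (u : 'I_m -> 'rV[K]_m) B
    (S G : 'I_m -> 'M[K]_m) :
  (forall a b, row b (S a) = row a (S b)) ->
  \sum_a \tr ((setrow a (u a) (S a) + setrow a w B *m G a)
              *m \adj (setrow a w B))
  = \sum_a \det (setrow a (u a) B)
    + \sum_a \tr (G a) * (w *m \adj B) 0 a.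
Proof.
move=> Ssym.
rewrite -big_split /=.
have E a : \tr ((setrow a (u a) (S a) + setrow a w B *m G a)
              *m \adj (setrow a w B))
  = \det (setrow a (u a) B) + \tr (G a) * (w *m \adj B) 0 a
    + \sum_b (if b != a then \det (setrow b (row a (S b)) (setrow a w B)) else 0).
  rewrite mulmxDl raddfD /= (mxtrace_mulC (_ *m G a)) mulmxA mul_adj_mx.
  rewrite mul_scalar_mx mxtraceZ (det_setrow a w B) mxtrace_mul_adj.
  rewrite (bigD1 a) //= -[RHS]addrA [X in _ = _ + X]addrC addrA mulrC; congr (_ + _ + _).
    rewrite setrow_setrow; congr (\det (setrow _ _ _)).
    by apply/rowP => j; rewrite !mxE eqxx.
  rewrite -big_mkcond; apply: eq_bigr => b ba /=.
  congr (\det (setrow _ _ _)); rewrite -Ssym.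
  by apply/rowP => j; rewrite !mxE (negbTE ba).
rewrite (eq_bigr _ (fun a _ => E a)) big_split /= -[RHS]addr0; congr (_ + _).
pose t a b := if b != a then \det (setrow b (row a (S b)) (setrow a w B)) else 0.
have tN a b : t a b = - t b a.
  rewrite /t eq_sym; case: eqVneq => [_|ab]; first by rewrite oppr0.
  rewrite det_setrow_swap; last by rewrite eq_sym.
  rewrite Ssym; congr (- \det _).
  apply/matrixP => k l; rewrite !mxE.
  by have [->|//] := eqVneq k b; rewrite eq_sym (negbTE ab).
rewrite -/(\sum_a \sum_b t a b).
have : \sum_a \sum_b t a b = - \sum_a \sum_b t a b.
  rewrite {1}exchange_big /= -sumrN; apply: eq_bigr => b _.
  by rewrite -sumrN; apply: eq_bigr => a _.
by move/eqP; rewrite -addr_eq0 -mulr2n mulrn_eq0 /= => /eqP.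
Qed.

End RowReplacement.

Section SkewSymmetric.
Context {K : numFieldType} {m : nat}.

Lemma mxtrace_skew_sym (Q N : 'M[K]_m) : Q^T = - Q -> N^T = N ->
  \tr (Q *m N) = 0.
Proof.
move=> QN NN; have : \tr (Q *m N) = - \tr (Q *m N).
  by rewrite -{1}mxtrace_tr trmx_mul QN NN mulmxN raddfN /= mxtrace_mulC.
by move/eqP; rewrite -addr_eq0 -mulr2n mulrn_eq0 /= => /eqP.
Qed.

(** The trace vanishes because [\adj B *m chi *m invmx sigma] is symmetric,
    that is, because the shape operators [chi *m invmx sigma] and
    [chib *m invmx sigma] commute. *)
Lemma mxtrace_skew_newton (sigma chi chib Q : 'M[K]_m) (y yb : K) :
  sigma \in unitmx -> sigma^T = sigma -> chi^T = chi -> chib^T = chib ->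
  Q^T = - Q ->
  chi *m invmx sigma *m chib = chib *m invmx sigma *m chi ->
  \tr (chi *m invmx sigma *m Q *m \adj (sigma + y *: chi + yb *: chib)) = 0.
Proof.
move=> su sT cT cbT QT cc; set S := invmx sigma; set B := _ + _ + _.
have ST : S^T = S by rewrite trmx_inv sT.
have BT : B^T = B by rewrite /B !linearD !linearZ /= sT cT cbT.
have comm : (B *m S) *m (chi *m S) = (chi *m S) *m (B *m S).
  rewrite !mulmxA; congr (_ *m _).
  rewrite /B !(mulmxDl, mulmxDr) -!scalemxAl -!scalemxAr.
  by rewrite mulmxV // mulmxKV // mul1mx cc.
have dS : \det S != 0 by rewrite -unitfE -unitmxE unitmx_inv.
have E : S *m chi *m \adj B = \adj B *m chi *m S.
  have adjS : \adj S = \det S *: sigma.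
    by rewrite -{1}(mulmxKV su (\adj S)) -/S mul_adj_mx mul_scalar_mx.
  have := adj_comm comm; rewrite !adj_mulmx adjS -!scalemxAl -!scalemxAr.
  move/(scalerI dS)/(congr1 (mulmx S)); rewrite !mulmxA mulVmx // mul1mx.
  by move=> ->; rewrite mulmxKV.
rewrite -(mulmxA _ Q) mxtrace_mulC -(mulmxA Q) mxtrace_skew_sym //.
by rewrite !trmx_mul ST cT trmx_adj BT E mulmxA.
Qed.

End SkewSymmetric.

Section PositiveDefinite.
Context {R : realType} {m : nat}.

(** The determinant does not vanish on the segment from the identity to
    [sigma], so it keeps the sign that it has at the identity. *)
Lemma det_posdef_gt0 (sigma : 'M[R]_m) :
  (forall v : 'rV_m, v != 0 -> 0 < (v *m sigma *m v^T) 0 0) -> 0 < \det sigma.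
Proof.
move=> pos.
pose P : {poly R} := \det (\matrix_(i, j)
  ((1%:M i j)%:P + 'X * ((sigma - 1%:M) i j)%:P)).
have PE t : P.[t] = \det (1%:M + t *: (sigma - 1%:M)).
  rewrite -/(horner_eval t P) -det_map_mx; congr (\det _).
  by apply/matrixP => i j; rewrite !mxE /= /horner_eval !hornerE.
have nz t : 0 <= t <= 1 -> P.[t] != 0.
  move=> /andP[t0 t1]; rewrite PE; apply/det0P => -[v v0 vM].
  have : (v *m (1%:M + t *: (sigma - 1%:M)) *m v^T) 0 0 = 0.
    by rewrite vM mul0mx mxE.
  have -> : 1%:M + t *: (sigma - 1%:M) = (1 - t) *: 1%:M + t *: sigma.
    by rewrite scalerBr scalerBl scale1r addrA addrAC.
  rewrite mulmxDr mulmxDl -!scalemxAr -!scalemxAl mulmx1.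
  rewrite [LHS]mxE [X in X + _]mxE [X in _ + X]mxE.
  have q0 : 0 < (v *m v^T) 0 0.
    rewrite mxE; move/rV0Pn: v0 => [i vi].
    rewrite (bigD1 i) //= ltr_pwDl //; first by rewrite mxE -expr2 exprn_even_gt0.
    by apply: sumr_ge0 => j _; rewrite mxE -expr2 sqr_ge0.
  have := pos v v0; move: (_ 0 0) q0 (_ 0 0) => q q0 q' q'0 /eqP.
  apply/negP; rewrite gt_eqF //; have [->|tn0] := eqVneq t 0.
    by rewrite subr0 mul1r mul0r addr0.
  rewrite ltr_wpDl //; first by rewrite mulr_ge0 ?subr_ge0 // ltW.
  by rewrite mulr_gt0 // lt_def tn0.
have P0 : P.[0] = 1 by rewrite PE scale0r addr0 det1.
have P1 : P.[1] = \det sigma by rewrite PE scale1r addrC subrK.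
have : P.[1] != 0 by apply: nz; rewrite ler01 lexx.
rewrite -P1 lt_def => -> /=; rewrite leNgt; apply/negP => lt.
have : root (- P) =1 root P by move=> x; rewrite rootN.
have [|x /andP[x0 x1]] := @poly_ivt R (- P) 0 1 ler01.
  by rewrite !hornerN P0; lra.
by rewrite rootN /root => Px; have := nz x; rewrite x0 x1 Px => /(_ isT).
Qed.

End PositiveDefinite.

Section BivariatePolynomials.
Context {R : realType}.

Lemma poly_eq0_horner (p : {poly R}) : (forall y, p.[y] = 0) -> p = 0.
Proof.
move=> p0; apply/eqP/negPn/negP => pn0.
pose rs : seq R := [seq i%:R | i <- iota 0 (size p)].
have : (size rs < size p)%N.
  apply: max_poly_roots => //; first by apply/allP => x _; rewrite /root p0.
  by rewrite map_inj_uniq ?iota_uniq // => i j /eqP; rewrite eqr_nat => /eqP.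
by rewrite size_map size_iota ltnn.
Qed.

Lemma poly2_eq0_horner (p : {poly {poly R}}) :
  (forall y yb : R, p.[y%:P].[yb] = 0) -> p = 0.
Proof.
move=> p0; apply/polyP => i; rewrite coef0; apply: poly_eq0_horner => yb.
have q0 : map_poly (horner_eval yb) p = 0.
  apply: poly_eq0_horner => y; rewrite -[RHS](p0 y yb).
  by rewrite -{1}(hornerC y yb) -/(horner_eval yb _) horner_map.
by have := congr1 (fun q : {poly R} => q`_i) q0; rewrite coef_map coef0.
Qed.

Lemma mixed_detC m (sigma chi chib : 'M[R]_m) :
  mixed_det sigma chib chi = swapXY (mixed_det sigma chi chib).
Proof.
rewrite /mixed_det -det_map_mx; congr (\det _).
apply/matrixP => a b; rewrite !mxE /= !rmorphD /= !rmorphM /=.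
by rewrite !swapXY_polyC !map_polyC /= swapXY_X map_polyX addrAC.
Qed.

End BivariatePolynomials.

(** * Calculus in R^m *)

Section DirectionalDerivatives.
Context {R : realType} {V : normedModType R}.
Implicit Types (f g : V -> R) (x v : V).

Lemma is_derive_D f g x v df dg : is_derive x v f df -> is_derive x v g dg ->
  is_derive x v (fun y => f y + g y) (df + dg).
Proof. exact: is_deriveD. Qed.

Lemma is_derive_N f x v df : is_derive x v f df ->
  is_derive x v (fun y => - f y) (- df).
Proof. exact: is_deriveN. Qed.

Lemma is_derive_M f g x v df dg : is_derive x v f df -> is_derive x v g dg ->
  is_derive x v (fun y => f y * g y) (df * g x + f x * dg).
Proof.
move=> hf hg; rewrite addrC mulrC [X in _ + X]mulrC mulrC.
by have := is_deriveM hf hg; rewrite /GRing.scale /= [g x * _]mulrC.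
Qed.

Lemma is_derive_V f x v df : f x != 0 -> is_derive x v f df ->
  is_derive x v (fun y => (f y)^-1) (- (f x) ^- 2 * df).
Proof.
move=> fx [hf hd]; apply: DeriveDef; first exact: derivableV.
by rewrite deriveV // hd.
Qed.

(** Along a line, directional derivatives are ordinary ones, to which the
    theorems in one variable apply. *)
Lemma is_derive_line f x v (s : R) df :
  is_derive s (1 : R) (fun t : R => f (t *: v + x)) df <->
  is_derive (s *: v + x) v f df.
Proof.
set g := fun t : R => f (t *: v + x).
have E : (fun h : R => h^-1 *: ((g \o shift s) (h *: (1 : R)) - g s)) =
         (fun h => h^-1 *: ((f \o shift (s *: v + x)) (h *: v) - f (s *: v + x))).
  by apply/funext => h; rewrite /g /= [_%:A]mulr1 scalerDl addrA.
by split=> -[h1 h2]; apply: DeriveDef; move: h1 h2; rewrite /derivable /derive E.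
Qed.

Lemma is_derive_line0 f x v df :
  is_derive (0 : R) (1 : R) (fun t : R => f (t *: v + x)) df <->
  is_derive x v f df.
Proof. by rewrite is_derive_line scale0r add0r. Qed.

Lemma is_derive_shift f w x v df :
  is_derive (x + w) v f df -> is_derive x v (fun y => f (y + w)) df.
Proof.
have E : (fun h : R => h^-1 *: (((fun y => f (y + w)) \o shift x) (h *: v) - f (x + w)))
  = (fun h => h^-1 *: ((f \o shift (x + w)) (h *: v) - f (x + w))).
  by apply/funext => h /=; rewrite addrA.
by move=> -[h1 h2]; apply: DeriveDef; move: h1 h2; rewrite /derivable /derive E.
Qed.

Lemma is_derive_big_sum (I : Type) (s : seq I) (P : pred I) (F : I -> V -> R)
    (dF : I -> R) x v :
  (forall i, P i -> is_derive x v (F i) (dF i)) ->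
  is_derive x v (fun y => \sum_(i <- s | P i) F i y) (\sum_(i <- s | P i) dF i).
Proof.
move=> h; elim: s => [|i s ih].
  under eq_fun do rewrite big_nil; rewrite big_nil; exact: is_derive_cst.
under eq_fun do rewrite big_cons; rewrite big_cons.
by case: ifP => // Pi; apply: is_derive_D => //; exact: h.
Qed.

Lemma is_derive_prod n (F : 'I_n -> V -> R) (dF : 'I_n -> R) x v :
  (forall i, is_derive x v (F i) (dF i)) ->
  is_derive x v (fun y => \prod_i F i y)
    (\sum_i \prod_j (if j == i then dF j else F j x)).
Proof.
elim: n F dF => [|n ih] F dF h.
  under eq_fun do rewrite big_ord0; rewrite big_ord0; exact: is_derive_cst.
under eq_fun do rewrite big_ord_recl.
rewrite big_ord_recl big_ord_recl eqxx.
have -> : \prod_(i < n) (if lift ord0 i == ord0 then dF (lift ord0 i)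
    else F (lift ord0 i) x) = \prod_(i < n) F (lift ord0 i) x by [].
under [X in _ + X]eq_bigr => i _.
  rewrite big_ord_recl /=.
  under eq_bigr do rewrite (inj_eq lift_inj).
  over.
rewrite -big_distrr /=; apply: is_derive_M => //.
exact: ih.
Qed.

(** Jacobi's formula. *)
Lemma is_derive_det n (M : V -> 'M[R]_n) (dM : 'M[R]_n) x v :
  (forall i j, is_derive x v (fun y => M y i j) (dM i j)) ->
  is_derive x v (fun y => \det (M y)) (\tr (dM *m \adj (M x))).
Proof.
move=> h; rewrite /determinant mxtrace_mul_adj.
have -> : \sum_i \det (setrow i (row i dM) (M x)) = \sum_(s : 'S_n)
    (0 * \prod_i M x i (s i) + (-1) ^+ s *
     \sum_i \prod_j (if j == i then dM j (s j) else M x j (s j))).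
  rewrite exchange_big; apply: eq_bigr => s _; rewrite mul0r add0r big_distrr.
  apply: eq_bigr => i _; congr (_ * _); apply: eq_bigr => j _.
  by rewrite !mxE; case: eqP => // ->.
apply: is_derive_big_sum => s _; apply: is_derive_M.
exact: is_derive_prod.
Qed.

End DirectionalDerivatives.

Section C1.
Context {R : realType} {m : nat}.
Implicit Types (f g : 'rV[R]_m -> R) (U W : set 'rV[R]_m) (x : 'rV[R]_m).

(** Continuous partial derivatives: this follows from [smooth_on], and it
    suffices for the chain rule, for Schwarz' theorem and for the divergence
    theorem. *)
Definition C1on U f := forall x, U x ->
  {for x, continuous f} /\
  forall a : 'I_m, derivable f x (basis_vec a) /\
    {for x, continuous ('D_(basis_vec a) f)}.

Lemma smooth_C1on U f s : smooth_on U f -> C1on U (iter_partial f s).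
Proof.
move=> h x Ux; split; first by case: (h s x Ux).
move=> a; split; first by case: (h s x Ux).
by case: (h (a :: s) x Ux).
Qed.

Lemma continuous_near_eq (T : topologicalType) (f g : T -> R) (x : T) :
  (\near x, f x = g x) -> {for x, continuous g} -> {for x, continuous f}.
Proof.
move=> fg gx; have fxE : f x = g x := nbhs_singleton fg.
rewrite /prop_for /continuous_at fxE; apply: cvg_trans gx; apply: near_eq_cvg.
by apply: filterS fg => y ->.
Qed.

Lemma C1on_intro U f (df : 'I_m -> 'rV[R]_m -> R) : open U ->
  (forall x, U x -> {for x, continuous f}) ->
  (forall x a, U x -> is_derive x (basis_vec a) f (df a x)) ->
  (forall x a, U x -> {for x, continuous (df a)}) -> C1on U f.
Proof.
move=> Uo fc fd dc x Ux; split; first exact: fc.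
move=> a; have [d dE] := fd x a Ux; split => //.
apply: (@continuous_near_eq _ _ (df a)); last exact: dc.
have : \near x, U x by exact: open_nbhs_nbhs.
apply: filterS => y Uy.
by have [] := fd y a Uy.
Qed.

Lemma C1on_is_derive U f x a : C1on U f -> U x ->
  is_derive x (basis_vec a) f ('D_(basis_vec a) f x).
Proof. by move=> h Ux; apply: derivableP; case: (h x Ux) => _ /(_ a) []. Qed.

Lemma C1on_eq U f g : open U -> (forall x, U x -> f x = g x) ->
  C1on U g -> C1on U f.
Proof.
move=> Uo fg h.
have nfg x : U x -> \near x, f x = g x.
  by move=> Ux; have : \near x, U x by [exact: open_nbhs_nbhs]; apply: filterS.
apply: (@C1on_intro _ _ (fun a => 'D_(basis_vec a) g)) => //.
- by move=> x Ux; apply: (continuous_near_eq (nfg x Ux)); case: (h x Ux).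
- move=> x a Ux; apply: (@near_eq_is_derive _ _ _ g).
    by apply: filterS (nfg x Ux) => y ->.
  exact: C1on_is_derive Ux.
- by move=> x a Ux; case: (h x Ux) => _ /(_ a) [].
Qed.

Lemma C1on_cst U (c : R) : open U -> C1on U (fun=> c).
Proof.
move=> Uo; apply: (@C1on_intro _ _ (fun _ _ => 0)) => // x *; exact: cst_continuous.
Qed.

Lemma C1onD U f g : open U -> C1on U f -> C1on U g ->
  C1on U (fun x => f x + g x).
Proof.
move=> Uo hf hg; apply: (@C1on_intro _ _
  (fun a x => 'D_(basis_vec a) f x + 'D_(basis_vec a) g x)) => // x.
- by move=> Ux; apply: continuousD; [case: (hf x Ux)|case: (hg x Ux)].
- by move=> a Ux; apply: is_derive_D; [exact: C1on_is_derive hf Ux|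
                                       exact: C1on_is_derive hg Ux].
- move=> a Ux; have [_ /(_ a)[_ c1]] := hf x Ux.
  by have [_ /(_ a)[_ c2]] := hg x Ux; exact: continuousD.
Qed.

Lemma C1onM U f g : open U -> C1on U f -> C1on U g ->
  C1on U (fun x => f x * g x).
Proof.
move=> Uo hf hg; apply: (@C1on_intro _ _
  (fun a x => 'D_(basis_vec a) f x * g x + f x * 'D_(basis_vec a) g x)) => // x.
- by move=> Ux; apply: continuousM; [case: (hf x Ux)|case: (hg x Ux)].
- by move=> a Ux; apply: is_derive_M; [exact: C1on_is_derive hf Ux|
                                       exact: C1on_is_derive hg Ux].
- move=> a Ux; have [c3 /(_ a)[_ c1]] := hf x Ux.
  have [c4 /(_ a)[_ c2]] := hg x Ux.
  by apply: continuousD; exact: continuousM.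
Qed.

Lemma C1onN U f : open U -> C1on U f -> C1on U (fun x => - f x).
Proof.
move=> Uo hf; apply: (@C1on_eq _ _ (fun x => -1 * f x)) => //.
  by move=> x _; rewrite mulN1r.
by apply: C1onM => //; exact: C1on_cst.
Qed.

Lemma C1on_sum U (I : Type) (s : seq I) (P : pred I) (F : I -> 'rV[R]_m -> R) :
  open U -> (forall i, P i -> C1on U (F i)) ->
  C1on U (fun x => \sum_(i <- s | P i) F i x).
Proof.
move=> Uo h; elim: s => [|i s ih].
  apply: (@C1on_eq _ _ (fun=> 0)) => //; last exact: C1on_cst.
  by move=> x _; rewrite big_nil.
apply: (@C1on_eq _ _ (fun x => if P i then F i x + \sum_(j <- s | P j) F j x
    else \sum_(j <- s | P j) F j x)) => //; first by move=> x _; rewrite big_cons.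
by case Pi: (P i) => //; apply: C1onD => //; exact: h.
Qed.

Lemma C1on_prod U (I : Type) (s : seq I) (P : pred I) (F : I -> 'rV[R]_m -> R) :
  open U -> (forall i, P i -> C1on U (F i)) ->
  C1on U (fun x => \prod_(i <- s | P i) F i x).
Proof.
move=> Uo h; elim: s => [|i s ih].
  apply: (@C1on_eq _ _ (fun=> 1)) => //; last exact: C1on_cst.
  by move=> x _; rewrite big_nil.
apply: (@C1on_eq _ _ (fun x => if P i then F i x * \prod_(j <- s | P j) F j x
    else \prod_(j <- s | P j) F j x)) => //; first by move=> x _; rewrite big_cons.
by case Pi: (P i) => //; apply: C1onM => //; exact: h.
Qed.

Lemma C1on_det U n (M : 'rV[R]_m -> 'M[R]_n) : open U ->
  (forall i j, C1on U (fun x => M x i j)) -> C1on U (fun x => \det (M x)).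
Proof.
move=> Uo h; apply: C1on_sum => // s _; apply: C1onM => //.
  exact: C1on_cst.
exact: C1on_prod.
Qed.

Lemma C1on_adj U n (M : 'rV[R]_m -> 'M[R]_n) i j : open U ->
  (forall i j, C1on U (fun x => M x i j)) ->
  C1on U (fun x => (\adj (M x)) i j).
Proof.
move=> Uo h; apply: (@C1on_eq _ _ (fun x => cofactor (M x) j i)) => //.
  by move=> x _; rewrite mxE.
apply: C1onM => //; first exact: C1on_cst.
apply: C1on_det => // k l.
apply: (@C1on_eq _ _ (fun x => M x (lift j k) (lift i l))) => // x _.
by rewrite !mxE.
Qed.

Lemma C1on_comp1 U f (phi dphi : R -> R) : open U -> C1on U f ->
  (forall x, U x -> is_derive (f x) 1 phi (dphi (f x))) ->
  (forall x, U x -> {for f x, continuous dphi}) ->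
  C1on U (fun x => phi (f x)).
Proof.
move=> Uo hf hd hc; apply: (@C1on_intro _ _
  (fun a x => 'D_(basis_vec a) f x * dphi (f x))) => // x.
- move=> Ux; apply: continuous_comp; first by case: (hf x Ux).
  by apply/differentiable_continuous/derivable1_diffP; case: (hd x Ux).
- move=> a Ux; apply/is_derive_line0; rewrite mulrC.
  apply: (@is_derive1_comp _ phi (fun t : R => f (t *: basis_vec a + x))).
    by rewrite scale0r add0r; exact: hd.
  by apply/is_derive_line0; exact: C1on_is_derive hf Ux.
- move=> a Ux; have [c3 /(_ a)[_ c1]] := hf x Ux.
  by apply: continuousM => //; apply: continuous_comp => //; exact: hc.
Qed.

Lemma C1onV U f : open U -> C1on U f -> (forall x, U x -> f x != 0) ->
  C1on U (fun x => (f x)^-1).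
Proof.
move=> Uo hf nz; apply: (@C1on_comp1 _ _ _ (fun t => - t ^- 2)) => // x Ux.
- have := is_derive_V (nz x Ux) (is_derive_id (f x) 1).
  by rewrite mulr1.
- apply: continuousN; apply: continuousV; first by rewrite expf_neq0 // nz.
  exact: exprn_continuous.
Qed.

Lemma C1on_sqrt U f : open U -> C1on U f -> (forall x, U x -> 0 < f x) ->
  C1on U (fun x => Num.sqrt (f x)).
Proof.
move=> Uo hf nz; apply: (@C1on_comp1 _ _ _ (fun t => (2 * Num.sqrt t)^-1)) => // x Ux.
- exact: is_derive1_sqrt (nz x Ux).
- apply: continuousV; first by rewrite mulf_neq0 // gt_eqF // sqrtr_gt0 nz.
  apply: continuousM; first exact: cst_continuous.
  exact: sqrt_continuous.
Qed.

End C1.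

Section MeanValue.
Context {R : realType} {V : normedModType R}.
Implicit Types (f : V -> R) (x v : V).

Lemma MVT_line f x v (t : R) :
  (forall s : R, `|s| <= `|t| -> derivable f (s *: v + x) v) ->
  exists2 c : R, `|c| <= `|t| &
    f (t *: v + x) - f x = t * 'D_v f (c *: v + x).
Proof.
move=> df; pose g (s : R) := f (s *: v + x).
have dg (s : R) : `|s| <= `|t| -> is_derive s (1 : R) g ('D_v f (s *: v + x)).
  by move=> /df st; apply/is_derive_line; exact: derivableP.
have cg (a b : R) : (forall s : R, s \in `[a, b] -> `|s| <= `|t|) ->
    {within `[a, b], continuous g}.
  by move=> H; apply: derivable_within_continuous => s /H /dg [].
have [t0|t0] := leP 0 t.
  have H : forall s : R, s \in `[0, t] -> `|s| <= `|t|.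
    by move=> s; rewrite in_itv /= => /andP[s0 st]; rewrite !ger0_norm.
  have [|c cI] := @MVT_segment R g (fun s => 'D_v f (s *: v + x)) 0 t t0 _ (cg _ _ H).
    by move=> s sI; apply: dg; apply: H; apply: subset_itv_oo_cc.
  by rewrite /g scale0r add0r subr0 mulrC => E; exists c => //; exact: H.
have H : forall s : R, s \in `[t, 0] -> `|s| <= `|t|.
  move=> s; rewrite in_itv /= => /andP[s0 st].
  by rewrite !ler0_norm ?lerN2 // ltW.
have [|c cI] := @MVT_segment R g (fun s => 'D_v f (s *: v + x)) t 0 (ltW t0) _ (cg _ _ H).
  by move=> s sI; apply: dg; apply: H; apply: subset_itv_oo_cc.
rewrite /g scale0r add0r sub0r => E; exists c; first exact: H.
by rewrite -opprB E mulrN opprK mulrC.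
Qed.

(** At a zero of [k], the product rule holds with a continuous factor [g]; this
    turns differentiability in the form of Caratheodory into a derivative. *)
Lemma is_derive_M0 (k g : R -> R) (dk : R) : k 0 = 0 ->
  is_derive (0 : R) (1 : R) k dk -> {for 0, continuous g} ->
  is_derive (0 : R) (1 : R) (fun t => k t * g t) (dk * g 0).
Proof.
move=> k0 [dk0 dkE] cg.
have H : (fun h : R => h^-1 *: (((fun t => k t * g t) \o shift 0) (h *: (1 : R))
    - k 0 * g 0)) @ (0 : R)^' --> dk * g 0.
  rewrite k0 mul0r.
  have -> : (fun h : R => h^-1 *: (((fun t => k t * g t) \o shift 0) (h *: (1 : R)) - 0))
    = (fun h : R => h^-1 *: ((k \o shift 0) (h *: (1 : R)) - k 0) * g h).
    by apply/funext => h /=; rewrite k0 !subr0 addr0 [_%:A]mulr1 -scalerAl.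
  apply: cvgM; first by rewrite -dkE; exact: dk0.
  exact: (cvg_trans (cvg_app g (@nbhs_dnbhs _ _)) cg).
apply: DeriveDef; first by apply/cvg_ex; exists (dk * g 0).
exact: cvg_lim H.
Qed.

End MeanValue.

Section RowVectors.
Context {R : realType} {m : nat}.
Implicit Types (x v : 'rV[R]_m).

Lemma coord_le_norm v i : `|v 0 i| <= `|v|.
Proof. by rewrite [leRHS]/Num.Def.normr/= mx_normrE (le_bigmax _ _ (0, i)). Qed.

Lemma norm_le_coord v (e : R) : 0 <= e -> (forall i, `|v 0 i| <= e) -> `|v| <= e.
Proof.
move=> e0 h; rewrite [leLHS]/Num.Def.normr/= mx_normrE (bigmax_le _ e0)//= => -[i j] _.
by rewrite (ord1 i) h.
Qed.

Lemma continuous_rV (T : topologicalType) (tau : T -> 'rV[R]_m) (x : T) :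
  (forall i, {for x, continuous (fun y => tau y 0 i)}) ->
  {for x, continuous tau}.
Proof.
move=> h; apply/cvgrPdist_le => e e0; near=> y.
apply: norm_le_coord; first exact: ltW.
move=> i; rewrite !mxE; move: i; near: y; apply: filter_forall => i.
exact: ((cvgrPdist_le _ _).1 (h i)).
Unshelve. all: by end_near. Qed.

End RowVectors.

Lemma continuous_at_dist {R : realType} {V : normedModType R} (f : V -> R) x :
  (forall e, 0 < e -> exists2 d, 0 < d &
    forall y, `|x - y| < d -> `|f x - f y| <= e) -> {for x, continuous f}.
Proof.
move=> h; apply/cvgrPdist_le => e /h[d d0 dP].
by apply/nbhs_normP; exists d.
Qed.

Lemma continuous_near_dist {R : realType} {T : topologicalType} (f : T -> R) x e :
  {for x, continuous f} -> 0 < e -> \forall y \near x, `|f x - f y| <= e.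
Proof. by move=> fc e0; exact: ((cvgrPdist_le _ _).1 fc). Qed.

Lemma continuous_sum {R : realType} {T : topologicalType} (I : Type)
    (s : seq I) (P : pred I) (F : I -> T -> R) x :
  (forall i, P i -> {for x, continuous (F i)}) ->
  {for x, continuous (fun y => \sum_(i <- s | P i) F i y)}.
Proof.
move=> h; elim: s => [|i s ih].
  rewrite (_ : (fun y => _) = fun=> 0); first exact: cst_continuous.
  by apply/funext => y; rewrite big_nil.
case Pi : (P i); last first.
  rewrite (_ : (fun y => _) = (fun y => \sum_(j <- s | P j) F j y)) //.
  by apply/funext => y; rewrite big_cons Pi.
rewrite (_ : (fun y => _) = (fun y => F i y + \sum_(j <- s | P j) F j y)).
  by apply: continuousD => //; exact: h.
by apply/funext => y; rewrite big_cons Pi.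
Qed.

Section ChainRule.
Context {R : realType} {m : nat}.
Implicit Types (f : 'rV[R]_m -> R) (U : set 'rV[R]_m) (x z k : 'rV[R]_m).

Definition head_coords (j : nat) k : 'rV[R]_m :=
  \row_i (if (i < j)%N then k 0 i else 0).

(** The increment of [f] at [z] is written as a sum over the coordinates, with
    coefficients that are continuous at [0]: this is differentiability in the
    form of Caratheodory. The coordinates of [k] are switched on one after the
    other. *)
Definition slope f z (b : 'I_m) k : R :=
  if k 0 b == 0 then 'D_(basis_vec b) f z
  else (f (z + head_coords b.+1 k) - f (z + head_coords b k)) / k 0 b.

Lemma head_coordsS (b : 'I_m) k :
  head_coords b.+1 k = k 0 b *: basis_vec b + head_coords b k.
Proof.
apply/rowP => i; rewrite !mxE eqxx ltnS leq_eqVlt.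
have [->|ib] := eqVneq i b; first by rewrite ltnn eqxx mulr1 addr0.
by rewrite (val_eqE i b) (negbTE ib) mulr0 add0r.
Qed.

Lemma increment_slope f z k :
  f (z + k) - f z = \sum_b k 0 b * slope f z b k.
Proof.
have -> : \sum_b k 0 b * slope f z b k =
    \sum_(b < m) (f (z + head_coords b.+1 k) - f (z + head_coords b k)).
  apply: eq_bigr => b _; rewrite /slope; case: eqP => [kb|/eqP kb].
    by rewrite head_coordsS kb scale0r add0r mul0r subrr.
  by rewrite mulrC divfK.
rewrite -(big_mkord xpredT (fun b => f (z + head_coords b.+1 k) - f (z + head_coords b k))).
rewrite telescope_sumr //; congr (f (z + _) - f _).
  by apply/rowP => i; rewrite !mxE ltn_ord.
by apply/rowP => i; rewrite !mxE addr0.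
Qed.

Lemma slope0 f z b : slope f z b 0 = 'D_(basis_vec b) f z.
Proof. by rewrite /slope mxE eqxx. Qed.

Lemma slope_continuous U f z b : open U -> C1on U f -> U z ->
  {for (0 : 'rV[R]_m), continuous (slope f z b)}.
Proof.
move=> Uo hf Uz; apply: continuous_at_dist => e e0; rewrite slope0.
have [_ /(_ b)[_ Dc]] := hf z Uz.
have : \forall w \near z, U w /\ `|'D_(basis_vec b) f z - 'D_(basis_vec b) f w| <= e.
  by near=> w; split; near: w; [exact: open_nbhs_nbhs|
    exact: ((cvgrPdist_le _ _).1 Dc)].
move=> /nbhs_ballP[d d0 dP]; exists d => // k; rewrite sub0r normrN => kd.
rewrite /slope; case: eqP => [_|/eqP kb]; first by rewrite subrr normr0 ltW.
have inball c : `|c| <= `|k 0 b| ->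
    ball z d (c *: basis_vec b + (z + head_coords b k)).
  move=> ck; rewrite mx_norm_ball /ball_ /=.
  apply: le_lt_trans kd; rewrite distrC addrCA addrC addrK.
  apply: norm_le_coord => // i; rewrite !mxE eqxx /=.
  have [->|ib] := eqVneq i b.
    by rewrite ltnn mulr1 addr0 (le_trans ck) // coord_le_norm.
  rewrite mulr0 add0r; case: ifP => _; first exact: coord_le_norm.
  by rewrite normr0.
rewrite head_coordsS addrCA.
have [|c ck ->] := @MVT_line R _ f (z + head_coords b k) (basis_vec b) (k 0 b).
  by move=> s /inball /dP[Us _]; case: (hf _ Us) => _ /(_ b)[].
by rewrite mulrC mulKf //; case: (dP _ (inball c ck)).
Unshelve. all: by end_near. Qed.

(** The increment of [f] is a sum of increments of coordinates times slopes, and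
    the slopes are continuous. *)
Lemma is_derive_comp (W : normedModType R) U f (tau : W -> 'rV[R]_m)
    (x v : W) (d : 'I_m -> R) : open U -> C1on U f -> U (tau x) ->
  (forall b, is_derive x v (fun y => tau y 0 b) (d b)) ->
  is_derive x v (fun y => f (tau y)) (\sum_b d b * 'D_(basis_vec b) f (tau x)).
Proof.
move=> Uo hf Ux ht; apply/is_derive_line0.
pose k (t : R) : 'rV[R]_m := tau (t *: v + x) - tau x.
have k0 : k 0 = 0 by rewrite /k scale0r add0r subrr.
have dk b : is_derive (0 : R) (1 : R) (fun t => k t 0 b) (d b).
  have -> : (fun t => k t 0 b) = (fun t => tau (t *: v + x) 0 b + - tau x 0 b).
    by apply/funext => t; rewrite !mxE.
  rewrite -[d b]addr0; apply: is_derive_D.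
  exact/is_derive_line0.
have kc : {for 0, continuous k}.
  apply: continuous_rV => b.
  by apply/differentiable_continuous/derivable1_diffP; case: (dk b).
have -> : (fun t : R => f (tau (t *: v + x))) =
   (fun t => f (tau x) + \sum_b k t 0 b * slope f (tau x) b (k t)).
  by apply/funext => t; rewrite -increment_slope /k !subrKC.
rewrite -[X in is_derive _ _ _ X]add0r; apply: is_derive_D.
apply: is_derive_big_sum => b _; rewrite -slope0 -k0.
apply: (@is_derive_M0 _ (fun t => k t 0 b) (fun t => slope f (tau x) b (k t))) => //.
  by rewrite k0 mxE.
apply: continuous_comp; first exact: kc.
by rewrite k0; exact: slope_continuous Ux.
Qed.

Lemma derive_C1on U f x v : open U -> C1on U f -> U x ->
  is_derive x v f (\sum_b v 0 b * 'D_(basis_vec b) f x).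
Proof.
move=> Uo hf Ux; apply: (@is_derive_comp _ U f id) => // b.
have -> : v 0 b = 0 + 1 * v 0 b by rewrite add0r mul1r.
apply/is_derive_line0.
have -> : (fun t : R => (t *: v + x) 0 b) = (fun t => x 0 b + t * v 0 b).
  by apply/funext => t; rewrite !mxE addrC.
apply: is_derive_D; rewrite -[X in is_derive _ _ _ X]addr0 -{2}(mulr0 (0 : R)).
by apply: is_derive_M.
Qed.

Lemma C1on_comp (n : nat) (U : set 'rV[R]_n) W f (tau : 'rV[R]_n -> 'rV[R]_m) :
  open U -> open W -> C1on W f -> (forall b, C1on U (fun p => tau p 0 b)) ->
  (forall p, U p -> W (tau p)) -> C1on U (fun p => f (tau p)).
Proof.
move=> Uo Wo hf ht UW.
have tc p : U p -> {for p, continuous tau}.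
  by move=> Ux; apply: continuous_rV => b; case: (ht b p Ux).
apply: (@C1on_intro _ _ _ _ (fun a p => \sum_b
   'D_(basis_vec a) (fun y => tau y 0 b) p * 'D_(basis_vec b) f (tau p))) => // p.
- move=> Ux; apply: continuous_comp; first exact: tc.
  by case: (hf _ (UW p Ux)).
- move=> a Ux; apply: (is_derive_comp Wo hf (UW _ Ux)) => b.
  exact: C1on_is_derive (ht b) Ux.
- move=> a Ux; apply: continuous_sum => b _; apply: continuousM.
    by case: (ht b p Ux) => _ /(_ a)[].
  apply: (@continuous_comp _ _ _ tau ('D_(basis_vec b) f)); first exact: tc.
  by case: (hf _ (UW p Ux)) => _ /(_ b)[].
Qed.

End ChainRule.

Section Schwarz.
Context {R : realType} {m : nat}.
Implicit Types (f : 'rV[R]_m -> R) (U : set 'rV[R]_m) (x z k : 'rV[R]_m).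

(** The mean value theorem in the direction [a], and then in the direction [b]. *)
Lemma second_difference U f x a b (h : R) : open U -> C1on U f ->
  C1on U ('D_(basis_vec a) f) ->
  (forall s t : R, `|s| <= `|h| -> `|t| <= `|h| ->
     U (x + s *: basis_vec a + t *: basis_vec b)) ->
  exists s t : R, [/\ `|s| <= `|h|, `|t| <= `|h| &
    f (x + h *: basis_vec a + h *: basis_vec b) - f (x + h *: basis_vec a)
    - f (x + h *: basis_vec b) + f x =
    h * (h * 'D_(basis_vec b) ('D_(basis_vec a) f)
               (x + s *: basis_vec a + t *: basis_vec b))].
Proof.
move=> Uo hf hDf inU; set u := basis_vec a; set w := basis_vec b.
pose g y := f (y + h *: w) - f y.
have h0 : `|0 : R| <= `|h| by rewrite normr0.
have dg s : `|s| <= `|h| -> is_derive (s *: u + x) u g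
    ('D_u f (s *: u + x + h *: w) - 'D_u f (s *: u + x)).
  move=> sh; apply: is_derive_D.
    apply: is_derive_shift; apply: (C1on_is_derive _ hf).
    by rewrite [s *: u + x]addrC; apply: inU.
  apply: is_derive_N; apply: (C1on_is_derive _ hf).
  by rewrite [s *: u + x]addrC -[X in U X]addr0 -(scale0r w); apply: inU.
have [s sh gE] : exists2 s : R, `|s| <= `|h| &
    g (h *: u + x) - g x = h * 'D_u g (s *: u + x).
  by apply: MVT_line => s /dg [].
have [t th DE] : exists2 t : R, `|t| <= `|h| &
    'D_u f (h *: w + (s *: u + x)) - 'D_u f (s *: u + x)
    = h * 'D_w ('D_u f) (t *: w + (s *: u + x)).
  apply: (@MVT_line _ _ ('D_u f) (s *: u + x) w h) => t th; suff Ut : U (t *: w + (s *: u + x)).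
    by have [_ /(_ b)[dt _]] := hDf _ Ut; exact: dt.
  by rewrite addrC [s *: u + x]addrC; exact: inU.
exists s, t; split => //.
have [_ dgE] := dg s sh; rewrite dgE [_ + h *: w]addrC DE in gE.
rewrite [x + s *: u]addrC [_ + t *: w]addrC -gE /g [x + h *: u]addrC opprB addrA.
by rewrite addrAC.
Qed.

Local Definition second_difference_eq U f (D : 'rV[R]_m -> R) x a b := forall h : R,
  (forall s t : R, `|s| <= `|h| -> `|t| <= `|h| ->
     U (x + s *: basis_vec a + t *: basis_vec b)) ->
  exists s t : R, [/\ `|s| <= `|h|, `|t| <= `|h| &
    f (x + h *: basis_vec a + h *: basis_vec b) - f (x + h *: basis_vec a)
    - f (x + h *: basis_vec b) + f x =
    h * (h * D (x + s *: basis_vec a + t *: basis_vec b))].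

Local Lemma second_difference_unique U f (A B : 'rV[R]_m -> R) x a b : open U -> U x ->
  {for x, continuous A} -> {for x, continuous B} ->
  second_difference_eq U f B x a b -> second_difference_eq U f A x b a ->
  A x = B x.
Proof.
move=> Uo Ux cA cB E1 E2; pose u : 'rV[R]_m := basis_vec a; pose w : 'rV[R]_m := basis_vec b.
apply/eqP; rewrite -subr_eq0 -normr_le0; apply/ler_addgt0Pl => e e0.
rewrite addr0; have e20 : 0 < e / 2 by rewrite divr_gt0.
have : \forall y \near x, [/\ U y, `|A x - A y| <= e / 2 & `|B x - B y| <= e / 2].
  have n1 := continuous_near_dist cA e20; have n2 := continuous_near_dist cB e20.
  have n0 : \forall y \near x, U y by exact: open_nbhs_nbhs.
  by apply: filterS3 n0 n1 n2 => y y0 y1 y2.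
move=> /nbhs_ballP[d /= d0 dP].
pose h := d / 3; have hh0 : 0 < h by rewrite divr_gt0.
have small (i j : 'I_m) (s t : R) : `|s| <= `|h| -> `|t| <= `|h| ->
    ball x d (x + s *: basis_vec i + t *: basis_vec j).
  move=> sh th; rewrite mx_norm_ball /ball_ /= -addrA opprD addrA subrr sub0r normrN.
  apply: (@le_lt_trans _ _ (h + h)); last by rewrite /h; lra.
  apply: norm_le_coord => [|l]; first by rewrite addr_ge0 // ltW.
  rewrite (gtr0_norm hh0) in sh th.
  rewrite !mxE eqxx (le_trans (ler_normD _ _)) // lerD // normrM normr_nat.
    by rewrite (le_trans _ sh) // ler_piMr // -[leRHS]/(1%:R) ler_nat leq_b1.
  by rewrite (le_trans _ th) // ler_piMr // -[leRHS]/(1%:R) ler_nat leq_b1.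
have [s [t [sh th {}E1]]] := E1 h
  (fun s t sh th => let: And3 Uy _ _ := dP _ (small a b s t sh th) in Uy).
have [s' [t' [sh' th' {}E2]]] := E2 h
  (fun s t sh th => let: And3 Uy _ _ := dP _ (small b a s t sh th) in Uy).
have E : B (x + s *: u + t *: w) = A (x + s' *: w + t' *: u).
  apply: (@mulfI _ h); first by rewrite gt_eqF.
  apply: (@mulfI _ h); first by rewrite gt_eqF.
  rewrite -E1 -E2 -/u -/w (addrAC x (h *: w)); congr (_ + f x).
  exact: addrAC.
have [_ _ d1] := dP _ (small a b s t sh th).
have [_ d2 _] := dP _ (small b a s' t' sh' th').
rewrite (splitr e); apply: le_trans (lerD d2 d1).
rewrite -[X in _ <= _ + X]normrN (le_trans _ (ler_normD _ _)) // -E.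
by rewrite opprB addrA subrK.
Qed.

(** The second difference is symmetric in the two directions, and both mixed
    derivatives are its limits. *)
Lemma schwarz U f x a b : open U -> C1on U f ->
  C1on U ('D_(basis_vec a) f) -> C1on U ('D_(basis_vec b) f) -> U x ->
  'D_(basis_vec a) ('D_(basis_vec b) f) x =
  'D_(basis_vec b) ('D_(basis_vec a) f) x.
Proof.
move=> Uo hf ha hb Ux.
have [_ /(_ a)[_ cA]] := hb x Ux; have [_ /(_ b)[_ cB]] := ha x Ux.
apply: (second_difference_unique Uo Ux cA cB) => h.
- exact: second_difference.
- exact: second_difference.
Qed.

End Schwarz.

(** * The static metric and its Levi-Civita connection *)

Section StaticAlgebra.
Context {R : realType} {n : nat}.
Variable kappa : R.
Implicit Types (z X Y Z V W : 'rV[R]_n.+1) (a : R).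
Local Notation g := (@static_metric R n kappa).
Local Notation tp := time_part.
Local Notation sp := space_part.

Lemma time_partD X Y : tp (X + Y) = tp X + tp Y.
Proof. by rewrite /time_part mxE. Qed.

Lemma time_partZ a X : tp (a *: X) = a * tp X.
Proof. by rewrite /time_part mxE. Qed.

Lemma space_partD X Y : sp (X + Y) = sp X + sp Y.
Proof. by apply/rowP => i; rewrite !mxE. Qed.

Lemma space_partZ a X : sp (a *: X) = a *: sp X.
Proof. by apply/rowP => i; rewrite !mxE. Qed.

Lemma time_space_eq X Y : tp X = tp Y -> sp X = sp Y -> X = Y.
Proof.
move=> tE /rowP sE; apply/rowP => i; case: (unliftP ord0 i) => [j|] ->.
  by have := sE j; rewrite !mxE.
exact: tE.
Qed.

Lemma dotp0l k (u : 'rV[R]_k) : dotp 0 u = 0.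
Proof. by rewrite -(scale0r u) dotpZl mul0r. Qed.

Lemma static_metricC z X Y : g z X Y = g z Y X.
Proof.
rewrite /static_metric (dotpC (sp X)) [tp X * _]mulrC.
by rewrite [dotp _ (sp X) * _]mulrC.
Qed.

Lemma static_metricDl z X Y W : g z (X + Y) W = g z X W + g z Y W.
Proof. by rewrite /static_metric time_partD space_partD !(dotpDl, dotpDr); ring. Qed.

Lemma static_metricZl z a X W : g z (a *: X) W = a * g z X W.
Proof. by rewrite /static_metric time_partZ space_partZ !(dotpZl, dotpZr); ring. Qed.

Lemma static_metricZr z a X W : g z W (a *: X) = a * g z W X.
Proof. by rewrite static_metricC static_metricZl (static_metricC _ W). Qed.

Lemma static_metric0l z W : g z 0 W = 0.
Proof. by rewrite -(scale0r (0 : 'rV[R]_n.+1)) static_metricZl mul0r. Qed.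

Lemma static_metric_suml (I : Type) (s : seq I) (P : pred I) (F : I -> 'rV[R]_n.+1) z W :
  g z (\sum_(i <- s | P i) F i) W = \sum_(i <- s | P i) g z (F i) W.
Proof.
apply: (big_morph (fun X => g z X W)) => [X Y|]; first exact: static_metricDl.
exact: static_metric0l.
Qed.

Lemma static_metric_sumr (I : Type) (s : seq I) (P : pred I) (F : I -> 'rV[R]_n.+1) z W :
  g z W (\sum_(i <- s | P i) F i) = \sum_(i <- s | P i) g z W (F i).
Proof.
by rewrite static_metricC static_metric_suml; apply: eq_bigr => i _; rewrite static_metricC.
Qed.

Lemma QformC z X Y : Qform z X Y = - Qform z Y X.
Proof. by rewrite /Qform; ring. Qed.

Lemma QformDl z X Y W : Qform z (X + Y) W = Qform z X W + Qform z Y W.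
Proof. by rewrite /Qform time_partD space_partD !(dotpDl, dotpDr); ring. Qed.

Lemma QformZl z a X W : Qform z (a *: X) W = a * Qform z X W.
Proof. by rewrite /Qform time_partZ space_partZ !(dotpZl, dotpZr); ring. Qed.

Lemma QformZr z a X W : Qform z W (a *: X) = a * Qform z W X.
Proof. by rewrite /Qform time_partZ space_partZ !(dotpZl, dotpZr); ring. Qed.

Lemma Qform_suml (I : Type) (s : seq I) (P : pred I) (F : I -> 'rV[R]_n.+1) z W :
  Qform z (\sum_(i <- s | P i) F i) W = \sum_(i <- s | P i) Qform z (F i) W.
Proof.
apply: (big_morph (fun X => Qform z X W)) => [X Y|]; first exact: QformDl.
by rewrite -(scale0r (0 : 'rV[R]_n.+1)) QformZl mul0r.
Qed.

Lemma Qform_sumr (I : Type) (s : seq I) (P : pred I) (F : I -> 'rV[R]_n.+1) z W :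
  Qform z W (\sum_(i <- s | P i) F i) = \sum_(i <- s | P i) Qform z W (F i).
Proof.
by rewrite QformC Qform_suml -sumrN; apply: eq_bigr => i _; rewrite -QformC.
Qed.

Definition lapse2 z : R := 1 + kappa * radius2 z.

(** The Christoffel symbols, contracted with two vectors. The spatial part has
    the form of the second fundamental form of a quadric, since [x] is the
    projection of a hyperquadric along the time plane. *)
Definition static_conn z V W : 'rV[R]_n.+1 :=
  static_point
    (kappa / lapse2 z * (dotp (sp z) (sp V) * tp W + tp V * dotp (sp z) (sp W)))
    (- (kappa * g z V W) *: sp z).

Lemma static_connC z V W : static_conn z V W = static_conn z W V.
Proof.
rewrite /static_conn static_metricC; congr (static_point (_ * _) _); ring.
Qed.

Lemma static_connDl z X Y W :
  static_conn z (X + Y) W = static_conn z X W + static_conn z Y W.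
Proof.
apply: time_space_eq; rewrite ?time_partD ?space_partD /static_conn.
  rewrite !time_part_static time_partD space_partD dotpDr; ring.
rewrite !space_part_static static_metricDl -scalerDl; congr (_ *: _); ring.
Qed.

Lemma static_connZl z a X W : static_conn z (a *: X) W = a *: static_conn z X W.
Proof.
apply: time_space_eq; rewrite ?time_partZ ?space_partZ /static_conn.
  rewrite !time_part_static time_partZ space_partZ dotpZr; ring.
rewrite !space_part_static static_metricZl scalerA; congr (_ *: _); ring.
Qed.

Lemma static_conn0l z W : static_conn z 0 W = 0.
Proof. by rewrite -(scale0r z) static_connZl !scale0r. Qed.

(** The metric is tested against the time direction and against a vector whose
    product with [V] is the Euclidean square of the spatial part of [V]. *)
Lemma static_metric_nondegenerate z V : lapse2 z != 0 ->
  (forall W, g z V W = 0) -> V = 0.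
Proof.
move=> fz h.
have t0 : tp V = 0.
  have := h (static_point 1 0); rewrite /static_metric space_part_static.
  rewrite time_part_static !(dotpC _ 0) !dotp0l !(mulr0, addr0, subr0) mulr1 => /eqP.
  by rewrite mulf_eq0 oppr_eq0 (negbTE fz) => /eqP.
have : dotp (sp V) (sp V) = 0.
  rewrite -[RHS](h (static_point 0 (sp V + (kappa * dotp (sp z) (sp V)) *: sp z))).
  rewrite /static_metric space_part_static time_part_static !(dotpDr, dotpZr).
  move: fz; rewrite (dotpC (sp V) (sp z)) /lapse2 /radius2 => fz; field.
  exact: fz.
move=> s0; apply: time_space_eq; first by rewrite t0 /time_part mxE.
apply/rowP => i; rewrite [RHS]mxE [RHS]mxE; apply/eqP; rewrite -sqrf_eq0 expr2.
move: s0; rewrite /dotp => /eqP; rewrite psumr_eq0.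
  by move=> /allP /(_ i); rewrite mem_index_enum => /(_ isT).
by move=> j _; rewrite -expr2 sqr_ge0.
Qed.

End StaticAlgebra.

Section AlongMap.
Context {R : realType} {n : nat} {E : normedModType R}.
Variable kappa : R.
Variables (x v : E).
Implicit Types (X V W : E -> 'rV[R]_n.+1) (dX dV dW : 'rV[R]_n.+1).
Local Notation g := (@static_metric R n kappa).
Local Notation tp := time_part.
Local Notation sp := space_part.

Definition has_dir_deriv k (V : E -> 'rV[R]_k) (dV : 'rV[R]_k) :=
  forall i, is_derive x v (fun y => V y 0 i) (dV 0 i).

Lemma is_derive_time_part V dV : has_dir_deriv V dV ->
  is_derive x v (fun y => tp (V y)) (tp dV).
Proof. exact. Qed.

Lemma is_derive_space_part V dV : has_dir_deriv V dV ->
  has_dir_deriv (fun y => sp (V y)) (sp dV).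
Proof.
move=> h i; rewrite mxE.
have -> : (fun y => sp (V y) 0 i) = (fun y => V y 0 (lift ord0 i)).
  by apply/funext => y; rewrite mxE.
exact: h.
Qed.

Lemma is_derive_dotp k (A B : E -> 'rV[R]_k) dA dB :
  has_dir_deriv A dA -> has_dir_deriv B dB ->
  is_derive x v (fun y => dotp (A y) (B y)) (dotp dA (B x) + dotp (A x) dB).
Proof.
move=> hA hB; rewrite /dotp -big_split /=.
by apply: is_derive_big_sum => i _; exact: is_derive_M.
Qed.

(** The derivatives [dX] and [dV] are arguments, so that the algebra of the
    connection does not depend on where they come from. *)
Definition covD X V dX dV := dV + static_conn kappa (X x) dX (V x).

(** Metric compatibility, along a map [X]. With the symmetry of [static_conn] it
    identifies the Levi-Civita connection. *)
Lemma is_derive_static_metric X V W dX dV dW : lapse2 kappa (X x) != 0 ->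
  has_dir_deriv X dX -> has_dir_deriv V dV -> has_dir_deriv W dW ->
  is_derive x v (fun y => g (X y) (V y) (W y))
    (g (X x) (covD X V dX dV) (W x) + g (X x) (V x) (covD X W dX dW)).
Proof.
move=> fx hX hV hW.
have hXs := is_derive_space_part hX.
have hVs := is_derive_space_part hV.
have hWs := is_derive_space_part hW.
have hc (c : R) : is_derive x v (fun=> c) 0 by exact: is_derive_cst.
have hf : is_derive x v (fun y => lapse2 kappa (X y)) _ := is_derive_D (hc 1) (is_derive_M (hc kappa) (is_derive_dotp hXs hXs)).
have h := is_derive_D (is_derive_D
  (is_derive_M (is_derive_N hf) (is_derive_M (is_derive_time_part hV) (is_derive_time_part hW)))
  (is_derive_dotp hVs hWs))
  (is_derive_N (is_derive_M (is_derive_M (hc kappa) (@is_derive_V _ _ (fun y => lapse2 kappa (X y)) _ _ _ fx hf))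
    (is_derive_M (is_derive_dotp hXs hVs) (is_derive_dotp hXs hWs)))).
apply: (is_derive_eq h).
rewrite /covD /static_metric /static_conn /static_metric.
rewrite !(time_partD, space_partD) !time_part_static !space_part_static.
rewrite !(dotpZl, dotpZr, dotpDl, dotpDr).
move: fx; rewrite /lapse2 /radius2.
rewrite (dotpC (sp dX) (sp (X x))) (dotpC (sp (V x)) (sp (X x))).
move: (dotp (sp (X x)) (sp (X x))) (dotp (sp (X x)) (sp (V x)))
  (dotp (sp (X x)) (sp (W x))) (dotp (sp dX) (sp (V x))) (dotp (sp dX) (sp (W x)))
  (dotp (sp (X x)) (sp dX)) (dotp (sp (X x)) (sp dV)) (dotp (sp (X x)) (sp dW))
  => xx xV xW dxV dxW xdx xdV xdW fx.
by field.
Qed.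

Lemma static_metric_partial_t z Y : g z Y partial_t = - lapse2 kappa z * tp Y.
Proof.
have tE : tp (partial_t : 'rV[R]_n.+1) = 1 by rewrite /time_part !mxE !eqxx.
have sE : sp (partial_t : 'rV[R]_n.+1) = 0.
  by apply/rowP => i; rewrite !mxE eqxx.
rewrite /static_metric tE sE !(dotpC _ 0) !dotp0l /lapse2; ring.
Qed.

(** The conformal Killing-Yano equation: the covariant derivative of [Qform] is
    the wedge product with the dual of [partial_t]. *)
Lemma is_derive_Qform X V W dX dV dW : lapse2 kappa (X x) != 0 ->
  has_dir_deriv X dX -> has_dir_deriv V dV -> has_dir_deriv W dW ->
  is_derive x v (fun y => Qform (X y) (V y) (W y))
    (Qform (X x) (covD X V dX dV) (W x) + Qform (X x) (V x) (covD X W dX dW)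
     - (g (X x) dX (V x) * g (X x) (W x) partial_t
        - g (X x) dX (W x) * g (X x) (V x) partial_t)).
Proof.
move=> fx hX hV hW.
have hXs := is_derive_space_part hX.
have hVs := is_derive_space_part hV.
have hWs := is_derive_space_part hW.
have h := is_derive_D
  (is_derive_M (is_derive_dotp hXs hVs) (is_derive_time_part hW))
  (is_derive_N (is_derive_M (is_derive_time_part hV) (is_derive_dotp hXs hWs))).
apply: (is_derive_eq h).
rewrite !static_metric_partial_t /covD /static_conn /Qform.
rewrite !(time_partD, space_partD) !time_part_static !space_part_static.
rewrite !(dotpZl, dotpZr, dotpDl, dotpDr) /static_metric.
move: fx; rewrite /lapse2 /radius2.
move: (dotp (sp (X x)) (sp (X x))) (dotp (sp (X x)) (sp (V x)))
  (dotp (sp (X x)) (sp (W x))) (dotp (sp dX) (sp (V x))) (dotp (sp dX) (sp (W x)))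
  (dotp (sp (X x)) (sp dX)) (dotp (sp (X x)) (sp dV)) (dotp (sp (X x)) (sp dW))
  => xx xV xW dxV dxW xdx xdV xdW fx.
by field.
Qed.

End AlongMap.

Section Christoffel.
Context {R : realType} {n : nat}.
Variable kappa : R.
Implicit Types (z V W : 'rV[R]_n.+1).
Local Notation g := (@static_metric R n kappa).

Lemma rV_basis_sum k (V : 'rV[R]_k) : V = \sum_i V 0 i *: basis_vec i.
Proof. exact: row_sum_delta. Qed.

Lemma is_derive_coord k (z v : 'rV[R]_k) i :
  is_derive z v (fun y => y 0 i) (v 0 i).
Proof.
apply/is_derive_line0.
have -> : (fun t : R => (t *: v + z) 0 i) = (fun t => z 0 i + t * v 0 i).
  by apply/funext => t; rewrite !mxE addrC.
have h := is_derive_D (is_derive_cst (z 0 i) (0 : R) (1 : R))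
  (is_derive_M (is_derive_id (0 : R) (1 : R)) (is_derive_cst (v 0 i) (0 : R) (1 : R))).
by apply: (is_derive_eq h); rewrite mul1r mulr0 addr0 add0r.
Qed.

Lemma mul_metric_mx z V l : (V *m metric_mx g z) 0 l = g z V (basis_vec l).
Proof.
rewrite [in RHS](rV_basis_sum V) static_metric_suml mxE.
by apply: eq_bigr => i _; rewrite mxE static_metricZl.
Qed.

Lemma metric_mx_unit z : lapse2 kappa z != 0 -> metric_mx g z \in unitmx.
Proof.
move=> fz; rewrite -row_free_unit -kermx_eq0; apply/eqP/row_matrixP => i.
rewrite row0; set V := row i _.
have VG : V *m metric_mx g z = 0 by rewrite -row_mul mulmx_ker row0.
apply: (static_metric_nondegenerate fz) => W.
rewrite (rV_basis_sum W) static_metric_sumr big1 // => l _.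
by rewrite static_metricZr -mul_metric_mx VG mxE mulr0.
Qed.

Lemma derive_metric_mx z v j l : lapse2 kappa z != 0 ->
  'D_v (fun y => metric_mx g y j l) z
  = g z (static_conn kappa z v (basis_vec j)) (basis_vec l)
    + g z (basis_vec j) (static_conn kappa z v (basis_vec l)).
Proof.
move=> fz.
have hid : has_dir_deriv z v (@id 'rV[R]_n.+1) v by move=> i; exact: is_derive_coord.
have hc (c : 'rV[R]_n.+1) : has_dir_deriv z v (fun=> c) 0.
  by move=> i; rewrite mxE; exact: is_derive_cst.
have [_ E] := @is_derive_static_metric R n _ kappa z v id (fun=> basis_vec j)
   (fun=> basis_vec l) v 0 0 fz hid (hc _) (hc _).
rewrite /covD !add0r in E; rewrite -[RHS]E; congr ('D_v _ z).
by apply/funext => y; rewrite mxE.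
Qed.

(** Koszul's formula: [static_conn] is symmetric and compatible with the
    metric. *)
Lemma christoffel_static z k i j : lapse2 kappa z != 0 ->
  christoffel g z k i j = static_conn kappa z (basis_vec i) (basis_vec j) 0 k.
Proof.
move=> fz; have Gu := metric_mx_unit fz; rewrite /christoffel.
set c := static_conn _ _ _ _; set G := metric_mx g z.
have GT : (invmx G)^T = invmx G.
  rewrite trmx_inv; congr invmx; apply/matrixP => a b.
  by rewrite !mxE static_metricC.
rewrite -[c in RHS](mulmxK Gu) [RHS]mxE big_distrr; apply: eq_bigr => l _ /=.
rewrite mul_metric_mx -[in RHS]GT mxE -/G.
rewrite !derive_metric_mx // (static_connC _ _ (basis_vec l) (basis_vec i)).
rewrite (static_connC _ _ (basis_vec l) (basis_vec j)).
rewrite (static_connC _ _ (basis_vec j) (basis_vec i)) -/c.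
rewrite (static_metricC _ _ (basis_vec i)) (static_metricC _ _ (basis_vec j)).
by field.
Qed.

Lemma cov_deriv_static m (f V : 'rV[R]_m -> 'rV[R]_n.+1) v x :
  lapse2 kappa (f x) != 0 ->
  cov_deriv g f V v x = covD kappa x f V (dir_deriv f v x) (dir_deriv V v x).
Proof.
move=> fx; rewrite /cov_deriv /covD; congr (_ + _).
set e := dir_deriv f v x; apply/rowP => k; rewrite mxE.
rewrite [in RHS](rV_basis_sum e).
have sumE u : static_conn kappa (f x) (\sum_i e 0 i *: basis_vec i) u =
    \sum_i e 0 i *: static_conn kappa (f x) (basis_vec i) u.
  apply: (big_ind2 (fun p q => static_conn kappa (f x) p u = q)) => //.
  - by rewrite static_conn0l.
  - by move=> p p' q q' <- <-; rewrite static_connDl.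
  - by move=> i _; rewrite static_connZl.
clearbody e; rewrite sumE summxE; apply: eq_bigr => i _.
rewrite [in RHS](rV_basis_sum (V x)) static_connC.
have -> : static_conn kappa (f x) (\sum_j V x 0 j *: basis_vec j) (basis_vec i) =
    \sum_j V x 0 j *: static_conn kappa (f x) (basis_vec j) (basis_vec i).
  apply: (big_ind2 (fun p q => static_conn kappa (f x) p (basis_vec i) = q)) => //.
  - by rewrite static_conn0l.
  - by move=> p p' q q' <- <-; rewrite static_connDl.
  - by move=> j _; rewrite static_connZl.
rewrite [RHS]mxE summxE big_distrr; apply: eq_bigr => j _ /=.
rewrite mxE christoffel_static // static_connC; ring.
Qed.

End Christoffel.

(** * Null frames *)

Section NullFrame.
Context {R : realType} {m : nat}.
Variables (kappa : R) (z L Lb : 'rV[R]_m.+2) (e : 'I_m -> 'rV[R]_m.+2).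
Local Notation g := (static_metric kappa z).
Hypotheses (LL : g L L = 0) (bb : g Lb Lb = 0) (Lb2 : g L Lb = - 2).
Hypotheses (eL : forall a, g (e a) L = 0) (eb : forall a, g (e a) Lb = 0).
Let sigma : 'M[R]_m := \matrix_(a, b) g (e a) (e b).
Hypothesis sigma_unit : sigma \in unitmx.

Let comb (p q : R) (xi : 'rV[R]_m) : 'rV[R]_m.+2 :=
  p *: L + q *: Lb + \sum_a xi 0 a *: e a.

Let comb_L p q xi : g (comb p q xi) L = - 2 * q.
Proof.
have bL : g Lb L = - 2 by rewrite static_metricC.
rewrite !static_metricDl !static_metricZl LL.
rewrite static_metric_suml big1 ?addr0 => [|a _]; last by rewrite static_metricZl eL mulr0.
by rewrite bL mulr0 add0r mulrC.
Qed.

Let comb_Lb p q xi : g (comb p q xi) Lb = - 2 * p.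
Proof.
rewrite !static_metricDl !static_metricZl bb Lb2.
rewrite static_metric_suml big1 ?addr0 => [|a _]; last by rewrite static_metricZl eb mulr0.
by rewrite mulr0 addr0 mulrC.
Qed.

Let comb_e p q xi b : g (comb p q xi) (e b) = (xi *m sigma) 0 b.
Proof.
rewrite !static_metricDl !static_metricZl ![g _ (e b)]static_metricC eL eb.
rewrite !mulr0 !add0r static_metricC static_metric_suml mxE; apply: eq_bigr => a _.
by rewrite static_metricZl mxE.
Qed.

Let comb_eq0 p q xi : g (comb p q xi) L = 0 -> g (comb p q xi) Lb = 0 ->
  (forall b, g (comb p q xi) (e b) = 0) -> [/\ p = 0, q = 0 & xi = 0].
Proof.
rewrite comb_L comb_Lb => q0 p0 h.
have n2 : - 2 != 0 :> R by rewrite oppr_eq0 pnatr_eq0.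
split; [by apply: (mulfI n2); rewrite p0 mulr0|by apply: (mulfI n2); rewrite q0 mulr0|].
apply: (can_inj (mulmxK sigma_unit)); rewrite mul0mx; apply/rowP => b.
by rewrite -(comb_e p q) h mxE.
Qed.

(** The frame [L], [Lb], [e a] is a basis, because its Gram matrix is
    invertible; and no nonzero combination of it is orthogonal to all of it. *)
Lemma null_frame_complete V : g V L = 0 -> g V Lb = 0 ->
  (forall b, g V (e b) = 0) -> V = 0.
Proof.
pose M := col_mx (col_mx L Lb) (\matrix_a e a) : 'M[R]_(1 + 1 + m, m.+2).
have combE (c : 'rV[R]_(1 + 1 + m)) : exists p q xi,
    [/\ c *m M = comb p q xi & (p = 0 -> q = 0 -> xi = 0 -> c = 0)].
  exists (lsubmx (lsubmx c) 0 0), (rsubmx (lsubmx c) 0 0), (rsubmx c); split.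
    rewrite -{1}(hsubmxK c) mul_row_col -{1}(hsubmxK (lsubmx c)) mul_row_col.
    rewrite {1}[lsubmx (lsubmx c)]mx11_scalar {1}[rsubmx (lsubmx c)]mx11_scalar.
    rewrite !mul_scalar_mx mulmx_sum_row; congr (_ + _).
    by apply: eq_bigr => a _; rewrite rowK.
  move=> p0 q0 x0; rewrite -(hsubmxK c) -(hsubmxK (lsubmx c)) x0.
  rewrite [lsubmx (lsubmx c)]mx11_scalar [rsubmx (lsubmx c)]mx11_scalar p0 q0.
  by rewrite !raddf0 !row_mx0.
have Mfree : row_free M.
  rewrite -kermx_eq0; apply/eqP/row_matrixP => i; rewrite row0.
  have [p [q [xi [cE]]]] := combE (row i (kermx M)).
  rewrite -row_mul mulmx_ker row0 in cE.
  have [|||-> -> ->] := @comb_eq0 p q xi; last exact.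
  - by rewrite -cE static_metric0l.
  - by rewrite -cE static_metric0l.
  - by move=> b; rewrite -cE static_metric0l.
have Mfull : row_full M by rewrite /row_full -[X in _ == X]/(1 + 1 + m)%N.
have /submxP[c ->] := submx_full V Mfull.
have [p [q [xi [-> _]]]] := combE c; move=> h1 h2 h3.
have [-> -> ->] := comb_eq0 h1 h2 h3.
rewrite /comb !scale0r !add0r big1 // => a _; by rewrite mxE scale0r.
Qed.

(** The difference of the two sides is orthogonal to the frame. *)
Lemma null_frame_expansion V : V =
  (- 2^-1 * g V Lb) *: L + (- 2^-1 * g V L) *: Lb
  + \sum_a ((\row_b g V (e b)) *m invmx sigma) 0 a *: e a.
Proof.
set W := _ + _ + _; apply/eqP; rewrite -subr_eq0; apply/eqP.
have gB Y : g (V - W) Y = g V Y - g W Y.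
  by rewrite -scaleN1r static_metricDl static_metricZl mulN1r.
have n2 : 2 != 0 :> R by rewrite pnatr_eq0.
apply: null_frame_complete; rewrite ?gB.
- by rewrite [W]/(comb _ _ _) comb_L; field.
- by rewrite [W]/(comb _ _ _) comb_Lb; field.
- move=> b; rewrite gB [W]/(comb _ _ _) comb_e mulmxKV // mxE subrr //.
Qed.

End NullFrame.

(** * The divergence identity in a chart *)

Lemma dir_derivE (R : realType) (m N : nat) (V : 'rV[R]_m -> 'rV[R]_N) v x k :
  dir_deriv V v x 0 k = 'D_v (fun y => V y 0 k) x.
Proof. by rewrite mxE. Qed.

Opaque dir_deriv.

(** The scalar content of the second covariant derivative of [L]. In
    [second_time_deriv], the time component of [D_p D_q L], the derivatives of
    the vectors are independent variables; its symmetry in [p] and [q] uses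
    [pL] and [qL], which say that [L] is normal. *)
Local Lemma time_deriv_ring (R : realType) (c f xx rp rq pq xdq tL dtL dtq xL tq pL xdL k : R) :
  c + ((0 / f + k * (- f ^- 2 * (0 + (0 * xx + k * (rp + rp)))))
       * (rq * tL + tq * xL)
       + k / f * ((pq + xdq) * tL + rq * dtL + (dtq * xL + tq * (pL + xdL)))) =
  c + (- f ^- 2 * (2 * k * rp) * k * (rq * tL + tq * xL)
       + k / f * ((pq + xdq) * tL + rq * dtL + (dtq * xL + tq * (pL + xdL)))).
Proof. by ring. Qed.

Local Definition second_time_deriv (R : realType) (f k tL xL c ePQ xd dt rp rq tp tq pL dLp dLq
    xdLp xdLq : R) : R :=
  c + (- f ^- 2 * (2 * k * rp) * k * (rq * tL + tq * xL)
       + k / f * ((ePQ + xd) * tL + rq * dLp + (dt * xL + tq * (pL + xdLp))))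
  + k / f * (rp * (dLq + k / f * (rq * tL + tq * xL)) + tp * xdLq).

Local Lemma second_time_deriv_sym (R : realType) (f k tL xL c c' ePQ eQP xd xd' dt dt'
    rp rq tp tq pL qL dLp dLq xdLp xdLq : R) : f != 0 ->
  pL = f * (tp * tL) + k / f * (rp * xL) -> qL = f * (tq * tL) + k / f * (rq * xL) ->
  c = c' -> ePQ = eQP -> xd = xd' -> dt = dt' ->
  second_time_deriv f k tL xL c ePQ xd dt rp rq tp tq pL dLp dLq xdLp xdLq =
  second_time_deriv f k tL xL c' eQP xd' dt' rq rp tq tp qL dLq dLp xdLq xdLp.
Proof. by move=> f0 -> -> -> -> -> ->; rewrite /second_time_deriv; field. Qed.

Section Curvature.
Context {R : realType} {m n : nat}.
Variables (kappa : R) (U : set 'rV[R]_m) (X L : 'rV[R]_m -> 'rV[R]_n.+1).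
Local Notation g := (static_metric kappa).
Local Notation tp := time_part.
Local Notation sp := space_part.
Local Notation d a := (basis_vec a : 'rV[R]_m).
Hypotheses (Uo : open U) (Xf : forall x, U x -> lapse2 kappa (X x) != 0).

Definition smooth_vec (V : 'rV[R]_m -> 'rV[R]_n.+1) :=
  forall k, smooth_on U (fun x => V x 0 k).

Definition C1vec (V : 'rV[R]_m -> 'rV[R]_n.+1) :=
  forall k, C1on U (fun x => V x 0 k).

Definition tangent (a : 'I_m) := dir_deriv X (d a).

Definition cov (V : 'rV[R]_m -> 'rV[R]_n.+1) a x :=
  covD kappa x X V (tangent a x) (dir_deriv V (d a) x).

Lemma smooth_C1vec V : smooth_vec V -> C1vec V.
Proof. by move=> h k; have := smooth_C1on [::] (h k). Qed.

Lemma smooth_dir_deriv V a : smooth_vec V -> C1vec (dir_deriv V (d a)).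
Proof.
move=> h k; have := smooth_C1on [:: a] (h k).
by apply: C1on_eq => // x _; rewrite dir_derivE.
Qed.

Lemma C1vec_dir_deriv V a x : C1vec V -> U x ->
  has_dir_deriv x (d a) V (dir_deriv V (d a) x).
Proof. by move=> h Ux k; rewrite dir_derivE; exact: C1on_is_derive (h k) Ux. Qed.

Lemma C1on_time V : C1vec V -> C1on U (fun x => tp (V x)).
Proof. by move=> h; exact: h. Qed.

Lemma C1on_space V k : C1vec V -> C1on U (fun x => sp (V x) 0 k).
Proof.
by move=> h; apply: (C1on_eq Uo _ (h (lift ord0 k))) => x _; rewrite mxE.
Qed.

Lemma C1on_dotp V W : C1vec V -> C1vec W ->
  C1on U (fun x => dotp (sp (V x)) (sp (W x))).
Proof.
move=> hV hW; apply: (@C1on_sum _ _ U _ (index_enum _) xpredT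
  (fun k x => sp (V x) 0 k * sp (W x) 0 k) Uo) => k _.
by apply: (C1onM Uo); exact: C1on_space.
Qed.

Hypothesis X_smooth : smooth_vec X.
Let hX : C1vec X := smooth_C1vec X_smooth.
Let he a : C1vec (tangent a) := smooth_dir_deriv a X_smooth.

Lemma C1on_lapse2 : C1on U (fun x => lapse2 kappa (X x)).
Proof.
apply: (C1onD Uo); first exact: C1on_cst.
by apply: (C1onM Uo); [exact: C1on_cst|exact: C1on_dotp].
Qed.

Lemma C1on_kappa_lapse2 : C1on U (fun x => kappa / lapse2 kappa (X x)).
Proof.
apply: (C1onM Uo); first exact: C1on_cst.
exact: (C1onV Uo C1on_lapse2 Xf).
Qed.

Lemma C1on_static_metric V W : C1vec V -> C1vec W ->
  C1on U (fun x => g (X x) (V x) (W x)).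
Proof.
move=> hV hW; apply: (C1on_eq Uo (g := fun x =>
  - lapse2 kappa (X x) * (tp (V x) * tp (W x)) + dotp (sp (V x)) (sp (W x))
  + - (kappa / lapse2 kappa (X x)
       * (dotp (sp (X x)) (sp (V x)) * dotp (sp (X x)) (sp (W x)))))) => [//|].
apply: (C1onD Uo); first apply: (C1onD Uo).
- apply: (C1onM Uo); first exact: (C1onN Uo C1on_lapse2).
  by apply: (C1onM Uo); [exact: (C1on_time hV)|exact: (C1on_time hW)].
- exact: C1on_dotp.
- apply: (C1onN Uo); apply: (C1onM Uo); first exact: C1on_kappa_lapse2.
  by apply: (C1onM Uo); exact: C1on_dotp.
Qed.

Lemma C1on_Qform V W : C1vec V -> C1vec W ->
  C1on U (fun x => Qform (X x) (V x) (W x)).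
Proof.
move=> hV hW; apply: (C1on_eq Uo (g := fun x =>
  dotp (sp (X x)) (sp (V x)) * tp (W x)
  + - (tp (V x) * dotp (sp (X x)) (sp (W x))))) => [//|].
apply: (C1onD Uo); last apply: (C1onN Uo).
- by apply: (C1onM Uo); [exact: C1on_dotp|exact: (C1on_time hW)].
- by apply: (C1onM Uo); [exact: (C1on_time hV)|exact: C1on_dotp].
Qed.

Lemma C1vec_cov V a : smooth_vec V -> C1vec (cov V a).
Proof.
move=> hV k; have hV1 := smooth_C1vec hV.
apply: (C1on_eq Uo (g := fun x => dir_deriv V (d a) x 0 k +
   static_conn kappa (X x) (tangent a x) (V x) 0 k)).
  by move=> x _; rewrite mxE.
apply: (C1onD Uo); first exact: smooth_dir_deriv.
case: (unliftP ord0 k) => [j|] ->.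
  apply: (C1on_eq Uo (g := fun x => - (kappa * g (X x) (tangent a x) (V x))
    * sp (X x) 0 j)).
    move=> x _; rewrite /static_conn; set t := _ * (_ + _); set c := - _.
    have := congr1 (fun u : 'rV_n => u 0 j) (space_part_static t (c *: sp (X x))).
    by rewrite mxE => ->; rewrite mxE.
  apply: (C1onM Uo); last exact: C1on_space.
  apply: (C1onN Uo); apply: (C1onM Uo); first exact: C1on_cst.
  exact: C1on_static_metric.
apply: (C1on_eq Uo (g := fun x => kappa / lapse2 kappa (X x) *
   (dotp (sp (X x)) (sp (tangent a x)) * tp (V x) +
    tp (tangent a x) * dotp (sp (X x)) (sp (V x))))).
  by move=> x _; exact: time_part_static.
apply: (C1onM Uo); first exact: C1on_kappa_lapse2.
apply: (C1onD Uo); apply: (C1onM Uo).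
- exact: (C1on_dotp hX (he a)).
- exact: (C1on_time hV1).
- exact: (C1on_time (he a)).
- exact: (C1on_dotp hX hV1).
Qed.

Lemma is_derive_g V W a x : C1vec V -> C1vec W -> U x ->
  is_derive x (d a) (fun y => g (X y) (V y) (W y))
    (g (X x) (cov V a x) (W x) + g (X x) (V x) (cov W a x)).
Proof.
move=> hV hW Ux; apply: is_derive_static_metric; first exact: Xf.
- exact: C1vec_dir_deriv.
- exact: C1vec_dir_deriv.
- exact: C1vec_dir_deriv.
Qed.

Lemma is_derive_Q V W a x : C1vec V -> C1vec W -> U x ->
  is_derive x (d a) (fun y => Qform (X y) (V y) (W y))
    (Qform (X x) (cov V a x) (W x) + Qform (X x) (V x) (cov W a x)
     - (g (X x) (tangent a x) (V x) * g (X x) (W x) partial_t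
        - g (X x) (tangent a x) (W x) * g (X x) (V x) partial_t)).
Proof.
move=> hV hW Ux; apply: is_derive_Qform; first exact: Xf.
- exact: C1vec_dir_deriv.
- exact: C1vec_dir_deriv.
- exact: C1vec_dir_deriv.
Qed.

Lemma is_derive_constant_on (f : 'rV[R]_m -> R) c a x df :
  (forall y, U y -> f y = c) -> U x -> is_derive x (d a) f df -> df = 0.
Proof.
move=> fc Ux [_ <-]; rewrite (@near_eq_derive _ _ _ f (cst c)) ?derive_cst //.
by have : \near x, U x by [exact: open_nbhs_nbhs]; apply: filterS.
Qed.

Lemma dir_deriv_sym V a b x : smooth_vec V -> U x ->
  dir_deriv (dir_deriv V (d b)) (d a) x = dir_deriv (dir_deriv V (d a)) (d b) x.
Proof.
move=> hV Ux; apply/rowP => k; rewrite [LHS]dir_derivE [RHS]dir_derivE.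
have E c : (fun y => dir_deriv V (d c) y 0 k) = 'D_(d c) (fun y => V y 0 k).
  by apply/funext => y; rewrite dir_derivE.
rewrite (E a) (E b).
exact: (schwarz Uo (smooth_C1on [::] (hV k)) (smooth_C1on [:: a] (hV k))
  (smooth_C1on [:: b] (hV k)) Ux).
Qed.

Lemma tangent_sym a b x : U x ->
  dir_deriv (tangent b) (d a) x = dir_deriv (tangent a) (d b) x.
Proof. exact: dir_deriv_sym. Qed.

Lemma cov_tangent_sym a b x : U x -> cov (tangent b) a x = cov (tangent a) b x.
Proof.
by move=> Ux; rewrite /cov /covD (static_connC _ _ (tangent a x)) (tangent_sym a b Ux).
Qed.

Hypothesis L_smooth : smooth_vec L.
Let hL : C1vec L := smooth_C1vec L_smooth.

Let time_cov c y : tp (cov L c y) = tp (dir_deriv L (d c) y) +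
    kappa / lapse2 kappa (X y) * (dotp (sp (X y)) (sp (tangent c y)) * tp (L y)
      + tp (tangent c y) * dotp (sp (X y)) (sp (L y))).
Proof. by rewrite /cov /covD time_partD /static_conn time_part_static. Qed.

Let time_dir_deriv_cov p q x : U x -> tp (dir_deriv (cov L q) (d p) x) =
  tp (dir_deriv (dir_deriv L (d q)) (d p) x) +
  (- (lapse2 kappa (X x)) ^- 2
     * (2 * kappa * dotp (sp (X x)) (sp (tangent p x)))
   * kappa * (dotp (sp (X x)) (sp (tangent q x)) * tp (L x)
     + tp (tangent q x) * dotp (sp (X x)) (sp (L x))) +
   kappa / lapse2 kappa (X x) *
   ((dotp (sp (tangent p x)) (sp (tangent q x)) +
     dotp (sp (X x)) (sp (dir_deriv (tangent q) (d p) x))) * tp (L x) +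
    dotp (sp (X x)) (sp (tangent q x)) * tp (dir_deriv L (d p) x) +
    (tp (dir_deriv (tangent q) (d p) x) * dotp (sp (X x)) (sp (L x)) +
     tp (tangent q x) * (dotp (sp (tangent p x)) (sp (L x))
       + dotp (sp (X x)) (sp (dir_deriv L (d p) x)))))).
Proof.
move=> Ux; rewrite [LHS]/(tp _) /time_part dir_derivE.
have -> : (fun y => cov L q y 0 ord0) = (fun y => tp (dir_deriv L (d q) y) +
  kappa / lapse2 kappa (X y) * (dotp (sp (X y)) (sp (tangent q y)) * tp (L y)
    + tp (tangent q y) * dotp (sp (X y)) (sp (L y)))).
  by apply/funext => y; rewrite -time_cov.
have hc (c : R) : is_derive x (d p) (fun=> c) 0 by exact: is_derive_cst.
have h1 : is_derive x (d p) (fun y => tp (dir_deriv L (d q) y))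
    (tp (dir_deriv (dir_deriv L (d q)) (d p) x)) :=
  C1vec_dir_deriv p (smooth_dir_deriv q L_smooth) Ux ord0.
have dX := C1vec_dir_deriv p hX Ux.
have dL := C1vec_dir_deriv p hL Ux.
have de := C1vec_dir_deriv p (he q) Ux.
have sX := is_derive_space_part dX.
have sL := is_derive_space_part dL.
have se := is_derive_space_part de.
have tL := is_derive_time_part dL.
have te := is_derive_time_part de.
have hlap : is_derive x (d p) (fun y => lapse2 kappa (X y)) _ :=
  is_derive_D (hc 1) (is_derive_M (hc kappa) (is_derive_dotp sX sX)).
have h2 := is_derive_M (hc kappa)
  (@is_derive_V _ _ (fun y => lapse2 kappa (X y)) _ _ _ (Xf Ux) hlap).
have [_ ->] := is_derive_D h1 (is_derive_M h2 (is_derive_D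
   (is_derive_M (is_derive_dotp sX se) tL) (is_derive_M te (is_derive_dotp sX sL)))).
rewrite -/(tangent p) (dotpC (sp (tangent p x)) (sp (X x))).
exact: time_deriv_ring.
Qed.

Hypothesis L_normal : forall x a, U x -> g (X x) (tangent a x) (L x) = 0.

Let space_cov c y : U y -> sp (cov L c y) = sp (dir_deriv L (d c) y).
Proof.
move=> Uy; rewrite /cov /covD space_partD /static_conn space_part_static.
by rewrite L_normal // mulr0 oppr0 scale0r addr0.
Qed.

Let space_dir_deriv_cov p q x : U x -> sp (dir_deriv (cov L q) (d p) x) =
  sp (dir_deriv (dir_deriv L (d q)) (d p) x).
Proof.
move=> Ux; apply/rowP => k; rewrite [LHS]mxE [LHS]mxE [RHS]mxE [RHS]mxE.
apply: near_eq_derive.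
have : \near x, U x by exact: open_nbhs_nbhs.
apply: filterS => y Uy; have := space_cov q Uy.
by move=> /(congr1 (fun u : 'rV_n => u 0 k)); rewrite [LHS]mxE [RHS]mxE.
Qed.

Let time_covD V a x : tp (cov V a x) = tp (dir_deriv V (d a) x)
  + kappa / lapse2 kappa (X x) * (dotp (sp (X x)) (sp (tangent a x)) * tp (V x)
      + tp (tangent a x) * dotp (sp (X x)) (sp (V x))).
Proof. by rewrite /cov /covD time_partD /static_conn time_part_static. Qed.

Let space_covD V a x : sp (cov V a x) = sp (dir_deriv V (d a) x)
  + (- (kappa * g (X x) (tangent a x) (V x))) *: sp (X x).
Proof. by rewrite /cov /covD space_partD /static_conn space_part_static. Qed.

Let normal_dotp a x : U x -> dotp (sp (tangent a x)) (sp (L x)) =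
  lapse2 kappa (X x) * (tp (tangent a x) * tp (L x))
  + kappa / lapse2 kappa (X x)
    * (dotp (sp (X x)) (sp (tangent a x)) * dotp (sp (X x)) (sp (L x))).
Proof.
move=> Ux; have := L_normal a Ux; rewrite /static_metric -/(lapse2 kappa (X x)).
by move=> /eqP; rewrite subr_eq0 mulNr addrC subr_eq => /eqP ->; rewrite addrC.
Qed.

Let time_cov_cov p q x : U x -> tp (cov (cov L q) p x) =
  second_time_deriv (lapse2 kappa (X x)) kappa (tp (L x)) (dotp (sp (X x)) (sp (L x)))
    (tp (dir_deriv (dir_deriv L (d q)) (d p) x))
    (dotp (sp (tangent p x)) (sp (tangent q x)))
    (dotp (sp (X x)) (sp (dir_deriv (tangent q) (d p) x)))
    (tp (dir_deriv (tangent q) (d p) x))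
    (dotp (sp (X x)) (sp (tangent p x))) (dotp (sp (X x)) (sp (tangent q x)))
    (tp (tangent p x)) (tp (tangent q x)) (dotp (sp (tangent p x)) (sp (L x)))
    (tp (dir_deriv L (d p) x)) (tp (dir_deriv L (d q) x))
    (dotp (sp (X x)) (sp (dir_deriv L (d p) x)))
    (dotp (sp (X x)) (sp (dir_deriv L (d q) x))).
Proof.
move=> Ux; apply: (etrans (time_covD (cov L q) p x)).
have E := congr2 (fun u w => dotp (sp (X x)) (sp (tangent p x)) * u
  + tp (tangent p x) * dotp (sp (X x)) w) (time_cov q x) (space_cov q Ux).
exact: (congr2 (fun u w => u + kappa / lapse2 kappa (X x) * w) (time_dir_deriv_cov p q Ux) E).
Qed.

Let space_cov_cov p q x : U x -> sp (cov (cov L q) p x) =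
  sp (dir_deriv (dir_deriv L (d q)) (d p) x)
  + (- (kappa * g (X x) (cov L q x) (tangent p x))) *: sp (X x).
Proof.
move=> Ux; apply: (etrans (space_covD (cov L q) p x)).
exact: (congr2 (fun u w => u + (- (kappa * w)) *: sp (X x))
  (space_dir_deriv_cov p q Ux) (static_metricC _ _ (tangent p x) (cov L q x))).
Qed.

Opaque static_metric cov tangent dir_deriv dotp lapse2 time_part space_part.

Lemma second_form_cov a b x : U x ->
  g (X x) (cov L a x) (tangent b x) = - g (X x) (L x) (cov (tangent b) a x).
Proof.
move=> Ux; have h := is_derive_g a (he b) hL Ux.
have /eqP := is_derive_constant_on (fun y Uy => L_normal b Uy) Ux h.
rewrite addrC addr_eq0 (static_metricC _ _ (tangent b x)).
by rewrite (static_metricC _ _ (cov (tangent b) a x)) => /eqP.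
Qed.

(** A derivative of the vanishing product of [L] and a tangent vector, and the
    symmetry of the second derivatives of [X]. *)
Lemma second_form_sym a b x : U x ->
  g (X x) (cov L a x) (tangent b x) = g (X x) (cov L b x) (tangent a x).
Proof.
move=> Ux; have E := congr1 (fun w => - g (X x) (L x) w) (cov_tangent_sym a b Ux).
exact: (etrans (second_form_cov a b Ux) (etrans E (esym (second_form_cov b a Ux)))).
Qed.

(** The curvature of a spacetime of constant curvature annihilates a normal
    vector, so that second covariant derivatives of a normal field commute.
    Both sides are computed in coordinates; what does not cancel at once is
    the normality of [L]. *)
Lemma cov_cov_sym a b x : U x -> cov (cov L b) a x = cov (cov L a) b x.
Proof.
move=> Ux; apply: time_space_eq.
  apply: (etrans (time_cov_cov a b Ux)); apply: (etrans _ (esym (time_cov_cov b a Ux))).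
  exact: (second_time_deriv_sym _ _ _ _ (Xf Ux)
    (normal_dotp a Ux) (normal_dotp b Ux) (congr1 tp (dir_deriv_sym a b L_smooth Ux))
    (dotpC (sp (tangent a x)) (sp (tangent b x)))
    (congr1 (fun u => dotp (sp (X x)) (sp u)) (tangent_sym a b Ux))
    (congr1 tp (tangent_sym a b Ux))).
apply: (etrans (space_cov_cov a b Ux)); apply: (etrans _ (esym (space_cov_cov b a Ux))).
have E1 := congr1 sp (dir_deriv_sym a b L_smooth Ux).
have E2 := second_form_sym a b Ux.
exact: (congr2 (fun u w => u + (- (kappa * w)) *: sp (X x)) E1 (esym E2)).
Qed.

End Curvature.

Lemma is_derive_comp1 (R : realType) (V : normedModType R) (f : V -> R) (phi : R -> R)
    (x v : V) (df dphi : R) :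
  is_derive (f x) (1 : R) phi dphi -> is_derive x v f df ->
  is_derive x v (fun y => phi (f y)) (dphi * df).
Proof.
move=> hp hf; apply/is_derive_line0.
apply: (@is_derive1_comp _ phi (fun t : R => f (t *: v + x))).
  by rewrite scale0r add0r.
by apply/is_derive_line0.
Qed.

Local Lemma mxDE (R : realType) p q (M M' : 'M[R]_(p, q)) i j : (M + M') i j = M i j + M' i j.
Proof. by rewrite mxE. Qed.

Local Lemma mxZE (R : realType) p q k (M : 'M[R]_(p, q)) i j : (k *: M) i j = k * M i j.
Proof. by rewrite mxE. Qed.

(** The ambient geometry enters the divergence identity only through metric
    compatibility, the Killing-Yano equation, the symmetry of second covariant
    derivatives and the expansion of vectors in the null frame. The metric, the
    two-form and the connection along the chart are therefore variables. *)
Section DivergenceIdentity.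
Context {R : realType} {m N : nat}.
Variables (U : set 'rV[R]_m).
Variables (g Q : 'rV[R]_m -> 'rV[R]_N -> 'rV[R]_N -> R).
Variables (xi : 'rV[R]_m -> 'rV[R]_N -> R).
Variables (e : 'I_m -> 'rV[R]_m -> 'rV[R]_N) (L Lb : 'rV[R]_m -> 'rV[R]_N).
Variable (cov : ('rV[R]_m -> 'rV[R]_N) -> 'I_m -> 'rV[R]_m -> 'rV[R]_N).
Variable (ok : ('rV[R]_m -> 'rV[R]_N) -> Prop).
Local Notation d a := (basis_vec a : 'rV[R]_m).
Hypothesis Uo : open U.
Hypotheses (gC : forall x V W, g x V W = g x W V)
  (gDl : forall x V V' W, g x (V + V') W = g x V W + g x V' W)
  (gZl : forall x k V W, g x (k *: V) W = k * g x V W).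
Hypotheses (QC : forall x V W, Q x V W = - Q x W V)
  (QDl : forall x V V' W, Q x (V + V') W = Q x V W + Q x V' W)
  (QZl : forall x k V W, Q x (k *: V) W = k * Q x V W).
Hypotheses (ok_e : forall a, ok (e a)) (ok_L : ok L) (ok_Lb : ok Lb)
  (ok_covL : forall a, ok (cov L a)) (ok_covLb : forall a, ok (cov Lb a)).
Hypothesis g_deriv : forall V W a x, ok V -> ok W -> U x ->
  is_derive x (d a) (fun y => g y (V y) (W y))
    (g x (cov V a x) (W x) + g x (V x) (cov W a x)).
Hypothesis Q_deriv : forall V W a x, ok V -> ok W -> U x ->
  is_derive x (d a) (fun y => Q y (V y) (W y))
    (Q x (cov V a x) (W x) + Q x (V x) (cov W a x)
     - (g x (e a x) (V x) * xi x (W x) - g x (e a x) (W x) * xi x (V x))).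
Hypothesis cov_e_sym : forall a b x, U x -> cov (e b) a x = cov (e a) b x.
Hypothesis cov_cov_L : forall a b x, U x -> cov (cov L b) a x = cov (cov L a) b x.
Hypothesis cov_cov_Lb : forall a b x, U x -> cov (cov Lb b) a x = cov (cov Lb a) b x.
Hypotheses (LL : forall x, U x -> g x (L x) (L x) = 0)
  (bb : forall x, U x -> g x (Lb x) (Lb x) = 0)
  (Lb2 : forall x, U x -> g x (L x) (Lb x) = - 2)
  (eL : forall x a, U x -> g x (e a x) (L x) = 0)
  (eb : forall x a, U x -> g x (e a x) (Lb x) = 0)
  (torsion0 : forall x a, U x -> g x (cov L a x) (Lb x) = 0).

Let sigma x : 'M[R]_m := \matrix_(a, b) g x (e a x) (e b x).
Let chi x : 'M[R]_m := \matrix_(a, b) g x (cov L a x) (e b x).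
Let chib x : 'M[R]_m := \matrix_(a, b) g x (cov Lb a x) (e b x).
Let beta x : 'rV[R]_m := \row_c Q x (L x) (e c x).
Let S x := invmx (sigma x).
Let conn a x : 'M[R]_m := (\matrix_(b, c) g x (cov (e b) a x) (e c x)) *m S x.
Let Qm x : 'M[R]_m := \matrix_(b, c) Q x (e b x) (e c x).

Hypothesis sigma_pos : forall x, U x -> 0 < \det (sigma x).
Hypothesis chi_sym : forall x, U x -> (chi x)^T = chi x.
Hypothesis chib_sym : forall x, U x -> (chib x)^T = chib x.
Hypothesis frame_expansion : forall x V, U x -> V =
  (- 2^-1 * g x V (Lb x)) *: L x + (- 2^-1 * g x V (L x)) *: Lb x
  + \sum_a ((\row_b g x V (e b x)) *m S x) 0 a *: e a x.

Let g0l x W : g x 0 W = 0.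
Proof. by rewrite -(scale0r (0 : 'rV[R]_N)) gZl mul0r. Qed.

Let g_suml x (F : 'I_m -> 'rV[R]_N) W : g x (\sum_i F i) W = \sum_i g x (F i) W.
Proof. by apply: (big_morph (fun V => g x V W)) => // V V'; rewrite gDl. Qed.

Let Q0l x W : Q x 0 W = 0.
Proof. by rewrite -(scale0r (0 : 'rV[R]_N)) QZl mul0r. Qed.

Let Q_suml x (F : 'I_m -> 'rV[R]_N) W : Q x (\sum_i F i) W = \sum_i Q x (F i) W.
Proof. by apply: (big_morph (fun V => Q x V W)) => // V V'; rewrite QDl. Qed.

Let sigma_sym x : (sigma x)^T = sigma x.
Proof. by apply/matrixP => a b; rewrite !mxE gC. Qed.

Let sigma_unit x : U x -> sigma x \in unitmx.
Proof. by move=> Ux; rewrite unitmxE unitfE gt_eqF // sigma_pos. Qed.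

Let S_sym x : (S x)^T = S x.
Proof. by rewrite trmx_inv sigma_sym. Qed.

Let const_deriv (f : 'rV[R]_m -> R) c a x df :
  (forall y, U y -> f y = c) -> U x -> is_derive x (d a) f df -> df = 0.
Proof. exact: is_derive_constant_on. Qed.

Let covL_L x a : U x -> g x (cov L a x) (L x) = 0.
Proof.
move=> Ux; have := const_deriv LL Ux (g_deriv a ok_L ok_L Ux).
by rewrite (gC x (L x)) => /eqP; rewrite -mulr2n mulrn_eq0 /= => /eqP.
Qed.

Let covLb_Lb x a : U x -> g x (cov Lb a x) (Lb x) = 0.
Proof.
move=> Ux; have := const_deriv bb Ux (g_deriv a ok_Lb ok_Lb Ux).
by rewrite (gC x (Lb x)) => /eqP; rewrite -mulr2n mulrn_eq0 /= => /eqP.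
Qed.

Let covLb_L x a : U x -> g x (cov Lb a x) (L x) = 0.
Proof.
move=> Ux; have := const_deriv Lb2 Ux (g_deriv a ok_L ok_Lb Ux).
by rewrite torsion0 // add0r gC.
Qed.

Let cove_L x a b : U x -> g x (cov (e b) a x) (L x) = - chi x a b.
Proof.
move=> Ux; have := const_deriv (fun y Uy => eL b Uy) Ux (g_deriv a (ok_e b) ok_L Ux).
by move/eqP; rewrite addr_eq0 => /eqP ->; rewrite mxE gC.
Qed.

Let cove_Lb x a b : U x -> g x (cov (e b) a x) (Lb x) = - chib x a b.
Proof.
move=> Ux; have := const_deriv (fun y Uy => eb b Uy) Ux (g_deriv a (ok_e b) ok_Lb Ux).
by move/eqP; rewrite addr_eq0 => /eqP ->; rewrite mxE gC.
Qed.

Let covL_expansion x a : U x -> cov L a x = \sum_c (chi x *m S x) a c *: e c x.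
Proof.
move=> Ux; rewrite {1}(frame_expansion (cov L a x) Ux) torsion0 // covL_L //.
rewrite !mulr0 !scale0r !add0r; apply: eq_bigr => c _; congr (_ *: _).
have -> : \row_b g x (cov L a x) (e b x) = row a (chi x).
  by apply/rowP => b; rewrite !mxE.
by rewrite -row_mul [LHS]mxE.
Qed.

Let covLb_expansion x a : U x -> cov Lb a x = \sum_c (chib x *m S x) a c *: e c x.
Proof.
move=> Ux; rewrite {1}(frame_expansion (cov Lb a x) Ux) covLb_L // covLb_Lb //.
rewrite !mulr0 !scale0r !add0r; apply: eq_bigr => c _; congr (_ *: _).
have -> : \row_b g x (cov Lb a x) (e b x) = row a (chib x).
  by apply/rowP => b; rewrite !mxE.
by rewrite -row_mul [LHS]mxE.
Qed.

Let cove_expansion x a b : U x -> cov (e b) a x =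
  (2^-1 * chib x a b) *: L x + (2^-1 * chi x a b) *: Lb x
  + \sum_c conn a x b c *: e c x.
Proof.
move=> Ux; rewrite {1}(frame_expansion (cov (e b) a x) Ux) cove_L // cove_Lb //.
rewrite !mulrNN; congr (_ + _); apply: eq_bigr => c _; congr (_ *: _).
rewrite /conn; set M := \matrix_(b0, c0) g x (cov (e b0) a x) (e c0 x).
have -> : \row_b0 g x (cov (e b) a x) (e b0 x) = row b M.
  by apply/rowP => c'; rewrite !mxE.
by rewrite -row_mul [LHS]mxE.
Qed.

(* A tangent vector sees only the intrinsic part of the second derivatives. *)
Let g_tangent_cove x a b (xi' : 'rV[R]_m) : U x ->
  g x (\sum_c xi' 0 c *: e c x) (cov (e b) a x)
  = ((xi' *m sigma x) *m (conn a x)^T) 0 b.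
Proof.
move=> Ux; rewrite /conn trmx_mul S_sym mulmxA mulmxK ?sigma_unit //.
rewrite g_suml mxE; apply: eq_bigr => c _.
by rewrite gZl !mxE gC.
Qed.

(** Differentiating [g (cov L b) Lb = 0] shows that the shape operators of
    [L] and [Lb] commute; this is the Ricci equation. *)
Let shape_comm x : U x ->
  chi x *m S x *m chib x = chib x *m S x *m chi x.
Proof.
move=> Ux; have E : (chi x *m S x *m chib x)^T = chi x *m S x *m chib x.
  apply/matrixP => a b; rewrite mxE.
  have H p q : (chi x *m S x *m chib x) q p = - g x (cov (cov L q) p x) (Lb x).
    have := const_deriv (fun y Uy => torsion0 q Uy) Ux (g_deriv p (ok_covL q) ok_Lb Ux).
    move/eqP; rewrite addrC addr_eq0 => /eqP <-.
    rewrite (covL_expansion q Ux) g_suml [LHS]mxE; apply: eq_bigr => c _.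
    by rewrite gZl; congr (_ * _); rewrite -(chib_sym Ux) [LHS]mxE [LHS]mxE gC.
  by rewrite !H cov_cov_L.
by rewrite -E !trmx_mul S_sym chi_sym // chib_sym // mulmxA.
Qed.

Let e_cove x a b c : U x ->
  g x (e b x) (cov (e c) a x) = (sigma x *m (conn a x)^T) b c.
Proof.
move=> Ux; rewrite /conn trmx_mul S_sym mulmxA mulmxV ?sigma_unit // mul1mx.
by rewrite !mxE gC.
Qed.

Let covL_cove x a b c : U x ->
  g x (cov L b x) (cov (e c) a x) = (chi x *m (conn a x)^T) b c.
Proof.
move=> Ux; rewrite (covL_expansion b Ux).
have -> : \sum_c0 (chi x *m S x) b c0 *: e c0 x =
    \sum_c0 (row b (chi x *m S x)) 0 c0 *: e c0 x.
  by apply: eq_bigr => c0 _; rewrite [in RHS]mxE.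
rewrite g_tangent_cove // -!row_mul [LHS]mxE mulmxKV // sigma_unit //.
Qed.

Let covLb_cove x a b c : U x ->
  g x (cov Lb b x) (cov (e c) a x) = (chib x *m (conn a x)^T) b c.
Proof.
move=> Ux; rewrite (covLb_expansion b Ux).
have -> : \sum_c0 (chib x *m S x) b c0 *: e c0 x =
    \sum_c0 (row b (chib x *m S x)) 0 c0 *: e c0 x.
  by apply: eq_bigr => c0 _; rewrite [in RHS]mxE.
rewrite g_tangent_cove // -!row_mul [LHS]mxE mulmxKV // sigma_unit //.
Qed.

Let sigma_deriv x a b c : U x -> is_derive x (d a) (fun z => sigma z b c)
  ((conn a x *m sigma x + sigma x *m (conn a x)^T) b c).
Proof.
move=> Ux; have -> : (fun z => sigma z b c) = (fun z => g z (e b z) (e c z)).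
  by apply/funext => z; rewrite mxE.
apply: (is_derive_eq (g_deriv a (ok_e b) (ok_e c) Ux)).
rewrite e_cove // [RHS]mxE; congr (_ + _).
by rewrite /conn mulmxKV ?sigma_unit // mxE.
Qed.

Let det_sigma_deriv x a : U x -> is_derive x (d a) (fun z => \det (sigma z))
  (2 * \tr (conn a x) * \det (sigma x)).
Proof.
move=> Ux; have := is_derive_det (fun b c => sigma_deriv a b c Ux).
rewrite mulmxDl raddfD /= -(mulmxA (conn a x)) mul_mx_adj mul_mx_scalar mxtraceZ.
rewrite (mxtrace_mulC (sigma x *m _)) mulmxA mul_adj_mx mul_scalar_mx mxtraceZ mxtrace_tr.
by have -> // : forall p q : R, p * q + p * q = 2 * q * p by move=> *; ring.
Qed.

Variables y yb : R.
Let B x := sigma x + y *: chi x + yb *: chib x.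
(** The part of the derivative of [B] that is symmetric in [a] and the row. *)
Let Sd a x : 'M[R]_m := \matrix_(b, c) (g x (cov (e b) a x) (e c x)
  + y * g x (cov (cov L b) a x) (e c x) + yb * g x (cov (cov Lb b) a x) (e c x)).

Let B_deriv x a b c : U x -> is_derive x (d a) (fun z => B z b c)
  ((Sd a x + B x *m (conn a x)^T) b c).
Proof.
move=> Ux; have hc (k : R) : is_derive x (d a) (fun=> k) 0 by exact: is_derive_cst.
have h := is_derive_D (is_derive_D (g_deriv a (ok_e b) (ok_e c) Ux)
  (is_derive_M (hc y) (g_deriv a (ok_covL b) (ok_e c) Ux)))
  (is_derive_M (hc yb) (g_deriv a (ok_covLb b) (ok_e c) Ux)).
have -> : (fun z => B z b c) = (fun z => g z (e b z) (e c z)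
    + y * g z (cov L b z) (e c z) + yb * g z (cov Lb b z) (e c z)).
  by apply/funext => z; rewrite !mxE.
apply: (is_derive_eq h).
rewrite e_cove // covL_cove // covLb_cove // mxDE [Sd _ _ _ _]mxE.
rewrite /B !mulmxDl -!scalemxAl !(mxDE, mxZE).
ring.
Qed.

Let w x := 2^-1 * Q x (L x) (Lb x).
Let T x : 'M[R]_m := xi x (L x) *: sigma x + chi x *m S x *m Qm x + w x *: chi x.

Let beta_deriv x a c : U x -> is_derive x (d a) (fun z => beta z 0 c)
  ((row a (T x) + beta x *m (conn a x)^T) 0 c).
Proof.
move=> Ux; have h := Q_deriv a ok_L (ok_e c) Ux.
have -> : (fun z => beta z 0 c) = (fun z => Q z (L z) (e c z)).
  by apply/funext => z; rewrite mxE.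
apply: (is_derive_eq h).
rewrite eL // mul0r sub0r opprK (covL_expansion a Ux) Q_suml.
rewrite QC (cove_expansion a c Ux) !QDl !QZl Q_suml.
have QLL : Q x (L x) (L x) = 0.
  by apply/eqP; have /eqP := QC x (L x) (L x); rewrite -addr_eq0 -mulr2n mulrn_eq0.
rewrite QLL mulr0 add0r opprD -mulrN -QC.
have -> : - (\sum_i Q x (conn a x c i *: e i x) (L x)) = (beta x *m (conn a x)^T) 0 c.
  rewrite -sumrN mxE; apply: eq_bigr => i _.
  by rewrite QZl -mulrN -QC !mxE mulrC.
have -> : \sum_i Q x ((chi x *m S x) a i *: e i x) (e c x) = (chi x *m S x *m Qm x) a c.
  by rewrite [RHS]mxE; apply: eq_bigr => i _; rewrite QZl [Qm _ _ _]mxE.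
rewrite mxDE [row _ _ _ _]mxE /T !(mxDE, mxZE) [sigma x a c]mxE /w; ring.
Qed.

Definition divergence_field a x : R :=
  (beta x *m \adj (B x)) 0 a / Num.sqrt (\det (sigma x)).

Definition divergence_density x : R :=
  (xi x (L x) * \tr (sigma x *m \adj (B x))
   + 2^-1 * Q x (L x) (Lb x) * \tr (chi x *m \adj (B x))) / Num.sqrt (\det (sigma x)).

Let invsqrt x := (Num.sqrt (\det (sigma x)))^-1.

Let invsqrt_deriv x a : U x -> is_derive x (d a) invsqrt (- \tr (conn a x) * invsqrt x).
Proof.
move=> Ux; have pos := sigma_pos Ux.
have sq0 : Num.sqrt (\det (sigma x)) != 0 by rewrite gt_eqF // sqrtr_gt0.
have h1 := @is_derive_comp1 _ _ (fun z => \det (sigma z)) _ _ _ _ _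
  (is_derive1_sqrt pos) (det_sigma_deriv a Ux).
have h := @is_derive_V _ _ (fun z => Num.sqrt (\det (sigma z))) _ _ _ sq0 h1.
apply: (is_derive_eq h); rewrite /invsqrt.
have := sqr_sqrtr (ltW pos); move: (Num.sqrt _) sq0 => q q0 <-.
by field.
Qed.

(** [divergence_field a] is the determinant of [B] with [beta] in the row [a],
    divided by the volume, and Jacobi's formula differentiates it. The symmetric
    parts [Sd] of the derivatives of the other rows cancel in the sum over [a],
    the derivative of [beta] leaves the rows of [T], and the connection terms
    cancel against the derivative of the volume. *)
Lemma divergence_identity x : U x ->
  exists2 v : 'I_m -> R,
    (forall a, is_derive x (d a) (divergence_field a) (v a)) &
    \sum_a v a = divergence_density x.
Proof.
move=> Ux.
pose u a := row a (T x); pose G a := (conn a x)^T.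
exists (fun a => \tr ((setrow a (u a) (Sd a x) + setrow a (beta x) (B x) *m G a)
              *m \adj (setrow a (beta x) (B x))) * invsqrt x
   + (beta x *m \adj (B x)) 0 a * (- \tr (conn a x) * invsqrt x)).
  move=> a; have -> : divergence_field a =
      (fun z => \det (setrow a (beta z) (B z)) * invsqrt z).
    by apply/funext => z; rewrite det_setrow.
  rewrite -det_setrow; apply: is_derive_M; last exact: invsqrt_deriv.
  apply: is_derive_det => b c.
  have [->|ba] := eqVneq b a.
    have -> : (fun z => setrow a (beta z) (B z) a c) = (fun z => beta z 0 c).
      by apply/funext => z; rewrite mxE eqxx.
    apply: (is_derive_eq (beta_deriv a c Ux)).
    rewrite mxE [RHS]mxE; congr (_ + _); first by rewrite [RHS]mxE eqxx.
    by rewrite !mxE; apply: eq_bigr => k _; rewrite [setrow _ _ _ _ _]mxE eqxx.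
  have -> : (fun z => setrow a (beta z) (B z) b c) = (fun z => B z b c).
    by apply/funext => z; rewrite mxE (negbTE ba).
  apply: (is_derive_eq (B_deriv a b c Ux)).
  rewrite mxE [RHS]mxE; congr (_ + _); first by rewrite [RHS]mxE (negbTE ba).
  by rewrite !mxE; apply: eq_bigr => k _; rewrite [setrow _ _ _ _ _]mxE (negbTE ba).
rewrite big_split /= -big_distrl /= sum_det_setrow_deriv; last first.
  move=> a b; apply/rowP => c; rewrite !mxE cov_e_sym // cov_cov_L //.
  by rewrite cov_cov_Lb.
have -> : \sum_a \det (setrow a (u a) (B x)) = \tr (T x *m \adj (B x)).
  by rewrite mxtrace_mul_adj.
rewrite /T !mulmxDl !raddfD /= -!scalemxAl !mxtraceZ mxtrace_skew_newton //; first last.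
- exact: shape_comm.
- by apply/matrixP => b c; rewrite !mxE QC.
- exact: chib_sym.
- exact: chi_sym.
- exact: sigma_unit.
rewrite addr0 /divergence_density -/(invsqrt x) mulrDl -[RHS]addr0 -addrA; congr (_ + _).
rewrite big_distrl -big_split big1 //= => a _.
by rewrite /G mxtrace_tr; ring.
Qed.

End DivergenceIdentity.

(** * Lebesgue measure on R^m *)

Notation borel T := (g_sigma_algebraType (@open T)).

Section BorelFunctions.
Context {R : realType} {T : ptopologicalType}.

Lemma open_borel (A : set T) : open A -> measurable (A : set (borel T)).
Proof. by move=> Ao; apply: sub_sigma_algebra. Qed.

Lemma measurable_continuous_on (D : set T) (f : T -> R) : open D ->
  (forall x, D x -> {for x, continuous f}) ->
  measurable_fun (D : set (borel T)) (f : borel T -> measurableTypeR R).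
Proof.
move=> Do fc; apply: (measurability _ (RGenOInfty.measurableE R)).
move=> _ [_ [a ->] <-]; apply: open_borel.
rewrite openE => x [Dx fx]; rewrite /interior; apply: filterI.
  exact: open_nbhs_nbhs.
apply: (fc x Dx); apply: open_nbhs_nbhs; split => //; exact: rray_open.
Qed.

Lemma measurable_continuous_borel (T' : ptopologicalType) (D : set T) (f : T -> T') :
  open D -> (forall x, D x -> {for x, continuous f}) ->
  measurable_fun (D : set (borel T)) (f : borel T -> borel T').
Proof.
move=> Do fc; apply: (@measurability _ _ (borel T) (borel T') D f (@open T') erefl).
move=> _ [W Wo <-]; apply: open_borel.
rewrite openE => x [Dx fx]; rewrite /interior; apply: filterI.
  exact: open_nbhs_nbhs.
by apply: (fc x Dx); apply: open_nbhs_nbhs.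
Qed.

End BorelFunctions.

(** The products of two increasing exhaustions. *)
Lemma product_sigma_finite d d' (T : measurableType d) (T' : measurableType d')
    (R : realType) (m1 : {sigma_finite_measure set T -> \bar R})
    (m2 : {sigma_finite_measure set T' -> \bar R}) :
  sigma_finite setT (m1 \x m2)%E.
Proof.
have /sigma_finiteP[F [TF ndF Foo]] := sigma_finiteT m1.
have /sigma_finiteP[G [TG ndG Goo]] := sigma_finiteT m2.
exists (fun n => F n `*` G n).
  rewrite -setXTT TF TG; apply/seteqP; split => [[x y] [/= [n _ Fx] [k _ Gy]]|].
    exists (maxn n k) => //; split => /=.
      by move: x Fx; apply/subsetPset/ndF/leq_maxl.
    by move: y Gy; apply/subsetPset/ndG/leq_maxr.
  by move=> [x y] [n _ [/= Fx Gy]]; split; exists n.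
move=> k; have [mF Fk] := Foo k; have [mG Gk] := Goo k.
split; first exact: measurableX.
by rewrite product_measure1E// lte_mul_pinfty// ge0_fin_numE.
Qed.

Section LebesgueStep.
Context {R : realType} {m : nat}.
Local Notation Rm := (measurableTypeR R).

Definition cons_coord (p : Rm * borel 'rV[R]_m) : borel 'rV[R]_m.+1 :=
  row_mx (p.1%:M : 'rV[R]_1) p.2.

Definition split_coord (x : borel 'rV[R]_m.+1) : Rm * borel 'rV[R]_m :=
  (x 0 ord0, \row_i x 0 (lift ord0 i)).

Lemma cons_coord0 p : cons_coord p 0 ord0 = p.1.
Proof. exact: (time_part_static p.1 p.2). Qed.

Lemma cons_coordS p i : cons_coord p 0 (lift ord0 i) = p.2 0 i.
Proof.
have := congr1 (fun u : 'rV_m => u 0 i) (space_part_static p.1 p.2).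
by rewrite mxE.
Qed.

Lemma cons_coordK : cancel cons_coord split_coord.
Proof.
move=> [t v]; rewrite /split_coord cons_coord0; congr (_, _).
by apply/rowP => i; rewrite mxE cons_coordS.
Qed.

Lemma cons_coord_ball x (r : R) : cons_coord @^-1` (ball x r) =
  ball (x 0 ord0) r `*` ball (\row_i x 0 (lift ord0 i) : 'rV[R]_m) r.
Proof.
apply/seteqP; split => [[t v]|[t v]] /=.
  move=> [r0 xr]; split.
    by have := xr 0 ord0; rewrite cons_coord0.
  split => // i j; have := xr 0 (lift ord0 j).
  by rewrite cons_coordS (ord1 i) mxE.
move=> [tr [r0 vr]]; split => // i j; rewrite (ord1 i).
case: (unliftP ord0 j) => [k|] ->; last by rewrite cons_coord0.
by rewrite cons_coordS; have := vr 0 k; rewrite mxE.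
Qed.

(** An open set is a countable union of balls with rational centre, and each of
    these is a product. *)
Lemma measurable_cons_coord : measurable_fun setT cons_coord.
Proof.
apply: (@measurability _ _ _ (borel 'rV[R]_m.+1) setT cons_coord (@open 'rV[R]_m.+1) erefl).
move=> _ [W Wo <-]; rewrite setTI.
pose c (q : 'rV[rat]_m.+1) : 'rV[R]_m.+1 := map_mx ratr q.
pose I := [set p : 'rV[rat]_m.+1 * nat | ball (c p.1) p.2.+1%:R^-1 `<=` W].
have -> : W = \bigcup_(p in I) ball (c p.1) p.2.+1%:R^-1.
  apply/seteqP; split => [x Wx|x [p Ip]]; last exact: Ip.
  have /nbhs_ballP[e /= e0 eW] : nbhs x W by exact: open_nbhs_nbhs.
  have [k ke] : exists k : nat, 2 * k.+1%:R^-1 < e :> R.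
    have [k _ /(_ k (leqnn k)) kP] : \forall k \near \oo, k.+1%:R^-1 < e / 2 :> R.
      have e20 : 0 < e / 2 by rewrite divr_gt0.
      exact: (near_infty_natSinv_lt (PosNum e20)).
    by exists k; rewrite mulrC -ltr_pdivlMr.
  have d0 : 0 < k.+1%:R^-1 :> R by rewrite invr_gt0.
  have qP i : exists q : rat, ball (x 0 i) k.+1%:R^-1 (ratr q).
    have : x 0 i - k.+1%:R^-1 < x 0 i + k.+1%:R^-1.
      by rewrite ltrBlDr -addrA ltrDl addr_gt0.
    move=> /rat_in_itvoo[q]; rewrite in_itv /= => /andP[q1 q2]; exists q.
    by rewrite /ball /= ltr_distlC; apply/andP; split.
  pose q : 'rV[rat]_m.+1 := \row_i projT1 (cid (qP i)).
  have xq : ball x k.+1%:R^-1 (c q).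
    split => // i j; rewrite !mxE (ord1 i).
    exact: (projT2 (cid (qP j))).
  exists (q, k) => /=; last exact: ball_sym.
  move=> y qy; apply: eW; apply: le_ball (ltW ke) _ _.
  by rewrite mulr_natl mulr2n; exact: ball_triangle xq qy.
rewrite preimage_bigcup bigcup_mkcond.
apply: countable_bigcupT_measurable => [|p]; first exact: countableP.
case: ifP => // _; rewrite cons_coord_ball; apply: measurableX.
  exact: measurable_ball.
by apply: open_borel; exact: ball_open.
Qed.

Lemma measurable_split_coord : measurable_fun setT split_coord.
Proof.
apply: measurable_fun_pair.
  by apply: (measurable_continuous_on openT) => x _; exact: coord_continuous.
apply: (measurable_continuous_borel openT) => x _; apply: continuous_rV => i.
rewrite (_ : (fun _ => _) = (fun y : 'rV[R]_m.+1 => y 0 (lift ord0 i))).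
  exact: coord_continuous.
by apply/funext => y; rewrite mxE.
Qed.

Variable lam : {sigma_finite_measure set (borel 'rV[R]_m) -> \bar R}.

(** One more coordinate, in the order in which [lebesgue_int] integrates. *)
Definition leb_step : set (borel 'rV[R]_m.+1) -> \bar R :=
  pushforward (@lebesgue_measure R \x lam)%E cons_coord.

Let step0 : leb_step set0 = 0%E.
Proof. by rewrite /leb_step /pushforward preimage_set0 measure0. Qed.

Let step_ge0 A : (0 <= leb_step A)%E.
Proof. by rewrite /leb_step /pushforward measure_ge0. Qed.

Let step_additive : semi_sigma_additive leb_step.
Proof.
exact: (@measure_semi_sigma_additive _ _ _
 (measure_function_pushforward__canonical__measure_function_Measure
   (@lebesgue_measure R \x lam)%E measurable_cons_coord)).
Qed.

HB.instance Definition _ := isMeasure.Build _ _ _ leb_step step0 step_ge0 step_additive.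

Let step_sigma_finite : sigma_finite setT leb_step.
Proof.
have [F FT Ffin] := product_sigma_finite (@lebesgue_measure R) lam.
exists (fun k => split_coord @^-1` (F k)).
  by rewrite -preimage_bigcup -FT preimage_setT.
move=> k; have [mF Foo] := Ffin k; split.
  by rewrite -[X in measurable X]setTI; exact: measurable_split_coord.
rewrite /leb_step /pushforward -comp_preimage.
rewrite (_ : _ \o _ = id) ?preimage_id //.
by apply/funext => p; exact: cons_coordK.
Qed.

HB.instance Definition _ := Measure_isSigmaFinite.Build _ _ _ leb_step step_sigma_finite.

End LebesgueStep.

Fixpoint lebn {R : realType} (m : nat) :
    {sigma_finite_measure set (borel 'rV[R]_m) -> \bar R} :=
  match m with
  | 0%N => \d_ (0 : borel 'rV[R]_0)
  | m'.+1 => leb_step (lebn m')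
  end.

Lemma is_derive_affine {R : realType} (V W : normedModType R) (A : V -> W)
    (u : W -> R) x w w' du :
  (forall h : R, A (h *: w + x) = h *: w' + A x) ->
  is_derive (A x) w' u du -> is_derive x w (fun y => u (A y)) du.
Proof.
move=> hA.
have E : (fun h : R => h^-1 *: (((fun y => u (A y)) \o shift x) (h *: w) - u (A x)))
  = (fun h => h^-1 *: ((u \o shift (A x)) (h *: w') - u (A x))).
  by apply/funext => h /=; rewrite hA.
by move=> -[h1 h2]; apply: DeriveDef; move: h1 h2; rewrite /derivable /derive E.
Qed.

Lemma continuous_ext {R : realType} (T : topologicalType) (f g : T -> R) x :
  f =1 g -> {for x, continuous g} -> {for x, continuous f}.
Proof. by move=> /funext ->. Qed.

Section LebesgueIntegral.
Context {R : realType}.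
Local Notation leb := (@lebesgue_measure R).

Lemma measurable_cons_coord2 m (t : R) :
  measurable_fun setT (fun v : borel 'rV[R]_m => cons_coord (t, v)).
Proof. exact: (measurable_fun_pair2 t (@measurable_cons_coord R m)). Qed.

Lemma ge0_integral_leb_step m (f : borel 'rV[R]_m.+1 -> \bar R) :
  measurable_fun setT f -> (forall x, (0 <= f x)%E) ->
  (\int[lebn m.+1]_x f x = \int[leb \x lebn m]_p f (cons_coord p))%E.
Proof.
move=> mf f0.
have := @ge0_integral_pushforward _ _ _ _ R _ measurable_cons_coord
  (leb \x lebn m)%E setT f measurableT mf (fun x _ => f0 x).
by rewrite preimage_setT.
Qed.

(** Tonelli's theorem, one coordinate at a time. *)
Lemma lebesgue_intE m (f : 'rV[R]_m -> \bar R) :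
  measurable_fun setT (f : borel 'rV[R]_m -> \bar R) -> (forall x, (0 <= f x)%E) ->
  (lebesgue_int f = \int[lebn m]_x f x)%E.
Proof.
elim: m f => [|m ih] f mf f0.
  by rewrite /= integral_dirac // diracT mul1e.
rewrite ge0_integral_leb_step // fubini_tonelli1 //; last first.
  by apply: measurableT_comp => //; exact: measurable_cons_coord.
apply: eq_integral => t _; rewrite /fubini_F -ih //.
by apply: measurableT_comp => //; exact: measurable_cons_coord2.
Qed.

Lemma lebn_ball_fin m (x : 'rV[R]_m) (r : R) : (lebn m (ball x r) < +oo)%E.
Proof.
elim: m x => [|m ih] x.
  rewrite /= diracE; case: (_ \in _); exact: ltry.
rewrite /= /leb_step /pushforward cons_coord_ball product_measure1E.
- apply: lte_mul_pinfty => //.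
    rewrite ge0_fin_numE //.
    have [r0|r0] := ltP 0 r; last by rewrite (ball0 _ _).2 // measure0.
    by rewrite [X in (X < _)%E](lebesgue_measure_ball _ (ltW r0)) ltry.
- exact: measurable_ball.
- by apply: open_borel; exact: ball_open.
Qed.

(** The function is bounded and vanishes off a ball, which has finite measure. *)
Lemma continuous_bounded_support_integrable m (h : 'rV[R]_m -> R) (r : R) :
  continuous h -> (forall x, r <= `|x| -> h x = 0) ->
  (lebn m).-integrable setT (EFin \o (h : borel 'rV[R]_m -> R)).
Proof.
move=> hc hr; have r1 : r < `|r| + 1 by rewrite (le_lt_trans (ler_norm r)) // ltrDl.
pose K := [set x : 'rV[R]_m | `|x| <= `|r| + 1].
have Kc : compact K.
  apply: bounded_closed_compact.
    exists (`|r| + 1); split; first exact: num_real.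
    by move=> M rM x Kx; apply: ltW; exact: le_lt_trans Kx rM.
  apply: (@closed_comp _ _ (fun x : 'rV[R]_m => `|x|) [set t | t <= `|r| + 1]).
    by move=> x _; exact: norm_continuous.
  exact: closed_le.
have mh : measurable_fun setT (h : borel 'rV[R]_m -> R).
  by apply: (measurable_continuous_on openT) => x _; exact: hc.
have mB : measurable (ball (0 : 'rV[R]_m) (`|r| + 1) : set (borel _)).
  by apply: open_borel; exact: ball_open.
have -> : EFin \o (h : borel 'rV[R]_m -> R) = (EFin \o h) \_ (ball (0 : 'rV[R]_m) (`|r| + 1)).
  apply/funext => x; rewrite patchE; case: ifPn => // /negP xB /=.
  rewrite hr // leNgt; apply/negP => xr; apply: xB; rewrite inE.
  by rewrite mx_norm_ball /ball_ /= sub0r normrN (lt_trans xr).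
apply/(integrable_mkcond _ mB).1; apply: measurable_bounded_integrable => //.
- exact: lebn_ball_fin.
- exact: measurable_funTS.
have /compact_bounded[M [Mr hM]] := continuous_compact (continuous_subspaceT hc) Kc.
exists M; split => // N MN x xB; apply: (hM N MN); exists x => //.
by move: xB; rewrite mx_norm_ball /ball_ /= sub0r normrN => /ltW.
Qed.

(** Fubini's theorem isolates the coordinate [a], in which this is the
    fundamental theorem of calculus. *)
Lemma integral_derive_eq0 m (u : 'rV[R]_m -> R) (a : 'I_m) (r : R) :
  continuous u -> (forall x, derivable u x (basis_vec a)) ->
  continuous ('D_(basis_vec a) u) -> (forall x, r <= `|x| -> u x = 0) ->
  (\int[lebn m]_x ('D_(basis_vec a) u x)%:E = 0)%E.
Proof.
elim: m u a => [|m ih] u a uc ud Dc ur; first by case: a ud Dc => [].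
have Dr x : r + 1 <= `|x| -> 'D_(basis_vec a) u x = 0.
  move=> xr; rewrite (@near_eq_derive _ _ _ u (cst 0)) ?derive_cst //.
  have nc : {for x, continuous (fun y : 'rV[R]_m.+1 => `|y|)} by exact: norm_continuous.
  apply: filterS (continuous_near_dist nc ltr01) => y /ler_normlP[_ xy].
  by apply: ur; rewrite -(lerD2r 1) (le_trans xr) // -lerBlDl.
have Dint := continuous_bounded_support_integrable Dc Dr.
pose f (p : measurableTypeR R * borel 'rV[R]_m) : \bar R :=
  ('D_(basis_vec a) u (cons_coord p))%:E.
have mD : measurable_fun setT (EFin \o ('D_(basis_vec a) u : borel 'rV[R]_m.+1 -> R)).
  by case/integrableP: Dint.
have mf : measurable_fun setT f.
  by apply: (measurableT_comp mD); exact: measurable_cons_coord.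
have fint : (leb \x lebn m)%E.-integrable setT f.
  apply/integrableP; split => //; case/integrableP: Dint => _.
  by rewrite ge0_integral_leb_step //; exact: measurableT_comp.
have -> : (\int[lebn m.+1]_x ('D_(basis_vec a) u x)%:E = \int[leb \x lebn m]_p f p)%E.
  have := @integral_pushforward _ _ _ _ R _ measurable_cons_coord
    (leb \x lebn m)%E setT _ mD.
  by rewrite preimage_setT; apply.
have le_cons1 (t : R) (v : 'rV[R]_m) : `|t| <= `|cons_coord (t, v) : 'rV[R]_m.+1|.
  by have := coord_le_norm (cons_coord (t, v) : 'rV[R]_m.+1) ord0; rewrite cons_coord0.
have le_cons2 (t : R) (v : 'rV[R]_m) : `|v| <= `|cons_coord (t, v) : 'rV[R]_m.+1|.
  apply: norm_le_coord => // i.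
  have := coord_le_norm (cons_coord (t, v) : 'rV[R]_m.+1) (lift ord0 i).
  by rewrite cons_coordS.
have cons_cont1 v : continuous (fun t : R => cons_coord (t, v) : 'rV[R]_m.+1).
  move=> t; apply: continuous_rV => i; case: (unliftP ord0 i) => [j|] ->.
    apply: (@continuous_ext _ _ _ (fun=> v 0 j)); last exact: cst_continuous.
    by move=> y; rewrite cons_coordS.
  apply: (@continuous_ext _ _ _ id); last by move=> ?; exact.
  by move=> y; rewrite cons_coord0.
have cons_cont2 t : continuous (fun v : 'rV[R]_m => cons_coord (t, v) : 'rV[R]_m.+1).
  move=> v; apply: continuous_rV => i; case: (unliftP ord0 i) => [j|] ->.
    apply: (@continuous_ext _ _ _ (fun v' : 'rV[R]_m => v' 0 j)); last exact: coord_continuous.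
    by move=> y; rewrite cons_coordS.
  apply: (@continuous_ext _ _ _ (fun=> t)); last exact: cst_continuous.
  by move=> y; rewrite cons_coord0.
case: (unliftP ord0 a) => [b|] aE.
  rewrite -(integral12_prod_meas1 fint) integral0_eq // => t _.
  rewrite /fubini_F.
  have DE v : is_derive v (basis_vec b) (fun v' : 'rV[R]_m => u (cons_coord (t, v')))
      ('D_(basis_vec a) u (cons_coord (t, v))).
    apply: (@is_derive_affine _ _ _ (fun v' => cons_coord (t, v'))); last exact: derivableP.
    move=> h; rewrite aE; apply/rowP => i; case: (unliftP ord0 i) => [j|] ->.
      rewrite cons_coordS [LHS]mxE [RHS]mxE cons_coordS; congr (_ + _).
      by rewrite !mxE (inj_eq lift_inj).
    by rewrite cons_coord0 [RHS]mxE cons_coord0 !mxE /= mulr0 add0r.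
  have DE' : 'D_(basis_vec b) (fun v' : 'rV[R]_m => u (cons_coord (t, v')))
      = (fun v => 'D_(basis_vec a) u (cons_coord (t, v))).
    by apply/funext => v; case: (DE v).
  rewrite -[RHS](ih (fun v => u (cons_coord (t, v))) b).
  - by apply: eq_integral => v _; rewrite /f; case: (DE v) => _ ->.
  - by move=> v; apply: continuous_comp; [exact: cons_cont2|exact: uc].
  - by move=> v; case: (DE v).
  - rewrite DE' => v; apply: (@continuous_comp _ _ _ (fun v => cons_coord (t, v) : 'rV[R]_m.+1) ('D_(basis_vec a) u)).
      exact: cons_cont2.
    exact: Dc.
  - by move=> v rv; apply: ur; exact: (le_trans rv (le_cons2 t v)).
rewrite -(integral21_prod_meas1 fint) integral0_eq // => v _.
rewrite /fubini_G; pose U t := u (cons_coord (t, v)).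
have DE t : is_derive (t : R) (1 : R) U ('D_(basis_vec a) u (cons_coord (t, v))).
  apply: (@is_derive_affine _ _ _ (fun t' : R => cons_coord (t', v))); last exact: derivableP.
  move=> h; rewrite aE; apply/rowP => i; case: (unliftP ord0 i) => [j|] ->.
    by rewrite cons_coordS [RHS]mxE cons_coordS !mxE /= mulr0 add0r.
  by rewrite cons_coord0 [RHS]mxE cons_coord0 !mxE /= mulr1 [_%:A]mulr1.
pose s := `|r| + 2; have s0 : - s < s by rewrite /s; have := normr_ge0 r; lra.
have rs : r < s by rewrite /s; have := ler_norm r; lra.
have Us t : s - 1 <= `|t| -> f (t, v) = 0%E.
  move=> st; rewrite /f Dr //; apply: le_trans (le_cons1 t v).
  by apply: le_trans st; rewrite /s; have := ler_norm r; lra.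
have -> : (\int[leb]_t f (t, v) = \int[leb]_(t in `[(- s)%R, s]) f (t, v))%E.
  rewrite [RHS]integral_mkcond; apply: eq_integral => t _; rewrite patchE.
  case: ifPn => // /negP tI; rewrite Us // leNgt; apply/negP => ts; apply: tI.
  have : `|t| <= s by lra.
  by rewrite inE /= in_itv /= ler_norml.
have contf t : {for t, continuous (fun t : R => 'D_(basis_vec a) u (cons_coord (t, v)))}.
  apply: (@continuous_comp _ _ _ (fun t : R => cons_coord (t, v) : 'rV[R]_m.+1) ('D_(basis_vec a) u)); [exact: cons_cont1|exact: Dc].
have contU t : {for t, continuous U}.
  by apply/differentiable_continuous/derivable1_diffP; case: (DE t).
rewrite (@continuous_FTC2 R _ U (- s) s s0).
- have UU t : r <= `|t| -> U t = 0.
    by move=> rt; apply: ur; exact: (le_trans rt (le_cons1 t v)).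
  rewrite !UU ?subee // ?normrN; apply: ltW; apply: (lt_le_trans rs); exact: ler_norm.
- by apply: continuous_subspaceT => t; exact: contf.
- split.
  + by move=> t _; case: (DE t).
  + by apply: cvg_at_right_filter; exact: contU.
  + by apply: cvg_at_left_filter; exact: contU.
- by move=> t _; rewrite derive1E; case: (DE t).
Qed.

End LebesgueIntegral.

(** * Charts *)

Section Charts.
Context {R : realType} {m : nat} {T : ptopologicalType}.
Variable S : manifold R m T.
Local Notation d a := (basis_vec a : 'rV[R]_m).
Local Notation U p := (chart_image S p).

Lemma param_dom p x : U p x -> dom S p (param S p x).
Proof. by move=> [q qp <-]; rewrite chartK. Qed.

Lemma paramK p x : U p x -> chart S p (param S p x) = x.
Proof. by move=> [q qp <-]; rewrite chartK. Qed.

Lemma chart_image_chart p q : dom S p q -> U p (chart S p q).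
Proof. by move=> qp; exists q. Qed.

Lemma chart_imageE p (A : set T) : A `<=` dom S p ->
  chart S p @` A = U p `&` param S p @^-1` A.
Proof.
move=> Ap; apply/seteqP; split => [x [q Aq <-]|x [Ux Ax]].
  have qp := Ap _ Aq; split; first exact: chart_image_chart.
  by rewrite /= chartK.
by exists (param S p x) => //; exact: paramK.
Qed.

Lemma U_open p : open (U p).
Proof. exact: chart_image_open. Qed.

Lemma near_chart p x : U p x -> \forall y \near x, U p y.
Proof. by move=> Ux; apply: open_nbhs_nbhs; split => //; exact: U_open. Qed.

Lemma open_param_preimage p (A : set T) : open A -> open (U p `&` param S p @^-1` A).
Proof.
move=> Ao; rewrite openE => x [Ux Ax]; rewrite /interior; apply: filterI.
  by apply: open_nbhs_nbhs; split => //; exact: U_open.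
by apply: (param_continuous Ux); apply: open_nbhs_nbhs.
Qed.

Lemma open_overlap p q : open (chart S p @` (dom S p `&` dom S q)).
Proof.
rewrite chart_imageE; last by move=> t [].
rewrite (_ : _ `&` _ = U p `&` param S p @^-1` (dom S q)).
  exact/open_param_preimage/dom_open.
apply/seteqP; split => x /= [Ux]; first by case.
by move=> xq; split => //; split => //; exact: param_dom.
Qed.

Lemma overlapP p q x : U p x -> dom S q (param S p x) ->
  (chart S p @` (dom S p `&` dom S q)) x.
Proof.
move=> Ux xq; exists (param S p x); last exact: paramK.
by split => //; exact: param_dom.
Qed.

Definition transition p q x : 'rV[R]_m := chart S q (param S p x).

Lemma transition_C1 p q b :
  C1on (chart S p @` (dom S p `&` dom S q)) (fun x => transition p q x 0 b).
Proof. exact: (smooth_C1on [::] (transition_smooth b)). Qed.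

Lemma transition_image p q x : (chart S p @` (dom S p `&` dom S q)) x ->
  U q (transition p q x).
Proof.
by move=> [t [tp tq] <-]; rewrite /transition chartK //; exact: chart_image_chart.
Qed.

Lemma near_transition p q x (f : T -> R) : U p x -> dom S q (param S p x) ->
  \near x, f (param S q (transition p q x)) = f (param S p x).
Proof.
move=> Ux xq; have : \near x, (chart S p @` (dom S p `&` dom S q)) x.
  by apply: open_nbhs_nbhs; split; [exact: open_overlap|exact: overlapP].
by apply: filterS => _ [t [tp tq] <-]; rewrite /transition !chartK.
Qed.

Lemma chain_rule_chart p q x v (f : T -> R) :
  C1on (U q) (f \o param S q) -> U p x -> dom S q (param S p x) ->
  is_derive x v (f \o param S p)
    (\sum_b 'D_v (fun y => transition p q y 0 b) x *
       'D_(d b) (f \o param S q) (transition p q x)).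
Proof.
move=> fC Ux xq; have xo := overlapP Ux xq.
apply: (near_eq_is_derive (near_transition f Ux xq)).
apply: (is_derive_comp (U_open (p := q)) fC (transition_image xo)) => b.
by apply: derivableP; case: (derive_C1on v (@open_overlap p q) (@transition_C1 p q b) xo).
Qed.

Definition C1fun (f : T -> R) := forall p, C1on (U p) (f \o param S p).

Lemma C1fun_local (f : T -> R) : (forall p x, U p x -> exists A : set 'rV[R]_m,
  A x /\ C1on A (f \o param S p)) -> C1fun f.
Proof. by move=> h p x Ux; have [A [Ax]] := h p x Ux; apply. Qed.

Lemma continuous_charts (f : T -> R) :
  (forall p x, U p x -> {for x, continuous (f \o param S p)}) -> continuous f.
Proof.
move=> fc t; have tt := dom_center S t.
apply: (@continuous_near_eq _ _ _ (fun q => (f \o param S t) (chart S t q))).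
  have : \forall q \near t, dom S t q by apply: open_nbhs_nbhs; split => //; exact: dom_open.
  by apply: filterS => q qt /=; rewrite chartK.
apply: (@continuous_comp _ _ _ (chart S t) (f \o param S t)).
  exact: chart_continuous.
by apply: fc; exact: chart_image_chart.
Qed.

(** Off the image of the chart, [param] is arbitrary; the functions to be
    integrated over R^m are cut off there. *)
Definition extend p (f : 'rV[R]_m -> R) x : R := if `[< U p x >] then f x else 0.

Lemma extendE p f x : U p x -> extend p f x = f x.
Proof. by move=> Ux; rewrite /extend asboolT. Qed.

Lemma extend_off p f (B : set 'rV[R]_m) x : (forall y, U p y -> ~ B y -> f y = 0) ->
  B `<=` U p -> ~ B x -> extend p f x = 0.
Proof. by move=> f0 BU xB; rewrite /extend; case: asboolP => // Ux; exact: f0. Qed.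

Lemma extend_continuous p f (B : set 'rV[R]_m) : closed B -> B `<=` U p ->
  (forall y, U p y -> ~ B y -> f y = 0) ->
  (forall y, U p y -> {for y, continuous f}) -> continuous (extend p f).
Proof.
move=> Bc BU f0 fc x; have [Ux|Ux] := pselect (U p x).
  apply: (@continuous_near_eq _ _ _ f); last exact: fc.
  have : \near x, U p x by apply: open_nbhs_nbhs; split => //; exact: U_open.
  by apply: filterS => y; exact: extendE.
apply: (@continuous_near_eq _ _ _ (fun=> 0)); last exact: cst_continuous.
have : \near x, ~ B x.
  apply: open_nbhs_nbhs; split; first exact: closed_openC.
  by move=> /BU.
by apply: filterS => y; exact: extend_off.
Qed.

Lemma extend_C1 p f (B : set 'rV[R]_m) : closed B -> B `<=` U p ->
  (forall y, U p y -> ~ B y -> f y = 0) -> C1on (U p) f -> C1on setT (extend p f).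
Proof.
move=> Bc BU f0 fC x _; have [Ux|Ux] := pselect (U p x).
  by apply: (@C1on_eq _ _ (U p) _ f) => //; [exact: U_open|exact: extendE].
apply: (@C1on_eq _ _ (~` B) _ (fun=> 0)) => //; last by move=> /BU.
- exact: closed_openC.
- by move=> y; exact: extend_off.
- by apply: C1on_cst; exact: closed_openC.
Qed.

End Charts.

(** * Bump functions and partitions of unity *)

Section Bump.
Context {R : realType} {m : nat}.

(** The function [t ^+ 2 + t * `|t|], which vanishes for negative [t], is
    of class C^1; the divergence theorem asks for no more. *)
Definition ramp (t : R) : R := t ^+ 2 + t * `|t|.

Lemma ramp_le0 t : t <= 0 -> ramp t = 0.
Proof. by move=> t0; rewrite /ramp ler0_norm //; ring. Qed.

Lemma ramp_gt0 t : 0 < t -> 0 < ramp t.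
Proof. by move=> t0; rewrite /ramp gtr0_norm // -expr2 addr_gt0 // exprn_gt0. Qed.

Lemma ramp_ge0 t : 0 <= ramp t.
Proof. by have [/ramp_le0 ->|/ramp_gt0/ltW] := leP t 0. Qed.

Lemma is_derive_ramp (t : R) : is_derive t (1 : R) ramp (2 * t + 2 * `|t|).
Proof.
have h1 : is_derive t (1 : R) (fun t : R => t ^+ 2) (2 * t).
  apply: (is_derive_eq (is_deriveX 2 (is_derive_id t (1 : R)))).
  by rewrite expr1 [_ *: _]mulr1.
apply: is_derive_D => //; have [t0|t0|->] := ltgtP t 0.
- apply: (@near_eq_is_derive _ _ _ (fun s : R => - s ^+ 2 : R)).
    have : \forall s \near t, s < 0 by exact: lt_nbhsl.
    by apply: filterS => s s0; rewrite ler0_norm ?ltW // mulrN expr2.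
  by apply: (is_derive_eq (is_derive_N h1)); rewrite ltr0_norm //; ring.
- apply: (@near_eq_is_derive _ _ _ (fun s : R => s ^+ 2 : R)).
    have : \forall s \near t, 0 < s by exact: lt_nbhsr.
    by apply: filterS => s s0; rewrite ger0_norm ?ltW // expr2.
  by apply: (is_derive_eq h1); rewrite gtr0_norm.
- have nc : {for (0 : R), continuous (fun s : R => `|s|)} by exact: norm_continuous.
  apply: (is_derive_eq (@is_derive_M0 _ id _ 1 erefl (is_derive_id (0 : R) (1 : R)) nc)).
  by rewrite normr0 !mulr0.
Qed.

Lemma C1on_coord i : C1on [set: 'rV[R]_m] (fun x => x 0 i).
Proof.
apply: (@C1on_intro _ _ _ _ (fun a _ => (basis_vec a : 'rV[R]_m) 0 i)) => //.
- exact: openT.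
- by move=> x _; exact: coord_continuous.
- by move=> x a _; exact: is_derive_coord.
- by move=> x a _; exact: cst_continuous.
Qed.

Definition sqdist (x0 x : 'rV[R]_m) : R := \sum_i (x 0 i - x0 0 i) ^+ 2.

Definition bump x0 e x : R := ramp (e ^+ 2 - sqdist x0 x).

Lemma bump_C1 x0 e : C1on setT (bump x0 e).
Proof.
have To := @openT 'rV[R]_m.
apply: (@C1on_comp1 _ _ setT _ ramp (fun t => 2 * t + 2 * `|t|)) => //.
- apply: (C1onD To); first exact: C1on_cst.
  apply: (C1onN To); apply: (@C1on_sum _ _ setT _ _ xpredT
    (fun i x => (x 0 i - x0 0 i) ^+ 2) To) => i _.
  rewrite (_ : (fun x => _) = (fun x : 'rV[R]_m => (x 0 i + - x0 0 i) * (x 0 i + - x0 0 i))).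
    by apply: (C1onM To); apply: (C1onD To); try exact: C1on_coord; exact: C1on_cst.
  by apply/funext => x; rewrite expr2.
- by move=> x _; exact: is_derive_ramp.
- move=> x _; apply: continuousD; apply: continuousM; try exact: cst_continuous.
    by move=> ?.
  exact: norm_continuous.
Qed.

Lemma bump_center x0 e : 0 < e -> 0 < bump x0 e x0.
Proof.
move=> e0; apply: ramp_gt0; rewrite /sqdist big1 ?subr0 ?exprn_gt0 // => i _.
by rewrite subrr expr0n.
Qed.

Lemma bump_support x0 e x : 0 <= e -> bump x0 e x != 0 -> `|x0 - x| <= e.
Proof.
move=> e0 bx; have h : sqdist x0 x < e ^+ 2.
  by rewrite ltNge -subr_le0; apply/negP => /ramp_le0 E; rewrite /bump E eqxx in bx.
apply: norm_le_coord => // i; rewrite !mxE distrC -(ler_pXn2r (ltn0Sn 1)) ?nnegrE //.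
rewrite real_normK ?num_real // (le_trans _ (ltW h)) // /sqdist (bigD1 i) //=.
by rewrite lerDl sumr_ge0 // => j _; exact: sqr_ge0.
Qed.

End Bump.

Section PartitionOfUnity.
Context {R : realType} {m : nat} {T : ptopologicalType}.
Variable S : manifold R m T.
Hypotheses (T_hausdorff : hausdorff_space T) (T_compact : compact [set: T]).
Local Notation U p := (chart_image S p).

(** [B] is a compact set of the chart that contains the support. *)
Record chart_supported p (f : T -> R) (B : set 'rV[R]_m) : Prop := ChartSupported {
  support_C1 : C1fun S f;
  support_closed : closed B;
  support_bounded : exists r : R, forall x, B x -> `|x| < r;
  support_sub : B `<=` U p;
  support_off : forall t, f t != 0 -> dom S p t /\ B (chart S p t);
  support_near : forall t, ~ dom S p t -> \forall q \near t, f q = 0 }.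

(** A closed ball of the chart has a compact, hence closed, image in [T]; the
    function vanishes on its complement, a neighbourhood of every point off the
    chart. *)
Lemma bump_exists p : exists f B,
  [/\ chart_supported p f B, forall t, 0 <= f t & 0 < f p].
Proof.
have pp := dom_center S p; pose x0 := chart S p p.
have Ux0 : U p x0 by exact: chart_image_chart.
have /nbhs_ballP[r /= r0 rU] : nbhs x0 (U p).
  by apply: open_nbhs_nbhs; split => //; exact: U_open.
pose e := r / 2; have e0 : 0 < e by rewrite divr_gt0.
pose B := [set x : 'rV[R]_m | `|x0 - x| <= e].
have BU : B `<=` U p.
  move=> x xB; apply: rU; rewrite mx_norm_ball /ball_ /=.
  by rewrite (le_lt_trans xB) // /e ltr_pdivrMr // ltr_pMr // ltr1n.
have Bc : closed B.
  apply: (@closed_comp _ _ (fun x : 'rV[R]_m => `|x0 - x|) [set t | t <= e]).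
    move=> x _; apply: continuous_comp; last exact: norm_continuous.
    by apply: continuousB; [exact: cst_continuous|move=> ?].
  exact: closed_le.
have Bb x : B x -> `|x| < `|x0| + e + 1.
  move=> xB; rewrite -[x](subrK x0) (le_lt_trans (ler_normD _ _)) // distrC addrC.
  by rewrite -addrA ltrD2l (le_lt_trans xB) // ltrDl.
have Bk : compact B.
  apply: bounded_closed_compact => //; exists (`|x0| + e + 1); split.
    exact: num_real.
  by move=> M rM x /Bb xr; apply: ltW; exact: lt_trans xr rM.
pose K := param S p @` B.
have Kk : compact K.
  apply: continuous_compact => //; apply: continuous_in_subspaceT => x /set_mem /BU Ux.
  exact: param_continuous.
have Ko : open (~` K) by apply: closed_openC; exact: compact_closed.
have Kp t : K t -> dom S p t by move=> [x /BU Ux <-]; exact: param_dom.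
pose f t : R := if `[< dom S p t >] then bump x0 e (chart S p t) else 0.
have fB t : f t != 0 -> dom S p t /\ B (chart S p t).
  rewrite /f; case: asboolP => [tp|_]; last by rewrite eqxx.
  by move=> /(bump_support (ltW e0)).
have f0 t : ~ K t -> f t = 0.
  move=> tK; apply: contra_notP tK => /eqP/fB[tp tB].
  by exists (chart S p t) => //; exact: chartK.
exists f, B; split; last by rewrite /f asboolT //; exact: bump_center.
- split => //; last first.
    move=> t tp; have tK : ~ K t by move=> /Kp.
    have : \forall q \near t, (~` K) q by exact: open_nbhs_nbhs.
    by apply: filterS => q; exact: f0.
  by exists (`|x0| + e + 1).
  apply: C1fun_local => q x Ux; have [xp|xp] := pselect (dom S p (param S q x)).
    exists (chart S q @` (dom S q `&` dom S p)); split; first exact: overlapP.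
    apply: (@C1on_eq _ _ _ _ (fun y => bump x0 e (transition S q p y))).
    - exact: open_overlap.
    - by move=> _ [t [tq tp] <-]; rewrite /f /transition /= chartK // asboolT.
    - apply: (@C1on_comp _ _ _ _ setT).
      + exact: open_overlap.
      + exact: openT.
      + exact: bump_C1.
      + by move=> b; exact: transition_C1.
      + by [].
  have Ao := @open_param_preimage _ _ _ S q _ Ko.
  exists (chart_image S q `&` param S q @^-1` (~` K)); split.
    by split => //= /Kp.
  apply: (@C1on_eq _ _ _ _ (fun=> 0)) => //; last exact: C1on_cst.
  by move=> y [_ yK] /=; exact: f0.
- by move=> t; rewrite /f; case: ifP => // _; exact: ramp_ge0.
Qed.

(** Dividing the bump functions of a finite cover by their sum. *)
Lemma partition_of_unity : exists (s : seq T) (phi : T -> T -> R) (B : T -> set 'rV[R]_m),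
  (forall p, chart_supported p (phi p) (B p)) /\
  forall t, \sum_(p <- s) phi p t = 1.
Proof.
have [fB] := boolp.choice bump_exists; move=> /boolp.choice[B hB].
pose f p := fB p.
have fC p : continuous (f p).
  have [[/(_ _) fC _ _ _ _ _] _ _] := hB p.
  by apply: continuous_charts => q x Ux; case: (fC q x Ux).
pose V p := [set t | 0 < f p t].
have Vo p : open (V p).
  by apply: (@open_comp _ _ (f p) [set r : R | 0 < r]) => [t _|]; [exact: fC|exact: open_gt].
have /(_ _ setT V (fun p _ => Vo p)) : cover_compact [set: T] by rewrite -compact_cover.
move=> [t _|D _ DV]; first by exists t => //; case: (hB t).
pose psi t := \sum_(p <- finmap.enum_fset D) f p t.
have psi0 t : 0 < psi t.
  have [p pD Vt] := DV t Logic.I.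
  rewrite /psi (big_rem p) //= ltr_wpDr //.
  by apply: sumr_ge0 => q _; have [_ + _] := hB q; apply.
exists (finmap.enum_fset D), (fun p t => (f p t / psi t : R)), B; split; last first.
  by move=> t; rewrite -mulr_suml divff // gt_eqF //; exact: psi0.
move=> p; have [[fC1 Bc Bb BU foff fn] _ _] := hB p; split => //.
- move=> q; have Uo := @U_open _ _ _ S q.
  apply: (C1onM Uo); first exact: fC1.
  apply: (@C1onV _ _ _ (psi \o param S q) Uo) => [|x _]; last first.
    by rewrite gt_eqF //=.
  apply: (@C1on_sum _ _ _ T (finmap.enum_fset D) xpredT (fun r => f r \o param S q) Uo) => r _; by case: (hB r) => -[+ _ _ _ _ _] _ _; apply.
- move=> t; rewrite mulf_eq0 negb_or => /andP[+ _]; exact: foff.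
- move=> t /fn; apply: filterS => q fq; by rewrite (_ : f p q = 0) // mul0r.
Qed.

End PartitionOfUnity.

(** * Integration in a chart *)

Section Density.
Local Open Scope ereal_scope.
Context d1 d2 (X : measurableType d1) (Y : measurableType d2) (R : realType).
Variables (mu : {measure set X -> \bar R}) (lam : {measure set Y -> \bar R}).
Variables (D : set X) (E : set Y) (phi : Y -> X) (w : Y -> R).
Hypotheses (mD : measurable D) (mE : measurable E) (ED : phi @` E `<=` D).
Hypotheses (mphi : measurable_fun E phi) (mw : measurable_fun E w).
Hypothesis w_ge0 : forall x, (0 <= w x)%R.
Hypothesis mu_density : forall A, measurable A -> A `<=` D ->
  mu A = \int[lam]_(x in E) (\1_A (phi x) * w x)%:E.

Import HBNNSimple.

Let mcomp (f : X -> R) : measurable_fun D f -> measurable_fun E (f \o phi).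
Proof. by move=> mf; exact: (measurable_comp mD ED mf mphi). Qed.

Let sfun_density (f : {nnsfun X >-> R}) :
  \int[mu]_(x in D) (f x)%:E = \int[lam]_(x in E) (f (phi x) * w x)%:E.
Proof.
transitivity (\sum_(k \in range f)
    \int[lam]_(x in E) (k * (\1_(f @^-1` [set k]) (phi x) * w x))%:E).
  under eq_integral do rewrite fimfunE -fsumEFin//.
  rewrite ge0_integral_fsum//; last 2 first.
  - by move=> y; exact/measurable_EFinP/measurable_funM.
  - by move=> y x _; rewrite nnfun_muleindic_ge0.
  apply: eq_fsbigr => r _; rewrite integralZl_indic_nnsfun// integral_indic//=.
  have [r0|r0] := ltP r 0%R.
    rewrite preimage_nnfun0// set0I measure0 mule0; apply/esym.
    by apply: integral0_eq => x _; rewrite indicE in_set0 mul0r mulr0.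
  rewrite mu_density; last 2 first.
  - exact: measurableI.
  - exact: subIsetr.
  rewrite -ge0_integralZl//; last 2 first.
  - apply/measurable_EFinP/measurable_funM => //; apply: mcomp.
    by apply: measurable_indic; exact: measurableI.
  - by move=> x _; rewrite lee_fin mulr_ge0.
  apply: eq_integral => x /set_mem xE; rewrite -EFinM; congr (r * (_ * w x))%:E.
  by rewrite !indicE in_setI (mem_set (ED (imageP phi xE))) andbT.
rewrite -ge0_integral_fsum//.
- apply: eq_integral => x _; rewrite fsumEFin// (fimfunE f (phi x)); congr EFin.
  rewrite [RHS]mulrC mulr_fsumr//; apply: eq_fsbigr => r _.
  by rewrite mulrA mulrC.
- move=> r; apply/measurable_EFinP/measurable_funM => //; apply: measurable_funM => //.
  exact: mcomp.
- move=> r x _; rewrite mulrA EFinM mule_ge0 ?lee_fin //.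
  exact: nnfun_muleindic_ge0.
Qed.

(** By definition for indicators, by linearity for simple functions, and by
    monotone convergence in general. *)
Lemma ge0_integral_density (h : X -> \bar R) : measurable_fun D h ->
  (forall t, D t -> 0 <= h t) ->
  \int[mu]_(t in D) h t = \int[lam]_(x in E) (h (phi x) * (w x)%:E).
Proof.
move=> mh h0; pose f_ := nnsfun_approx mD mh.
transitivity (limn (fun n => \int[mu]_(x in D) (f_ n x)%:E)).
  rewrite -monotone_convergence//.
  - apply: eq_integral => y /set_mem yD; apply/esym/cvg_lim => //.
    exact: cvg_nnsfun_approx.
  - by move=> n; exact/measurable_EFinP/measurable_funP.
  - by move=> n y _; rewrite lee_fin.
  - by move=> y _ m n mn; rewrite lee_fin; exact/lefP/nd_nnsfun_approx.
under eq_fun do rewrite sfun_density.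
rewrite -monotone_convergence//; last 3 first.
- move=> n; apply/measurable_EFinP/measurable_funM => //.
  by apply: mcomp; exact: measurable_funP.
- by move=> n x _; rewrite lee_fin mulr_ge0.
- move=> x _ m n mn; rewrite lee_fin ler_wpM2r //.
  exact/lefP/nd_nnsfun_approx.
apply: eq_integral => x /set_mem xE; apply/cvg_lim => //.
under eq_fun do rewrite EFinM.
apply: cvgeZr => //; apply: cvg_nnsfun_approx => //.
exact: (ED (imageP phi xE)).
Qed.

End Density.

Section ChartIntegral.
Context {R : realType} {m : nat} {T : ptopologicalType}.
Variables (S : manifold R m T) (mu : {measure set (borel T) -> \bar R}).
Variable w : T -> 'rV[R]_m -> R.
Local Notation U p := (chart_image S p).
Hypothesis w_ge0 : forall p x, 0 <= w p x.
Hypothesis w_continuous : forall p x, U p x -> {for x, continuous (w p)}.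
Hypothesis mu_w : forall p (A : set (borel T)), measurable A -> A `<=` dom S p ->
  mu A = lebesgue_int (fun x => (\1_(chart S p @` A) x * w p x)%:E).

Let mdom p : measurable (dom S p : set (borel T)).
Proof. apply: open_borel; exact: dom_open. Qed.

Let mU p : measurable (U p : set (borel 'rV[R]_m)).
Proof. apply: open_borel; exact: (U_open (p := p)). Qed.

Let par p : borel 'rV[R]_m -> borel T := param S p.

Let mparam p : measurable_fun (U p : set (borel 'rV[R]_m)) (par p).
Proof. by apply: measurable_continuous_borel (@U_open _ _ _ S p) _ => x; exact: param_continuous. Qed.

Let mw p : measurable_fun (U p : set (borel 'rV[R]_m)) (w p : borel _ -> measurableTypeR R).
Proof. exact: measurable_continuous_on (@U_open _ _ _ S p) (@w_continuous p). Qed.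

Let param_sub p : par p @` (U p : set (borel 'rV[R]_m)) `<=` (dom S p : set (borel T)).
Proof. by move=> _ [x Ux <-]; exact: param_dom. Qed.

Lemma chart_density p (A : set (borel T)) : measurable A -> A `<=` dom S p ->
  (mu A = \int[lebn m]_(x in U p) (\1_A (param S p x) * w p x)%:E)%E.
Proof.
move=> mA Ap; rewrite (mu_w mA Ap) integral_mkcond.
have E : (fun x => (\1_(chart S p @` A) x * w p x)%:E) =
    ((fun x => (\1_A (param S p x) * w p x)%:E) \_ (U p)).
  apply/funext => x; rewrite patchE chart_imageE // !indicE in_setI.
  by case: ifP => _ /=; rewrite ?mul0r.
rewrite E; apply: lebesgue_intE; last first.
  by move=> x; rewrite patchE; case: ifP => _ //; rewrite lee_fin mulr_ge0.
apply/(measurable_restrictT _ (mU p)).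
apply/measurable_EFinP/measurable_funM; last exact: mw.
exact: (measurable_comp (mdom p) (@param_sub p) (measurable_indic mA) (mparam (p := p))).
Qed.

Section Supported.
Variables (p : T) (g : T -> R).
Hypotheses (g_continuous : continuous g) (g_off : forall t, g t != 0 -> dom S p t).

Let ge0_integral_supported (k : R -> R) : continuous k -> (forall s, 0 <= k s) ->
  k 0 = 0 ->
  (\int[mu]_t (k (g t))%:E =
   \int[lebn m]_x (extend S p (fun x => k (g (param S p x)) * w p x) x)%:E)%E.
Proof.
move=> kc k_ge0 k0.
have kgc : continuous (k \o g) by move=> t; apply: continuous_comp; [exact: g_continuous|exact: kc].
have mkg : measurable_fun setT ((k \o g) : borel T -> measurableTypeR R).
  by apply: (measurable_continuous_on openT) => t _; exact: kgc.
transitivity (\int[mu]_(t in dom S p) (k (g t))%:E)%E.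
  rewrite [RHS]integral_mkcond; apply: eq_integral => t _; rewrite patchE.
  case: ifPn => // /negP tp; have /eqP -> : g t == 0; last by rewrite k0.
  by apply: contra_notT tp => /g_off /mem_set.
rewrite (ge0_integral_density (mdom p) (mU p) (@param_sub p) (mparam (p := p)) (mw (p := p))
  (@w_ge0 p) (@chart_density p)); last 2 first.
- by apply/measurable_EFinP; exact: measurable_funTS.
- by move=> t _; rewrite lee_fin.
rewrite integral_mkcond; apply: eq_integral => x _; rewrite patchE /extend.
by case: asboolP => Ux; [rewrite mem_set|rewrite memNset].
Qed.

Local Notation G := (extend S p (fun x => g (param S p x) * w p x)).
Hypothesis G_integrable : (lebn m).-integrable setT (EFin \o (G : borel _ -> R)).

Lemma integrable_supported : mu.-integrable setT (EFin \o (g : borel T -> R)).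
Proof.
apply/integrableP; split.
  apply/measurable_EFinP; apply: (measurable_continuous_on openT) => t _.
  exact: g_continuous.
case/integrableP: G_integrable => _; congr (_ < _)%E.
rewrite (ge0_integral_supported (k := fun s => `|s|)) ?normr0 //; last first.
  exact: norm_continuous.
apply: eq_integral => x _ /=; rewrite /extend; case: ifP => _; last by rewrite normr0.
by rewrite normrM (ger0_norm (w_ge0 _ _)).
Qed.

(** The positive and the negative part are integrated separately. *)
Lemma integral_supported : (\int[mu]_t (g t)%:E = \int[lebn m]_x (G x)%:E)%E.
Proof.
have mc (h : R -> R) : continuous h -> continuous (fun s : R => Num.max (h s) 0).
  by move=> hc s; apply: continuous_max; [exact: hc|exact: cst_continuous].
have m0 (s : R) : 0 <= Num.max s 0 by rewrite le_max lexx orbT.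
have max_w (s : R) x : Num.max (s * w p x) 0 = Num.max s 0 * w p x.
  by rewrite maxr_pMl ?mul0r.
rewrite integralE [RHS]integralE; congr (_ - _)%E.
- transitivity (\int[mu]_t (Num.max (g t) 0)%:E)%E.
    by apply: eq_integral => t _; rewrite funeposE -EFin_max.
  rewrite (ge0_integral_supported (k := fun s => Num.max s 0)) ?maxxx //; last by apply: (mc id) => s; exact: cvg_id.
  apply: eq_integral => x _; rewrite funeposE -EFin_max; congr EFin.
  by rewrite /extend; case: asboolP => // _; rewrite ?max_w ?maxxx.
- transitivity (\int[mu]_t (Num.max (- g t) 0)%:E)%E.
    by apply: eq_integral => t _; rewrite funenegE -EFinN -EFin_max.
  rewrite (ge0_integral_supported (k := fun s => Num.max (- s) 0)) ?oppr0 ?maxxx //; last first.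
    by apply: mc; exact: opp_continuous.
  apply: eq_integral => x _; rewrite funenegE -EFinN -EFin_max; congr EFin.
  by rewrite /extend; case: asboolP => // _; rewrite -?mulNr ?max_w ?oppr0 ?maxxx.
Qed.

End Supported.
End ChartIntegral.

(** * The divergence theorem on a closed manifold *)

Section ClosedManifold.
Context {R : realType} {m : nat} {T : ptopologicalType}.
Variables (S : manifold R m T) (mu : {measure set (borel T) -> \bar R}).
Variable w : T -> 'rV[R]_m -> R.
Local Notation U p := (chart_image S p).
Local Notation d a := (basis_vec a : 'rV[R]_m).
Hypotheses (T_hausdorff : hausdorff_space T) (T_compact : compact [set: T]).
Hypothesis w_ge0 : forall p x, 0 <= w p x.
Hypothesis w_continuous : forall p x, U p x -> {for x, continuous (w p)}.
Hypothesis mu_w : forall p (A : set (borel T)), measurable A -> A `<=` dom S p ->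
  mu A = lebesgue_int (fun x => (\1_(chart S p @` A) x * w p x)%:E).

Let pou := partition_of_unity S T_hausdorff T_compact.

(** A partition of unity reduces this to functions supported in one chart. *)
Lemma continuous_integrable (g : T -> R) : continuous g ->
  mu.-integrable setT (EFin \o (g : borel T -> R)).
Proof.
move=> gc; have [s [phi [B [hB phi1]]]] := pou.
have -> : EFin \o (g : borel T -> R) =
    (fun t => \sum_(p <- s) (phi p t * g t)%:E)%E.
  by apply/funext => t /=; rewrite sumEFin -mulr_suml phi1 mul1r.
apply: integrable_sum => // p _; have [fC Bc [r Br] BU off near_off] := hB p.
have fc : continuous (phi p).
  by apply: (@continuous_charts _ _ _ S) => q x Ux; case: (fC q x Ux).
apply: (@integrable_supported _ _ _ S mu w w_ge0 w_continuous mu_w p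
  (fun t => phi p t * g t)).
- by move=> t; apply: continuousM; [exact: fc|exact: gc].
- by move=> t; rewrite mulf_eq0 negb_or => /andP[/off[]].
- have k0 y : U p y -> ~ B p y -> phi p (param S p y) * g (param S p y) * w p y = 0.
    move=> Uy By; have /eqP -> : phi p (param S p y) == 0; last by rewrite !mul0r.
    by apply: contra_notT By => /off[_]; rewrite paramK.
  apply: (@continuous_bounded_support_integrable _ _ _ r).
    apply: (extend_continuous Bc BU k0) => y Uy; apply: continuousM; last exact: w_continuous.
    apply: continuousM; first by case: (fC p y Uy).
    by apply: (@continuous_comp _ _ _ (param S p) g); [exact: param_continuous|exact: gc].
  move=> x rx; apply: (extend_off k0 BU) => /Br; rewrite ltNge; exact/negP/negPn.
Qed.

Variables (Y : T -> 'I_m -> 'rV[R]_m -> R) (c : T -> R).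
Hypothesis w_gt0 : forall p x, U p x -> 0 < w p x.
Hypothesis Y_C1 : forall p a, C1on (U p) (Y p a).
Hypothesis c_continuous : continuous c.
Hypothesis Y_divergence : forall p x, U p x ->
  \sum_a 'D_(d a) (Y p a) x = c (param S p x) * w p x.

(** The derivative of [phi] along the vector field with components
    [Y p a / w p] in the chart [p]. *)
Definition field_deriv (phi : T -> R) p x : R :=
  (\sum_a 'D_(d a) (phi \o param S p) x * Y p a x) / w p x.

Hypothesis Y_field : forall p q x phi, C1fun S phi -> U p x ->
  dom S q (param S p x) ->
  field_deriv phi p x = field_deriv phi q (transition S p q x).

Let dY phi t := field_deriv phi t (chart S t t).

Let dYE phi p x : C1fun S phi -> U p x -> dY phi (param S p x) = field_deriv phi p x.
Proof. by move=> phiC Ux; rewrite (Y_field phiC Ux (dom_center S _)). Qed.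

Let dY_continuous phi : C1fun S phi -> continuous (dY phi).
Proof.
move=> phiC; apply: (@continuous_charts _ _ _ S) => p x Ux.
apply: (@continuous_near_eq _ _ _ (field_deriv phi p)).
  have : \near x, U p x by apply: near_chart.
  by apply: filterS => y; exact: dYE.
apply: continuousM; last first.
  by apply: continuousV; [rewrite gt_eqF // w_gt0|exact: w_continuous].
apply: continuous_sum => a _; apply: continuousM.
  by case: (phiC p x Ux) => _ /(_ a)[].
by case: (@Y_C1 p a x Ux).
Qed.

(** The divergence of [phi] times the field, where [phi] is supported in the
    chart [p]; there it is a sum of partial derivatives of functions with
    compact support. *)
Let local_div phi t := phi t * c t + dY phi t.

Let local_div_continuous phi : C1fun S phi -> continuous (local_div phi).
Proof.
move=> phiC t; have phic : continuous phi.
  by apply: (@continuous_charts _ _ _ S) => q x Ux; case: (phiC q x Ux).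
apply: (@continuousD _ _ _ (fun t => phi t * c t) (dY phi)).
  by apply: continuousM; [exact: phic|exact: c_continuous].
exact: dY_continuous.
Qed.

Let integral_local_div p phi B : chart_supported S p phi B ->
  (\int[mu]_t (local_div phi t)%:E = 0)%E.
Proof.
move=> [fC Bc [r Br] BU off near_off].
pose u a := extend S p (fun x => phi (param S p x) * Y p a x).
have phi0 y : U p y -> ~ B y -> phi (param S p y) = 0.
  by move=> Uy By; apply/eqP; apply: contra_notT By => /off[_]; rewrite paramK.
have k0 a y : U p y -> ~ B y -> phi (param S p y) * Y p a y = 0.
  by move=> Uy By; rewrite phi0 // mul0r.
have uC a : C1on setT (u a).
  by apply: (extend_C1 Bc BU (k0 a)); apply: (C1onM (@U_open _ _ _ S p)).
have u0 a x : ~ B x -> u a x = 0 by exact: (extend_off (k0 a) BU).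
have Du0 a x : ~ B x -> 'D_(d a) (u a) x = 0.
  move=> Bx; rewrite (@near_eq_derive _ _ _ _ (cst 0)) ?derive_cst //.
  have : \near x, (~` B) x by apply: open_nbhs_nbhs; split => //; exact: closed_openC.
  by apply: filterS => y; exact: u0.
have rB x : r <= `|x| -> ~ B x by move=> rx /Br; rewrite ltNge rx.
have off' t : local_div phi t != 0 -> dom S p t.
  apply: contra_neqP => tp; have phit := nbhs_singleton (near_off t tp).
  rewrite /local_div phit mul0r add0r /dY /field_deriv big1 ?mul0r // => a _.
  rewrite (@near_eq_derive _ _ _ _ (cst 0)) ?derive_cst ?mul0r //.
  have tt := dom_center S t; have Ut := chart_image_chart tt.
  have h : \forall q \near param S t (chart S t t), phi q = 0.
    by rewrite chartK //; exact: near_off.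
  exact: (param_continuous Ut h).
have E : extend S p (fun x => local_div phi (param S p x) * w p x) =
    (fun x => \sum_a 'D_(d a) (u a) x).
  apply/funext => x; have [Ux|Ux] := pselect (U p x); last first.
    by rewrite /extend asboolF // big1 // => a _; apply: Du0 => /BU.
  rewrite extendE // /local_div mulrDl dYE // /field_deriv divfK ?gt_eqF ?w_gt0 //.
  rewrite -mulrA -Y_divergence // big_distrr -big_split; apply: eq_bigr => a _ /=.
  have : is_derive x (d a) (fun x => phi (param S p x) * Y p a x)
     ('D_(d a) (phi \o param S p) x * Y p a x + phi (param S p x) * 'D_(d a) (Y p a) x).
    apply: is_derive_M; first exact: (C1on_is_derive _ (fC p)).
    exact: C1on_is_derive.
  rewrite addrC => -[_ <-]; apply: near_eq_derive.
  have : \near x, U p x by apply: near_chart.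
  by apply: filterS => y Uy; rewrite /u extendE.
have Di a : (lebn m).-integrable setT (EFin \o ('D_(d a) (u a) : borel 'rV[R]_m -> R)).
  apply: (@continuous_bounded_support_integrable _ _ _ r).
    by move=> x; case: (uC a x) => // _ /(_ a)[].
  by move=> x /rB; exact: Du0.
have EE : EFin \o (extend S p (fun x => local_div phi (param S p x) * w p x) : borel 'rV[R]_m -> R)
    = (fun x => \sum_a ('D_(d a) (u a) x)%:E)%E.
  by apply/funext => x; rewrite /= E sumEFin.
rewrite (@integral_supported _ _ _ S mu w w_ge0 w_continuous mu_w p (local_div phi)) //; last first.
  exact: local_div_continuous.
under eq_integral do rewrite E -sumEFin.
rewrite integral_sum // big1 // => a _; apply: (@integral_derive_eq0 _ _ _ _ r).
- by move=> x; case: (uC a x).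
- by move=> x; case: (uC a x) => // _ /(_ a)[].
- by move=> x; case: (uC a x) => // _ /(_ a)[].
- by move=> x /rB; exact: u0.
Qed.

(** [local_div phi] is the divergence of [phi] times the field. When [phi] runs
    through a partition of unity, the derivatives of [phi] along the field add
    up to the derivative of 1, and the divergences add up to [c]. *)
Lemma closed_divergence : (\int[mu]_t (c t)%:E = 0)%E.
Proof.
have [s [phi [B [hB phi1]]]] := pou.
transitivity (\int[mu]_t (\sum_(p <- s) (local_div (phi p) t)%:E))%E.
  apply: eq_integral => t _; rewrite sumEFin big_split /= -mulr_suml phi1 mul1r.
  congr EFin; rewrite /dY /field_deriv -mulr_suml exchange_big /=.
  rewrite big1 ?mul0r ?addr0 // => a _; rewrite -mulr_suml.
  have Ut := chart_image_chart (dom_center S t).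
  have : is_derive (chart S t t) (d a) (fun x => \sum_(p <- s) (phi p \o param S t) x)
      (\sum_(p <- s) 'D_(d a) (phi p \o param S t) (chart S t t)).
    apply: is_derive_big_sum => p _; apply: (C1on_is_derive _ _ Ut).
    exact: (support_C1 (hB p)).
  move=> [_ <-]; rewrite (_ : (fun x => _) = cst 1) ?derive_cst ?mul0r //.
  by apply/funext => x; rewrite /= phi1.
rewrite integral_sum // => [|p].
  by rewrite big1 // => p _; exact: integral_local_div (hB p).
apply: continuous_integrable; apply: local_div_continuous.
exact: (support_C1 (hB p)).
Qed.

End ClosedManifold.

(** * The mixed curvatures as coefficients *)

Section MixedDet.
Context {R : realType} {m : nat}.
Implicit Types (sigma chi chib J : 'M[R]_m).

Lemma mixed_det_horner sigma chi chib (y yb : R) :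
  (mixed_det sigma chi chib).[y%:P].[yb] = \det (sigma + y *: chi + yb *: chib).
Proof.
rewrite -/(horner_eval y%:P _) -/(horner_eval yb _) /mixed_det -!det_map_mx; congr (\det _).
by apply/matrixP => a b; rewrite !mxE /= /horner_eval !hornerE.
Qed.

(** The values at real [y] and [yb] agree. *)
Lemma mixed_det_congruence J sigma chi chib :
  mixed_det (J *m sigma *m J^T) (J *m chi *m J^T) (J *m chib *m J^T) =
  (\det J ^+ 2)%:P%:P * mixed_det sigma chi chib.
Proof.
apply/eqP; rewrite -subr_eq0; apply/eqP; apply: poly2_eq0_horner => y yb.
rewrite !hornerE mixed_det_horner [in X in _ - X]mixed_det_horner.
have -> : J *m sigma *m J^T + y *: (J *m chi *m J^T) + yb *: (J *m chib *m J^T) =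
    J *m (sigma + y *: chi + yb *: chib) *m J^T.
  by rewrite !(mulmxDl, mulmxDr) -!scalemxAr -!scalemxAl.
by rewrite !det_mulmx det_tr; ring.
Qed.

Lemma mixed_mean_curvature_congruence J sigma chi chib r s : \det J != 0 ->
  mixed_mean_curvature (J *m sigma *m J^T) (J *m chi *m J^T) (J *m chib *m J^T) r s =
  mixed_mean_curvature sigma chi chib r s.
Proof.
move=> J0; rewrite /mixed_mean_curvature mixed_det_congruence !coefCM !det_mulmx det_tr.
have [->|s0] := eqVneq (\det sigma) 0; first by rewrite !mulr0 mul0r !invr0 !mulr0.
by field; rewrite J0 s0 pnatr_eq0 -lt0n fact_gt0.
Qed.

(** Jacobi's formula, where [B] varies with [y]. *)
Lemma mxtrace_adj_mixed_det sigma chi chib (y yb : R) :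
  \tr (chi *m \adj (sigma + y *: chi + yb *: chib)) =
  (mixed_det sigma chi chib)^`().[y%:P].[yb].
Proof.
pose p : {poly R} := map_poly (horner_eval yb) (mixed_det sigma chi chib).
have pE t : p.[t] = \det (sigma + t *: chi + yb *: chib).
  rewrite -mixed_det_horner -{1}(hornerC t yb) -/(horner_eval yb _) horner_map.
  by [].
have dp : is_derive y (1 : R) (fun t => \det (sigma + t *: chi + yb *: chib))
    (\tr (chi *m \adj (sigma + y *: chi + yb *: chib))).
  apply: (@is_derive_det _ _ _ (fun t : R => sigma + t *: chi + yb *: chib)) => i j.
  have -> : (fun t : R => (sigma + t *: chi + yb *: chib) i j) =
    (fun t : R => (sigma i j + yb * chib i j) + t * chi i j).
    by apply/funext => t; rewrite !mxE addrAC.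
  have hc (k : R) : is_derive y (1 : R) (fun=> k) 0 by exact: is_derive_cst.
  apply: (is_derive_eq (is_derive_D (hc _) (is_derive_M (is_derive_id y (1 : R)) (hc _)))).
  by rewrite mulr0 addr0 add0r mul1r.
have E : horner p = (fun t => \det (sigma + t *: chi + yb *: chib)) by exact/funext.
have [_ <-] := dp; rewrite -E; have [_ ->] := is_derive_poly p y.
by rewrite /p deriv_map -[RHS]/(horner_eval yb _) -horner_map /= {3}/horner_eval hornerC.
Qed.

(** The divergence of the current is a polynomial in [y] and [yb], whose
    coefficients are the integrands of the Minkowski formulas. *)
Definition density_poly sigma chi chib (xi q : R) : {poly {poly R}} :=
  let P := mixed_det sigma chi chib in
  (xi / \det sigma)%:P%:P
    * (m%:R%:P%:P * P - 'X * P^`() - 'X%:P * swapXY (swapXY P)^`())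
  + (2^-1 * q / \det sigma)%:P%:P * P^`().

(** The trace with [sigma] is what remains of [\tr (B *m \adj B)], a multiple
    of [\det B]. *)
Lemma density_poly_horner sigma chi chib xi q (y yb : R) :
  let B := sigma + y *: chi + yb *: chib in
  (density_poly sigma chi chib xi q).[y%:P].[yb] =
  (xi * \tr (sigma *m \adj B) + 2^-1 * q * \tr (chi *m \adj B)) / \det sigma.
Proof.
move=> B; have tb : \tr (chib *m \adj B) =
    (swapXY (swapXY (mixed_det sigma chi chib))^`()).[y%:P].[yb].
  rewrite horner2_swapXY -mixed_detC -mxtrace_adj_mixed_det.
  by rewrite /B addrAC.
have ts : \tr (sigma *m \adj B) =
    m%:R * \det B - y * \tr (chi *m \adj B) - yb * \tr (chib *m \adj B).
  have /(congr1 mxtrace) := mul_mx_adj B.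
  rewrite mxtrace_scalar {1}/B !mulmxDl -!scalemxAl !raddfD /= !mxtraceZ -(mulr_natl (\det B)).
  by move=> <-; ring.
rewrite ts tb mxtrace_adj_mixed_det -mixed_det_horner /density_poly.
by rewrite !hornerE; ring.
Qed.

Lemma density_poly_coef sigma chi chib xi q i j :
  (density_poly sigma chi chib xi q)`_i`_j =
  ((i + j)`!)%:R / (i`! * j`!)%:R *
    ((m%:R - (i + j)%:R) * (mixed_mean_curvature sigma chi chib i j * xi)
     + (i + j).+1%:R / 2 * (mixed_mean_curvature sigma chi chib i.+1 j * q)).
Proof.
rewrite /density_poly /mixed_mean_curvature; set P := mixed_det _ _ _; set D := (\det sigma)^-1.
have c1 : ('X * P^`())`_i`_j = i%:R * P`_i`_j.
  rewrite coefXM; case: i => [|i]; first by rewrite coef0 mul0r.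
  by rewrite coef_deriv coefMn mulr_natl.
set Y := 'X%:P * _; have c2 : Y`_i`_j = j%:R * P`_i`_j.
  rewrite /Y coefCM coefXM; case: j {c1} => [|j]; first by rewrite mul0r.
  by rewrite coef_swapXY coef_deriv coefMn coef_swapXY mulr_natl.
clearbody Y; rewrite !(coefD, coefN, coefCM) c1 c2 coef_deriv coefMn addSn !factS natrD.
rewrite !natrM -mulr_natr.
field.
by rewrite -natrD -[1]/1%:R -natrD !pnatr_eq0 -!lt0n !fact_gt0.
Qed.

Lemma bidegree_density_poly sigma chi chib xi q :
  bidegree_le m (density_poly sigma chi chib xi q).
Proof.
move=> i j ij; rewrite density_poly_coef /mixed_mean_curvature.
have h := bidegree_mixed_det sigma chi chib.
by rewrite !h ?addSn ?leqW // !(mulr0, mul0r) addr0 mulr0.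
Qed.

Lemma bidegree_coef_eq0 (d : nat) (A : nat -> nat -> R) :
  (forall y yb : R,
    \sum_(i < d.+1) \sum_(j < d.+1 | (i + j <= d)%N) A i j * yb ^+ j * y ^+ i = 0) ->
  forall i j, (i + j <= d)%N -> A i j = 0.
Proof.
move=> A0 i j ij.
pose P : {poly {poly R}} := \poly_(i < d.+1) \poly_(j < d.+1) (if (i + j <= d)%N then A i j else 0).
have Pc k l : (k + l <= d)%N -> P`_k`_l = A k l.
  move=> kl; rewrite coef_poly ltnS (leq_trans (leq_addr _ _) kl) coef_poly.
  by rewrite ltnS (leq_trans (leq_addl _ _) kl) kl.
have Pd : bidegree_le d P.
  move=> k l kl; rewrite coef_poly; case: ifP => _; rewrite ?coef0 // coef_poly.
  by case: ifP => _ //; rewrite leqNgt kl.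
rewrite -Pc // (poly2_eq0_horner (p := P)) ?coef0 // => y yb.
rewrite (horner_bidegree y yb Pd) -[RHS](A0 y yb).
by apply: eq_bigr => k _; apply: eq_bigr => l kl; rewrite Pc.
Qed.

End MixedDet.

(** * The current in a chart *)

Section ChartCurrent.
Context {R : realType} {m : nat}.
Variables (kappa : R) (U : set 'rV[R]_m) (X L Lb : 'rV[R]_m -> 'rV[R]_m.+2).
Local Notation g := (static_metric kappa).
Local Notation d a := (basis_vec a : 'rV[R]_m).
Local Notation e := (tangent X).
Local Notation D := (cov kappa X).
Hypotheses (Uo : open U) (Xf : forall x, U x -> lapse2 kappa (X x) != 0).
Hypotheses (X_smooth : smooth_vec U X) (L_smooth : smooth_vec U L)
  (Lb_smooth : smooth_vec U Lb).
Hypotheses (LL : forall x, U x -> g (X x) (L x) (L x) = 0)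
  (bb : forall x, U x -> g (X x) (Lb x) (Lb x) = 0)
  (Lb2 : forall x, U x -> g (X x) (L x) (Lb x) = - 2)
  (eL : forall x a, U x -> g (X x) (e a x) (L x) = 0)
  (eb : forall x a, U x -> g (X x) (e a x) (Lb x) = 0)
  (torsion0 : forall x a, U x -> g (X x) (D L a x) (Lb x) = 0).

Definition chart_metric x : 'M[R]_m := \matrix_(a, b) g (X x) (e a x) (e b x).

Definition chart_form V x : 'M[R]_m := \matrix_(a, b) g (X x) (D V a x) (e b x).

Definition chart_beta x : 'rV[R]_m := \row_a Qform (X x) (L x) (e a x).

Hypothesis sigma_pos : forall x, U x -> 0 < \det (chart_metric x).

Variables y yb : R.
Let B x := chart_metric x + y *: chart_form L x + yb *: chart_form Lb x.

(** The components of a tangent field times the volume density: the divergence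
    is then a plain sum of partial derivatives. *)
Definition current a x : R :=
  (chart_beta x *m \adj (B x)) 0 a / Num.sqrt (\det (chart_metric x)).

Let he a : C1vec U (e a) := smooth_dir_deriv Uo a X_smooth.

Lemma C1on_chart_metric a b : C1on U (fun x => chart_metric x a b).
Proof.
apply: (C1on_eq Uo _ (C1on_static_metric Uo Xf X_smooth (he a) (he b))) => x _.
by rewrite mxE.
Qed.

Lemma C1on_chart_form V a b : smooth_vec U V -> C1on U (fun x => chart_form V x a b).
Proof.
move=> hV; apply: (C1on_eq Uo _ (C1on_static_metric Uo Xf X_smooth
  (C1vec_cov Uo Xf X_smooth a hV) (he b))) => x _.
by rewrite mxE.
Qed.

Lemma C1on_chart_volume : C1on U (fun x => Num.sqrt (\det (chart_metric x))).
Proof.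
by apply: (C1on_sqrt Uo _ sigma_pos); apply: (C1on_det Uo) => a b; exact: C1on_chart_metric.
Qed.

Lemma C1on_current a : C1on U (current a).
Proof.
have hB i j : C1on U (fun x => B x i j).
  apply: (C1on_eq Uo (g := fun x => chart_metric x i j + y * chart_form L x i j
    + yb * chart_form Lb x i j)) => [x _|]; first by rewrite !mxE.
  have cst (c : R) := C1on_cst c Uo.
  apply: (C1onD Uo); first apply: (C1onD Uo).
  - exact: C1on_chart_metric.
  - exact: (C1onM Uo (cst _) (C1on_chart_form i j L_smooth)).
  - exact: (C1onM Uo (cst _) (C1on_chart_form i j Lb_smooth)).
apply: (C1onM Uo); last first.
  apply: (C1onV Uo C1on_chart_volume) => x Ux.
  by rewrite gt_eqF // sqrtr_gt0 sigma_pos.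
apply: (C1on_eq Uo (g := fun x => \sum_c chart_beta x 0 c * (\adj (B x)) c a)) => [x _|].
  by rewrite mxE.
apply: (@C1on_sum _ _ U _ (index_enum _) xpredT
  (fun c x => chart_beta x 0 c * (\adj (B x)) c a) Uo) => c _.
apply: (C1onM Uo); last exact: C1on_adj.
apply: (C1on_eq Uo _ (C1on_Qform Uo X_smooth (smooth_C1vec L_smooth) (he c))) => x _.
by rewrite mxE.
Qed.

Lemma current_divergence x : U x -> \sum_a 'D_(d a) (current a) x =
  (g (X x) (L x) partial_t * \tr (chart_metric x *m \adj (B x))
   + 2^-1 * Qform (X x) (L x) (Lb x) * \tr (chart_form L x *m \adj (B x)))
  / Num.sqrt (\det (chart_metric x)).
Proof.
move=> Ux.
have frame x' V : U x' -> V =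
  (- 2^-1 * g (X x') V (Lb x')) *: L x' + (- 2^-1 * g (X x') V (L x')) *: Lb x'
  + \sum_a ((\row_b g (X x') V (e b x')) *m invmx (chart_metric x')) 0 a *: e a x'.
  move=> Ux'; apply: null_frame_expansion.
  - exact: LL.
  - exact: bb.
  - exact: Lb2.
  - by move=> a; exact: eL.
  - by move=> a; exact: eb.
  - by rewrite unitmxE unitfE gt_eqF //; exact: sigma_pos.
have sym V x' : smooth_vec U V -> (forall z a, U z -> g (X z) (e a z) (V z) = 0) ->
    U x' -> (chart_form V x')^T = chart_form V x'.
  move=> hV eV Ux'; apply/matrixP => a b; rewrite mxE [LHS]mxE [RHS]mxE.
  exact: (second_form_sym Uo Xf X_smooth hV eV b a Ux').
have [v hv E] := @divergence_identity R m m.+2 U (fun x => g (X x)) (fun x => Qform (X x))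
  (fun x V => g (X x) V partial_t) e L Lb D (C1vec U) Uo
  (fun x => static_metricC kappa (X x)) (fun x => static_metricDl kappa (X x))
  (fun x => static_metricZl kappa (X x))
  (fun x => QformC (X x)) (fun x => QformDl (X x)) (fun x => QformZl (X x))
  he (smooth_C1vec L_smooth) (smooth_C1vec Lb_smooth)
  (fun a => C1vec_cov Uo Xf X_smooth a L_smooth)
  (fun a => C1vec_cov Uo Xf X_smooth a Lb_smooth)
  (fun V W a x hV hW Ux => is_derive_g Xf X_smooth a hV hW Ux)
  (fun V W a x hV hW Ux => is_derive_Q Xf X_smooth a hV hW Ux)
  (fun a b x Ux => cov_tangent_sym kappa Uo X_smooth a b Ux)
  (fun a b x Ux => cov_cov_sym Uo Xf X_smooth L_smooth eL a b Ux)
  (fun a b x Ux => cov_cov_sym Uo Xf X_smooth Lb_smooth eb a b Ux)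
  LL bb Lb2 eL eb torsion0 sigma_pos
  (fun x Ux => sym L x L_smooth eL Ux) (fun x Ux => sym Lb x Lb_smooth eb Ux)
  frame y yb x Ux.
rewrite -[RHS]E; apply: eq_bigr => a _; by have [_ <-] := hv a.
Qed.

End ChartCurrent.

(** * Change of charts *)

Section Congruence.
Context {R : realType} {m : nat}.

(** With [J] the Jacobian matrix of a change of charts and [f] the differential
    of a function, this relates the derivatives of the function along the field
    [Y] in the two charts, up to the denominators [\det sigma]; these have the
    same factor [\det J ^+ 2]. *)
Lemma current_congruence (J B : 'M[R]_m) (b f : 'rV[R]_m) :
  (b *m J^T) *m \adj (J *m B *m J^T) *m (f *m J^T)^T =
  \det J ^+ 2 *: (b *m \adj B *m f^T).
Proof.
rewrite !adj_mulmx trmx_mul trmxK -!mulmxA (mulmxA (\adj J)) mul_adj_mx mul_scalar_mx.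
rewrite (mulmxA J^T) mul_mx_adj mul_scalar_mx det_tr -!scalemxAr scalerA -expr2.
by rewrite !mulmxA.
Qed.

Lemma static_metric_congruence n (kappa : R) (z : 'rV[R]_n.+1) (J : 'M[R]_m)
    (u v : 'I_m -> 'rV[R]_n.+1) :
  \matrix_(a, c) static_metric kappa z (\sum_b J a b *: u b) (\sum_b J c b *: v b) =
  J *m (\matrix_(a, c) static_metric kappa z (u a) (v c)) *m J^T.
Proof.
apply/matrixP => a c; rewrite mxE [RHS]mxE static_metric_sumr; apply: eq_bigr => k _.
rewrite static_metricZr static_metric_suml mulrC [J^T _ _]mxE; congr (_ * _).
by rewrite [RHS]mxE; apply: eq_bigr => l _; rewrite static_metricZl [in RHS]mxE.
Qed.

End Congruence.

Section Spacetime.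
Context {R : realType} {m : nat} {T : ptopologicalType}.
Variables (kappa : R) (S : manifold R m T) (F : T -> 'rV[R]_m.+2).
Local Notation g := (static_metric kappa).
Local Notation d a := (basis_vec a : 'rV[R]_m).
Local Notation U p := (chart_image S p).
Local Notation X p := (F \o param S p).
Local Notation D p := (cov kappa (X p)).
Hypotheses (F_smooth : smooth_map S F) (F_static : forall t, static_domain kappa (F t)).
Hypothesis F_spacelike : spacelike S g F.

Let Xf p x : lapse2 kappa (X p x) != 0.
Proof. exact: F_static. Qed.

Lemma null_second_formE V p x :
  null_second_form S g F V p x = chart_form kappa (X p) (V \o param S p) x.
Proof.
by apply/matrixP => a b; rewrite mxE [RHS]mxE /cov_deriv_along cov_deriv_static.
Qed.

Lemma induced_metricE p x : induced_metric S g F p x = chart_metric kappa (X p) x.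
Proof. by []. Qed.

(** The induced metric is the Gram matrix of a positive form, because the
    pushforward is linear. *)
Lemma induced_metric_det_gt0 p x : U p x -> 0 < \det (induced_metric S g F p x).
Proof.
move=> Ux; apply: det_posdef_gt0 => v v0.
have -> : (v *m induced_metric S g F p x *m v^T) 0 0 =
    g (F (param S p x)) (Defs.pushforward S F p x v) (Defs.pushforward S F p x v).
  have -> : Defs.pushforward S F p x v = \sum_a v 0 a *: Defs.pushforward S F p x (d a).
    apply/rowP => k; rewrite summxE [LHS]mxE.
    have [_ ->] := derive_C1on v (@U_open _ _ _ S p)
      (smooth_C1on [::] (@F_smooth p k)) Ux.
    by apply: eq_bigr => a _; rewrite [RHS]mxE [in RHS]mxE.
  rewrite static_metric_sumr mxE; apply: eq_bigr => a _.
  rewrite static_metricZr mulrC [v^T _ _]mxE static_metric_suml; congr (_ * _).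
  by rewrite mxE; apply: eq_bigr => b _; rewrite static_metricZl [in LHS]mxE.
exact: F_spacelike.
Qed.

Section Transition.
Variables (p q : T) (x : 'rV[R]_m).
Hypotheses (Ux : U p x) (xq : dom S q (param S p x)).
Let z := transition S p q x.
Let zE : param S q z = param S p x. Proof. by rewrite /z /transition chartK. Qed.

Definition jacobian : 'M[R]_m := \matrix_(a, b) 'D_(d a) (fun y => transition S p q y 0 b) x.
Local Notation J := jacobian.

Lemma dir_deriv_transition N (V : T -> 'rV[R]_N) a : smooth_map S V ->
  dir_deriv (V \o param S p) (d a) x =
  \sum_b J a b *: dir_deriv (V \o param S q) (d b) z.
Proof.
move=> hV; apply/rowP => k; rewrite [LHS]dir_derivE summxE.
have hk : C1on (U q) ((fun t => V t 0 k) \o param S q) := smooth_C1on [::] (hV q k).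
have [_ ->] := chain_rule_chart (d a) hk Ux xq.
by apply: eq_bigr => b _; rewrite [in RHS]mxE [in RHS]dir_derivE [in RHS]mxE.
Qed.

Lemma cov_transition V a : smooth_map S V ->
  D p (V \o param S p) a x = \sum_b J a b *: D q (V \o param S q) b z.
Proof.
move=> hV; rewrite /cov /covD /tangent !dir_deriv_transition //= zE.
under [RHS]eq_bigr do rewrite scalerDr -static_connZl.
rewrite big_split /=; congr (_ + _).
apply: (big_morph (fun u => static_conn kappa (F (param S p x)) u (V (param S p x)))).
- by move=> u u'; exact: static_connDl.
- exact: static_conn0l.
Qed.

Lemma induced_metric_transition :
  induced_metric S g F p x = J *m induced_metric S g F q z *m J^T.
Proof.
rewrite !induced_metricE /chart_metric /= zE -static_metric_congruence.
by apply/matrixP => a b; rewrite mxE [RHS]mxE /tangent !dir_deriv_transition.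
Qed.

Lemma null_second_form_transition V : smooth_map S V ->
  null_second_form S g F V p x = J *m null_second_form S g F V q z *m J^T.
Proof.
move=> hV; rewrite !null_second_formE /chart_form /= zE -static_metric_congruence.
apply/matrixP => a b; rewrite mxE [RHS]mxE cov_transition //.
by rewrite /tangent dir_deriv_transition.
Qed.

Lemma chart_beta_transition L :
  chart_beta (X p) (L \o param S p) x = chart_beta (X q) (L \o param S q) z *m J^T.
Proof.
apply/rowP => a; rewrite mxE [RHS]mxE /tangent dir_deriv_transition // Qform_sumr /= -zE.
by apply: eq_bigr => b _; rewrite QformZr [in RHS]mxE [J^T _ _]mxE mulrC.
Qed.

Lemma jacobian_det_neq0 : \det J != 0.
Proof.
have := induced_metric_det_gt0 Ux; rewrite induced_metric_transition !det_mulmx.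
by apply: contraTneq => ->; rewrite !mul0r ltxx.
Qed.

End Transition.
End Spacetime.

(** * Continuity of the mixed curvatures *)

Section CoefContinuity.
Context {R : realType} {W : topologicalType}.
Variable x : W.

Definition coef_continuous (P : W -> {poly {poly R}}) :=
  forall i j, {for x, continuous (fun y => (P y)`_i`_j)}.

Lemma coef_continuous_ext P P' : P =1 P' -> coef_continuous P' -> coef_continuous P.
Proof. by move=> /funext ->. Qed.

Lemma coef_continuous_cst P : coef_continuous (fun=> P).
Proof. by move=> i j; exact: cst_continuous. Qed.

Lemma coef_continuousC (f : W -> R) : {for x, continuous f} ->
  coef_continuous (fun y => (f y)%:P%:P).
Proof.
move=> fc i j; have z : {for x, continuous (fun=> 0 : R)} by exact: cst_continuous.
case: i => [|i]; last by apply: continuous_ext z => y; rewrite coefC coef0.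
case: j => [|j]; last by apply: continuous_ext z => y; rewrite !coefC.
by apply: continuous_ext fc => y; rewrite !coefC.
Qed.

Lemma coef_continuousD P Q : coef_continuous P -> coef_continuous Q ->
  coef_continuous (fun y => P y + Q y).
Proof.
move=> hP hQ i j; apply: (continuous_ext _ (continuousD (hP i j) (hQ i j))) => y.
by rewrite !coefD.
Qed.

Lemma coef_continuousM P Q : coef_continuous P -> coef_continuous Q ->
  coef_continuous (fun y => P y * Q y).
Proof.
move=> hP hQ i j.
apply: (@continuous_ext _ _ _ (fun y =>
  \sum_(k < i.+1) \sum_(l < j.+1) (P y)`_k`_l * (Q y)`_(i - k)`_(j - l))).
  by move=> y; rewrite coefM coef_sum; apply: eq_bigr => k _; rewrite coefM.
apply: continuous_sum => k _; apply: continuous_sum => l _.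
by apply: continuousM; [exact: hP|exact: hQ].
Qed.

Lemma coef_continuous_sum (I : Type) (s : seq I) (P : I -> W -> {poly {poly R}}) :
  (forall i, coef_continuous (P i)) -> coef_continuous (fun y => \sum_(i <- s) P i y).
Proof.
move=> hP; elim: s => [|i s ih].
  apply: (@coef_continuous_ext _ (fun=> 0)) => [y|]; first by rewrite big_nil.
  exact: coef_continuous_cst.
apply: coef_continuous_ext (coef_continuousD (hP i) ih) => y.
by rewrite big_cons.
Qed.

Lemma coef_continuous_prod (I : Type) (s : seq I) (P : I -> W -> {poly {poly R}}) :
  (forall i, coef_continuous (P i)) -> coef_continuous (fun y => \prod_(i <- s) P i y).
Proof.
move=> hP; elim: s => [|i s ih].
  apply: (@coef_continuous_ext _ (fun=> 1)) => [y|]; first by rewrite big_nil.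
  exact: coef_continuous_cst.
apply: coef_continuous_ext (coef_continuousM (hP i) ih) => y.
by rewrite big_cons.
Qed.

(** The coefficients of [mixed_det] are polynomial in the entries of the three
    matrices. *)
Lemma mixed_mean_curvature_continuous m (sigma chi chib : W -> 'M[R]_m) r s :
  (forall a b, {for x, continuous (fun y => sigma y a b)}) ->
  (forall a b, {for x, continuous (fun y => chi y a b)}) ->
  (forall a b, {for x, continuous (fun y => chib y a b)}) ->
  {for x, continuous (fun y => \det (sigma y))} -> \det (sigma x) != 0 ->
  {for x, continuous (fun y => mixed_mean_curvature (sigma y) (chi y) (chib y) r s)}.
Proof.
move=> hs hc hb hd d0; apply: continuousM; last exact: continuousV.
apply: continuousM; first exact: cst_continuous.
suff : coef_continuous (fun y => mixed_det (sigma y) (chi y) (chib y)) by apply.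
rewrite /mixed_det /determinant; apply: coef_continuous_sum => s'.
apply: coef_continuousM; first exact: coef_continuous_cst.
apply: coef_continuous_prod => a.
apply: (@coef_continuous_ext _ (fun y => (sigma y a (s' a))%:P%:P
  + 'X * (chi y a (s' a))%:P%:P + 'X%:P * (chib y a (s' a))%:P%:P)).
  by move=> y; rewrite mxE.
apply: coef_continuousD; first apply: coef_continuousD.
- exact: coef_continuousC.
- by apply: coef_continuousM; [exact: coef_continuous_cst|exact: coef_continuousC].
- by apply: coef_continuousM; [exact: coef_continuous_cst|exact: coef_continuousC].
Qed.

End CoefContinuity.

Lemma Rintegral_sum {R : realType} dd (W : measurableType dd)
    (mu : {measure set W -> \bar R}) (I : Type) (s : seq I) (P : pred I) (f : I -> W -> R) :
  (forall i, mu.-integrable setT (EFin \o f i)) ->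
  \int[mu]_(t in setT) (\sum_(i <- s | P i) f i t) =
  \sum_(i <- s | P i) \int[mu]_(t in setT) f i t.
Proof.
move=> fi; rewrite /Rintegral; under eq_integral do rewrite -sumEFin.
rewrite integral_sum // (eq_bigr (fun i => (\int[mu]_(t in setT) f i t)%:E)) ?sumEFin //.
by move=> i _; rewrite /Rintegral fineK //; exact: integrable_fin_num (fi i).
Qed.

(** * The Minkowski formulas *)

Section Minkowski.
Context {R : realType} {m : nat} {T : ptopologicalType}.
Variables (kappa : R) (S : manifold R m T) (F L Lb : T -> 'rV[R]_m.+2).
Variable mu : {measure set (borel T) -> \bar R}.
Local Notation g := (static_metric kappa).
Local Notation d a := (basis_vec a : 'rV[R]_m).
Local Notation U p := (chart_image S p).
Local Notation X p := (F \o param S p).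
Hypotheses (T_hausdorff : hausdorff_space T) (T_compact : compact [set: T]).
Hypotheses (F_smooth : smooth_map S F) (F_static : forall t, static_domain kappa (F t)).
Hypothesis F_spacelike : spacelike S g F.
Hypotheses (L_smooth : smooth_map S L) (Lb_smooth : smooth_map S Lb).
Hypothesis LLb_null_frame : null_frame S g F L Lb.
Hypothesis torsion0 : forall p x a, U p x ->
  g (X p x) (cov kappa (X p) (L \o param S p) a x) (Lb (param S p x)) = 0.
Hypothesis mu_area : area_measure S g F mu.

Let sigma p x := induced_metric S g F p x.
Let chi p x := null_second_form S g F L p x.
Let chib p x := null_second_form S g F Lb p x.
Let xi t : R := g (F t) (L t) partial_t.
Let q t : R := Qform (F t) (L t) (Lb t).
Let K r s t : R := mixedP S g F L Lb r s t.
Let w p x : R := Num.sqrt (\det (sigma p x)).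

Let Xf p x : U p x -> lapse2 kappa (X p x) != 0.
Proof. by move=> _; exact: F_static. Qed.

Let X_smooth p : smooth_vec (U p) (X p). Proof. exact: F_smooth. Qed.
Let Lp_smooth p : smooth_vec (U p) (L \o param S p). Proof. exact: L_smooth. Qed.
Let Lbp_smooth p : smooth_vec (U p) (Lb \o param S p). Proof. exact: Lb_smooth. Qed.

Let sigma_pos p x : U p x -> 0 < \det (chart_metric kappa (X p) x).
Proof. exact: (induced_metric_det_gt0 F_smooth F_spacelike). Qed.

Let w_C1 p : C1on (U p) (w p).
Proof. exact: (C1on_chart_volume (@U_open _ _ _ S p) (@Xf p) (@X_smooth p) (@sigma_pos p)). Qed.

Let K_chart r s p x : U p x -> K r s (param S p x) =
  mixed_mean_curvature (sigma p x) (chi p x) (chib p x) r s.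
Proof.
move=> Ux; have xq := dom_center S (param S p x).
rewrite /sigma /chi /chib.
rewrite (induced_metric_transition kappa F_smooth Ux xq).
rewrite (null_second_form_transition F_smooth F_static Ux xq L_smooth).
rewrite (null_second_form_transition F_smooth F_static Ux xq Lb_smooth).
rewrite mixed_mean_curvature_congruence //.
exact: (jacobian_det_neq0 F_smooth F_spacelike Ux xq).
Qed.

Let K_continuous r s : continuous (K r s).
Proof.
apply: (@continuous_charts _ _ _ S) => p x Ux.
apply: (@continuous_near_eq _ _ _ (fun x =>
  mixed_mean_curvature (sigma p x) (chi p x) (chib p x) r s)).
  have : \near x, U p x by exact: near_chart.
  by apply: filterS => y; exact: K_chart.
have Uo := @U_open _ _ _ S p.
have hs a b : C1on (U p) (fun x => sigma p x a b) := C1on_chart_metric Uo (@Xf p) (@X_smooth p) a b.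
have hV V : smooth_map S V -> forall a b,
    {for x, continuous (fun x => null_second_form S g F V p x a b)}.
  move=> V_smooth a b.
  have [+ _] := C1on_chart_form Uo (@Xf p) (@X_smooth p) a b (V_smooth p) Ux.
  by apply: continuous_ext => y; rewrite null_second_formE.
apply: mixed_mean_curvature_continuous.
- by move=> a b; case: (hs a b x Ux).
- exact: hV.
- exact: hV.
- by case: (C1on_det Uo hs Ux).
- by rewrite gt_eqF //; exact: sigma_pos.
Qed.

Let xi_continuous : continuous xi.
Proof.
apply: (@continuous_charts _ _ _ S) => p x Ux; have Uo := @U_open _ _ _ S p.
have hc : C1vec (U p) (fun=> partial_t : 'rV[R]_m.+2) by move=> k; exact: C1on_cst.
by case: (C1on_static_metric Uo (@Xf p) (@X_smooth p) (smooth_C1vec (@Lp_smooth p)) hc Ux).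
Qed.

Let q_continuous : continuous q.
Proof.
apply: (@continuous_charts _ _ _ S) => p x Ux; have Uo := @U_open _ _ _ S p.
by case: (C1on_Qform Uo (@X_smooth p) (smooth_C1vec (@Lp_smooth p)) (smooth_C1vec (@Lbp_smooth p)) Ux).
Qed.

Let G t := density_poly (sigma t (chart S t t)) (chi t (chart S t t))
  (chib t (chart S t t)) (xi t) (q t).

Let Gcoef i j t : R := ((i + j)`!)%:R / (i`! * j`!)%:R *
  ((m%:R - (i + j)%:R) * (K i j t * xi t) + (i + j).+1%:R / 2 * (K i.+1 j t * q t)).

Let G_coef i j t : (G t)`_i`_j = Gcoef i j t.
Proof. exact: density_poly_coef. Qed.

Let G_chart p x : U p x -> G (param S p x) = density_poly (sigma p x) (chi p x)
  (chib p x) (xi (param S p x)) (q (param S p x)).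
Proof.
move=> Ux; apply/polyP => i; apply/polyP => j.
apply: (etrans (G_coef i j _)); apply: (etrans _ (esym (density_poly_coef _ _ _ _ _ _ _))).
exact: (congr2 (fun u v => ((i + j)`!)%:R / (i`! * j`!)%:R *
  ((m%:R - (i + j)%:R) * (u * xi (param S p x))
   + (i + j).+1%:R / 2 * (v * q (param S p x)))) (K_chart i j Ux) (K_chart i.+1 j Ux)).
Qed.

Let Gcoef_continuous i j : continuous (Gcoef i j).
Proof.
have prod (k : R) (f h : T -> R) : continuous f -> continuous h ->
    forall t, {for t, continuous (fun t => k * (f t * h t))}.
  move=> fc hc t; have h1 := continuousM (fc t) (hc t).
  exact: (continuousM (@cst_continuous T R k t) h1).
move=> t; have h := continuousD (prod (m%:R - (i + j)%:R) _ _ (@K_continuous i j) xi_continuous t)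
  (prod ((i + j).+1%:R / 2) _ _ (@K_continuous i.+1 j) q_continuous t).
exact: (continuousM (@cst_continuous T R _ t) h).
Qed.

Let w_continuous p x : U p x -> {for x, continuous (w p)}.
Proof. by move=> /(w_C1 (p := p))[]. Qed.

Let w_ge0 p x : 0 <= w p x. Proof. exact: sqrtr_ge0. Qed.

Let w_gt0 p x : U p x -> 0 < w p x.
Proof. by move=> Ux; rewrite sqrtr_gt0; exact: sigma_pos. Qed.

Let sigmaE p x : U p x -> \det (sigma p x) = w p x ^+ 2.
Proof. by move=> Ux; rewrite sqr_sqrtr // ltW //; exact: sigma_pos. Qed.

Section Current.
Variables y yb : R.

Let Y p := current kappa (X p) (L \o param S p) (Lb \o param S p) y yb.

Let c t : R := (G t).[y%:P].[yb].

Let cE t : c t = \sum_(i < m.+1) \sum_(j < m.+1 | (i + j <= m)%N)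
  Gcoef i j t * yb ^+ j * y ^+ i.
Proof.
rewrite /c (horner_bidegree _ _ (bidegree_density_poly _ _ _ _ _)).
by apply: eq_bigr => i _; apply: eq_bigr => j _; rewrite -G_coef.
Qed.

Let c_continuous : continuous c.
Proof.
move=> t; apply: (continuous_ext cE); apply: continuous_sum => i _.
apply: continuous_sum => j _; apply: continuousM; last exact: cst_continuous.
by apply: continuousM; [exact: Gcoef_continuous|exact: cst_continuous].
Qed.

Let Y_divergence p x : U p x ->
  \sum_a 'D_(d a) (Y p a) x = c (param S p x) * w p x.
Proof.
move=> Ux; have [eL eb nf] := LLb_null_frame.
have LL x' : U p x' -> g (X p x') (L (param S p x')) (L (param S p x')) = 0.
  by move=> _; case: (nf (param S p x')).
have bb x' : U p x' -> g (X p x') (Lb (param S p x')) (Lb (param S p x')) = 0.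
  by move=> _; case: (nf (param S p x')).
have Lb2 x' : U p x' -> g (X p x') (L (param S p x')) (Lb (param S p x')) = - 2.
  by move=> _; case: (nf (param S p x')).
have e0 V : normal_field S g F V ->
    forall x' a, U p x' -> g (X p x') (tangent (X p) a x') (V (param S p x')) = 0.
  by move=> hV x' a Ux'; rewrite static_metricC; exact: hV.
rewrite (current_divergence (@U_open _ _ _ S p) (@Xf p) (@X_smooth p) (@Lp_smooth p)
  (@Lbp_smooth p) LL bb Lb2 (e0 L eL) (e0 Lb eb) (@torsion0 p) (@sigma_pos p)) //.
rewrite /c G_chart // density_poly_horner /chi /chib !null_second_formE // sigmaE //.
have w0 : w p x != 0 by rewrite gt_eqF // w_gt0.
rewrite /sigma !induced_metricE -/(w p x) -/(sigma p x); set A := (_ + _).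
by rewrite expr2 invfM mulrA divfK // -expr2 sqrtr_sqr ger0_norm.
Qed.

Let Y_field p q' x phi : C1fun S phi -> U p x -> dom S q' (param S p x) ->
  field_deriv S w Y phi p x = field_deriv S w Y phi q' (transition S p q' x).
Proof.
move=> hphi Ux xq; set z := transition S p q' x.
have Uz : U q' z by exact: (transition_image (overlapP Ux xq)).
pose B p x := sigma p x + y *: chi p x + yb *: chib p x.
pose b p x := chart_beta (X p) (L \o param S p) x.
pose df p x : 'rV[R]_m := \row_a 'D_(d a) (phi \o param S p) x.
have YE p' a x' : Y p' a x' = (b p' x' *m \adj (B p' x')) 0 a / w p' x'.
  by rewrite /B /chi /chib !null_second_formE.
have fE p' x' : U p' x' -> field_deriv S w Y phi p' x' =
    (b p' x' *m \adj (B p' x') *m (df p' x')^T) 0 0 / \det (sigma p' x').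
  move=> Ux'; rewrite sigmaE // expr2 invfM mulrA; congr (_ / _).
  rewrite [in RHS]mxE big_distrl; apply: eq_bigr => a _.
  rewrite YE [(df p' x')^T _ _]mxE [df p' x' _ _]mxE mulrA; congr (_ / _).
  exact: mulrC.
pose J := jacobian S p q' x.
have sE : sigma p x = J *m sigma q' z *m J^T.
  exact: (induced_metric_transition kappa F_smooth Ux xq).
have BE : B p x = J *m B q' z *m J^T.
  have hc := null_second_form_transition F_smooth F_static Ux xq L_smooth.
  have hcb := null_second_form_transition F_smooth F_static Ux xq Lb_smooth.
  rewrite /B sE /chi hc /chib hcb !(mulmxDl, mulmxDr) -!scalemxAr -!scalemxAl.
  by [].
have bE : b p x = b q' z *m J^T by exact: (chart_beta_transition F_smooth Ux xq).
have dfE : df p x = df q' z *m J^T.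
  apply/rowP => a; rewrite mxE [RHS]mxE.
  have [_ ->] := chain_rule_chart (d a) (hphi q') Ux xq.
  apply: eq_bigr => k _.
  by rewrite [df q' z _ _]mxE [J^T _ _]mxE [J _ _]mxE mulrC.
have J0 : \det J != 0 := jacobian_det_neq0 F_smooth F_spacelike Ux xq.
rewrite (fE p x Ux) (fE q' z Uz) BE bE dfE current_congruence sE !det_mulmx det_tr.
rewrite [Z in Z / _]mxE; set N := (_ *m _) _ _.
have s0 : \det (sigma q' z) != 0 by rewrite sigmaE // expf_neq0 // gt_eqF // w_gt0.
move: (\det (sigma q' z)) (\det J) s0 J0 => s j s0 j0.
by field; rewrite s0 j0.
Qed.

Lemma sum_integral_eq0 :
  \sum_(i < m.+1) \sum_(j < m.+1 | (i + j <= m)%N)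
    (\int[mu]_(t in [set: borel T]) Gcoef i j t) * yb ^+ j * y ^+ i = 0.
Proof.
have Gi (i j : nat) : mu.-integrable setT (EFin \o (Gcoef i j : borel T -> R)).
  exact: (continuous_integrable T_hausdorff T_compact w_ge0 w_continuous mu_area (@Gcoef_continuous i j)).
have cI : (\int[mu]_t (c t)%:E = 0)%E.
  apply: (closed_divergence T_hausdorff T_compact w_ge0 w_continuous mu_area w_gt0
    _ c_continuous Y_divergence Y_field).
  move=> p a; exact: (C1on_current (@U_open _ _ _ S p) (@Xf p) (@X_smooth p)
    (@Lp_smooth p) (@Lbp_smooth p) (@sigma_pos p)).
have Gij (i j : nat) : mu.-integrable setT
    (EFin \o (fun t : borel T => Gcoef i j t * yb ^+ j * y ^+ i)).
  have := integrableZr measurableT (yb ^+ j * y ^+ i) (Gi i j).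
  by congr (_ .-integrable _ _); apply/funext => t /=; rewrite -EFinM mulrA.
have cR : \int[mu]_(t in [set: borel T]) c t = 0 by rewrite /Rintegral cI.
rewrite -[RHS]cR.
under [RHS]eq_Rintegral do rewrite cE.
rewrite Rintegral_sum => [|i]; last first.
  have := integrable_sum measurableT (P := fun j : 'I_m.+1 => (i + j <= m)%N)
    (index_enum _) (fun j _ => Gij i j).
  by congr (_ .-integrable _ _); apply/funext => t /=; rewrite sumEFin.
apply: eq_bigr => i _; rewrite Rintegral_sum //; apply: eq_bigr => j _.
under [RHS]eq_Rintegral do rewrite -mulrA.
by rewrite RintegralZr // mulrA.
Qed.

End Current.

Let Ki (r s : nat) (f : T -> R) : continuous f ->
  mu.-integrable setT (EFin \o (fun t : borel T => K r s t * f t)).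
Proof.
move=> fc; apply: (continuous_integrable T_hausdorff T_compact w_ge0 w_continuous mu_area).
by move=> t; exact: (continuousM (@K_continuous r s t) (fc t)).
Qed.

Lemma integrable_mixedP_Qform r s :
  mu.-integrable setT (EFin \o (fun t : borel T => K r s t * q t)).
Proof. exact: Ki q_continuous. Qed.

(** This is the coefficient of [y ^+ i * yb ^+ j] in the vanishing integral of
    the divergence. *)
Lemma null_frame_minkowski i j : (i + j <= m)%N ->
  (m%:R - (i + j)%:R) * (\int[mu]_(t in [set: borel T]) (K i j t * xi t))
  + (i + j).+1%:R / 2 * (\int[mu]_(t in [set: borel T]) (K i.+1 j t * q t)) = 0.
Proof.
move=> ij; have Kz (k : R) (r s : nat) (f : T -> R) : continuous f ->
    mu.-integrable setT (EFin \o (fun t : borel T => k * (K r s t * f t))).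
  move=> fc; have := integrableZl measurableT k (@Ki r s f fc).
  by congr (_ .-integrable _ _); apply/funext => t /=; rewrite -EFinM.
have := bidegree_coef_eq0 (A := fun i j => \int[mu]_(t in [set: borel T]) Gcoef i j t)
  sum_integral_eq0 ij.
have fact0 : ((i + j)`!)%:R / (i`! * j`!)%:R != 0 :> R.
  by rewrite mulf_neq0 ?invr_eq0 // pnatr_eq0 -lt0n ?muln_gt0 ?fact_gt0.
have Kxi := @Ki i j xi xi_continuous; have Kq := @Ki i.+1 j q q_continuous.
rewrite /Gcoef RintegralZl //; last first.
  have := integrableD measurableT (Kz (m%:R - (i + j)%:R) i j xi xi_continuous)
    (Kz ((i + j).+1%:R / 2) i.+1 j q q_continuous).
  by congr (_ .-integrable _ _).
move=> /eqP; rewrite mulf_eq0 (negbTE fact0) /= => /eqP <-.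
rewrite RintegralD //; try exact: Kz.
by rewrite !RintegralZl.
Qed.

End Minkowski.

Section FrameSwap.
Context {R : realType} {m : nat} {T : ptopologicalType}.
Variables (kappa : R) (S : manifold R m T) (F L Lb : T -> 'rV[R]_m.+2).
Local Notation g := (static_metric kappa).
Local Notation U p := (chart_image S p).
Local Notation X p := (F \o param S p).
Hypotheses (F_smooth : smooth_map S F) (F_static : forall t, static_domain kappa (F t)).

Lemma torsion_free_frame : torsion_free S g F L Lb -> forall p x a, U p x ->
  g (X p x) (cov kappa (X p) (L \o param S p) a x) (Lb (param S p x)) = 0.
Proof.
move=> tf p x a Ux; have := tf p x Ux (basis_vec a); rewrite /torsion.
have Xf : lapse2 kappa (X p x) != 0 by exact: F_static.
rewrite /cov_deriv_along (cov_deriv_static _ _ Xf) => /eqP.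
by rewrite mulf_eq0 invr_eq0 pnatr_eq0 /= => /eqP.
Qed.

Lemma null_frame_swap : null_frame S g F L Lb -> null_frame S g F Lb L.
Proof.
move=> [nL nLb nf]; split => // p; have [h1 h2 h3] := nf p.
by split => //; rewrite static_metricC.
Qed.

(** The torsion changes sign when the null vectors are exchanged, because
    their product is constant. *)
Lemma torsion_swap : smooth_map S L -> smooth_map S Lb -> null_frame S g F L Lb ->
  (forall p x a, U p x ->
    g (X p x) (cov kappa (X p) (L \o param S p) a x) (Lb (param S p x)) = 0) ->
  forall p x a, U p x ->
  g (X p x) (cov kappa (X p) (Lb \o param S p) a x) (L (param S p x)) = 0.
Proof.
move=> L_smooth Lb_smooth [_ _ nf] tf p x a Ux.
have Xf y : U p y -> lapse2 kappa (X p y) != 0 by move=> _; exact: F_static.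
have h := is_derive_g Xf (@F_smooth p) a (smooth_C1vec (L_smooth p))
  (smooth_C1vec (Lb_smooth p)) Ux.
have c y : U p y -> g (X p y) (L (param S p y)) (Lb (param S p y)) = - 2.
  by move=> _; case: (nf (param S p y)).
have E := is_derive_constant_on (@U_open _ _ _ S p) c Ux h.
by rewrite static_metricC; move: E; rewrite tf // add0r.
Qed.

Lemma mixedP_swap r s p : mixedP S g F Lb L s r p = mixedP S g F L Lb r s p.
Proof.
rewrite /mixedP /mixed_mean_curvature mixed_detC coef_swapXY; congr (_ * _ / _).
by rewrite mulnC addnC.
Qed.

End FrameSwap.

Theorem theoremD (R : realType) (kappa : R) (n : nat)
    (T : ptopologicalType) (S : manifold R n.-1 T)
    (F L Lb : T -> 'rV[R]_n.+1)
    (mu : {measure set (g_sigma_algebraType (@open T)) -> \bar R})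
    (r s : nat)
    (T_hausdorff : hausdorff_space T)
    (T_compact : compact [set: T])
    (F_smooth : smooth_map S F)
    (F_static : forall p : T, static_domain kappa (F p))
    (F_spacelike : spacelike S (static_metric kappa) F)
    (L_smooth : smooth_map S L)
    (Lb_smooth : smooth_map S Lb)
    (LLb_null_frame : null_frame S (static_metric kappa) F L Lb)
    (LLb_torsion_free : torsion_free S (static_metric kappa) F L Lb)
    (mu_area : area_measure S (static_metric kappa) F mu)
    (rs_bounds : (1 <= r + s <= n.-1)%N) :
  ((1 <= r)%N ->
     2 * (\int[mu]_(p in [set: g_sigma_algebraType (@open T)])
            (mixedP S (static_metric kappa) F L Lb r.-1 s p
             * static_metric kappa (F p) (L p) partial_t))
     + (r + s)%:R / (n - (r + s))%:R
       * (\int[mu]_(p in [set: g_sigma_algebraType (@open T)])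
            (mixedP S (static_metric kappa) F L Lb r s p
             * Qform (F p) (L p) (Lb p)))
     = 0) /\
  ((1 <= s)%N ->
     2 * (\int[mu]_(p in [set: g_sigma_algebraType (@open T)])
            (mixedP S (static_metric kappa) F L Lb r s.-1 p
             * static_metric kappa (F p) (Lb p) partial_t))
     - (r + s)%:R / (n - (r + s))%:R
       * (\int[mu]_(p in [set: g_sigma_algebraType (@open T)])
            (mixedP S (static_metric kappa) F L Lb r s p
             * Qform (F p) (L p) (Lb p)))
     = 0).
Proof.
case: n => [|m] in S F L Lb F_smooth F_static F_spacelike L_smooth Lb_smooth
  LLb_null_frame LLb_torsion_free mu_area rs_bounds *.
  by case/andP: rs_bounds; case: (r + s)%N.
move: rs_bounds => /= /andP[_ rsm].
have tL := torsion_free_frame F_static LLb_torsion_free.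
have tLb := torsion_swap F_smooth F_static L_smooth Lb_smooth LLb_null_frame tL.
have solve (k : nat) (A B : R) :
    (m%:R - k%:R) * A + k.+1%:R / 2 * B = 0 -> (k.+1 <= m)%N ->
    2 * A + k.+1%:R / (m.+1 - k.+1)%:R * B = 0.
  move=> E km; have d0 : (m%:R - k%:R : R) != 0 by rewrite subr_eq0 eqr_nat; lia.
  rewrite subSS natrB ?(ltnW km) //; apply: (mulfI d0); rewrite mulr0.
  transitivity (2 * ((m%:R - k%:R) * A + k.+1%:R / 2 * B)); last by rewrite E mulr0.
  by field.
split.
- case: r rsm => // r rsm _; rewrite addSn in rsm *; rewrite -pred_Sn.
  apply: solve => //.
  exact: (null_frame_minkowski T_hausdorff T_compact F_smooth F_static F_spacelike
    L_smooth Lb_smooth LLb_null_frame tL mu_area (ltnW rsm)).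
- case: s rsm => // s rsm _; rewrite addnS addnC in rsm *; rewrite -pred_Sn.
  have := null_frame_minkowski T_hausdorff T_compact F_smooth F_static F_spacelike
    Lb_smooth L_smooth (null_frame_swap LLb_null_frame) tLb mu_area (ltnW rsm).
  have Qi := integrable_mixedP_Qform T_hausdorff T_compact F_smooth F_static F_spacelike
    L_smooth Lb_smooth mu_area r s.+1.
  under eq_Rintegral do rewrite mixedP_swap.
  under [in X in _ + X]eq_Rintegral do rewrite mixedP_swap QformC mulrN -mulN1r.
  rewrite RintegralZl // mulN1r => E.
  by rewrite -mulrN; exact: solve E rsm.
Qed.
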